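(* There exists a Banach space $Y$ with separable dual which is universal for the class $\mathcal{C}_{\mathrm{aus}}$ of all separable reflexive Banach spaces having an equivalent a.u.s. norm, i.e. every member of $\mathcal{C}_{\mathrm{aus}}$ is isomorphic to a closed subspace of $Y$. Moreover, $Y$ is the $\ell_2$-sum of a sequence of a.u.s. spaces.
   Context: Banach spaces are real, separable and infinite dimensional. $\operatorname{cof}(X)$ is the set of closed finite codimensional subspaces of $X$ and $B_V$ is the unit ball of $V$. For $t>0$, $\bar\rho_X(t)=\sup_{\|x\|=1}\inf_{V\in\operatorname{cof}(X)}\sup_{y\in tB_V}\|x+y\|-1$. $X$ is a.u.s. (asymptotically uniformly smooth) if $\lim_{t\to0^+}\bar\rho_X(t)/t=0$. *)

(* Defs.v *)
From HB Require Import structures.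
From mathcomp Require Import all_boot all_order all_algebra.
From mathcomp Require Import all_classical all_reals all_analysis.

Set Implicit Arguments.
Unset Strict Implicit.
Unset Printing Implicit Defensive.

Import Order.TTheory GRing.Theory Num.Theory.
Import numFieldNormedType.Exports.

Local Open Scope classical_set_scope.
Local Open Scope ring_scope.

Section dual_space.
Context {R : realType} (X : normedModType R).

Definition is_functional : {pred X -> R^o} :=
  fun f => `[< linear f /\ continuous f >].

Record dual := Dual {
  dual_fun :> X -> R^o;
  dual_is_functional : is_functional dual_fun }.

HB.instance Definition _ := [isSub for dual_fun].
HB.instance Definition _ := [Choice of dual by <:].

Lemma is_functionalP (f : X -> R^o) :
  f \in is_functional <-> linear f /\ continuous f.
Proof. by split=> [/asboolP|?]//; apply/asboolP. Qed.

Lemma is_functional_submod : submod_closed is_functional.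
Proof.
split=> [|a f g].
  apply/is_functionalP; split; last exact: (@cst_continuous X R^o 0).
  by move=> a x y; rewrite /= scaler0 addr0.
move=> /is_functionalP[lf cf] /is_functionalP[lg cg].
apply/is_functionalP; split=> [b x y|x].
  rewrite !fctE lf lg !scalerDr !scalerA [b * a]mulrC -!addrA.
  by congr (_ + _); rewrite addrCA.
apply: (@continuousD _ R^o X (a *: f) g) => //; last exact: cg.
by apply: (@continuousZl_tmp _ R^o); exact: cf.
Qed.

HB.instance Definition _ :=
  GRing.isSubmodClosed.Build _ _ is_functional is_functional_submod.
HB.instance Definition _ := [SubChoice_isSubLmodule of dual by <:].

Lemma dual_linear (f : dual) : linear f.
Proof. by have /is_functionalP[] := dual_is_functional f. Qed.

Lemma dual_continuous (f : dual) : continuous f.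
Proof. by have /is_functionalP[] := dual_is_functional f. Qed.

HB.instance Definition _ (f : dual) :=
  GRing.isLinear.Build R X R^o *:%R f (dual_linear f).

Definition dual_norm (f : dual) : R :=
  sup [set `|f x| | x in [set x : X | `|x| <= 1]].

Let has_sup_dual (f : dual) :
  has_sup [set `|f x| | x in [set x : X | `|x| <= 1]].
Proof.
split; first by exists `|f 0|, 0; rewrite //= normr0.
have /(linear_bounded_continuous f)/bounded_funP/(_ 1)[M fM] :=
  @dual_continuous f.
by exists M => _ [x x1 <-]; exact: fM.
Qed.

Let dual_norm_ub (f : dual) (x : X) : `|x| <= 1 -> `|f x| <= dual_norm f.
Proof. by move=> x1; apply: sup_upper_bound => //; exists x. Qed.

Let dual_normD (f g : dual) : dual_norm (f + g) <= dual_norm f + dual_norm g.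
Proof.
apply: ge_sup; first by have [] := has_sup_dual (f + g).
move=> _ [x x1 <-]; rewrite (le_trans (ler_normD (f x) (g x)))//.
by rewrite lerD// dual_norm_ub.
Qed.

Let dual_normZ_le a (f : dual) : dual_norm (a *: f) <= `|a| * dual_norm f.
Proof.
apply: ge_sup; first by have [] := has_sup_dual (a *: f).
by move=> _ [x x1 <-]; rewrite [leLHS]normrM ler_wpM2l// dual_norm_ub.
Qed.

Let dual_normZ a (f : dual) : dual_norm (a *: f) = `|a| * dual_norm f.
Proof.
apply/le_anti; rewrite dual_normZ_le/=; have [->|a0] := eqVneq a 0.
  rewrite normr0 mul0r (le_trans _ (@dual_norm_ub (0 *: f) 0 _))//.
  by rewrite normr0.
rewrite -ler_pdivlMl ?normr_gt0// -normfV -[X in dual_norm X](scalerK a0 f).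
exact: dual_normZ_le.
Qed.

Let dual_norm_eq0 (f : dual) : dual_norm f = 0 -> f = 0.
Proof.
move=> f0; apply/val_inj/funext => x /=.
have [->|x0] := eqVneq x 0; first by rewrite linear0.
have nx0 : `|x| != 0 by rewrite normr_eq0.
have /dual_norm_ub : `| `|x|^-1 *: x| <= 1.
  by rewrite normrZ normfV normr_id mulVf.
move=> /(_ f); rewrite f0 linearZ/= normr_le0 => /eqP/(congr1 ( *:%R `|x|)).
by rewrite scalerA divff// scale1r scaler0.
Qed.

HB.instance Definition _ :=
  @Lmodule_isNormed.Build R dual dual_norm dual_normD dual_normZ dual_norm_eq0.

End dual_space.

Section banach_notions.
Context {R : realType}.

Definition separable_space (T : topologicalType) :=
  exists D : set T, countable D /\ dense D.

Definition reflexive_space (X : normedModType R) :=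
  forall phi : dual (dual X), exists x : X, forall f : dual X, phi f = f x.

Definition finite_codim (X : lmodType R) (V : set X) :=
  exists n (e : 'I_n -> X), forall x, exists c : 'I_n -> R,
    V (x - \sum_(i < n) c i *: e i).

Definition infinite_dim (X : lmodType R) := ~ finite_codim [set 0 : X].

Definition cof (X : normedModType R) : set (set X) :=
  [set V | [/\ submod_closed (mem V), closed V & finite_codim V]].
Arguments cof : clear implicits.

(* A norm on X is passed as an explicit function N because equivalent norms on
   the same space are needed below; cof X is the same for all of them. *)
Definition aus_modulus (X : normedModType R) (N : X -> R) (t : R) : \bar R :=
  (ereal_sup [set
     ereal_inf [set
       ereal_sup [set (N (x + t *: y))%:E | y in V `&` [set y | N y <= 1]%R]
     | V in cof X]
   | x in [set x | N x = 1%R]] - 1)%E.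

Definition aus (X : normedModType R) (N : X -> R) :=
  (aus_modulus N t * (t^-1)%:E)%E @[t --> 0^'+] --> 0%E.

Definition equivalent_norm (X : normedModType R) (N : X -> R) :=
  [/\ forall x y, N (x + y) <= N x + N y,
      forall a x, N (a *: x) = `|a| * N x
    & exists c C : R, 0 < c /\ forall x, c * `|x| <= N x <= C * `|x|].

(* The bounds make T an isomorphism onto its range. *)
Definition iso_closed_subspace (X Y : normedModType R) :=
  exists T : {linear X -> Y}, closed (range T) /\
    exists c C : R, 0 < c /\ forall x, c * `|x| <= `|T x| <= C * `|x|.

(* J n is the n-th coordinate map: y |-> (J n y)_n is an isometric
   isomorphism of Y onto the space of square-summable families. *)
Definition is_l2_sum (Y : normedModType R) (E : nat -> normedModType R) :=
  exists J : forall n, {linear Y -> E n},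
    (forall y, series (fun n => `|J n y| ^+ 2) @ \oo --> `|y| ^+ 2) /\
    (forall e : forall n, E n, cvgn (series (fun n => `|e n| ^+ 2)) ->
       exists y, forall n, J n y = e n).

End banach_notions.

(* Main.v *)
(* For q >= 1 let E_q be the closure of the finitely supported functions z on a
   countable tree for the norm sup |sum_I z| / w(I)^(1/q), where I runs through the
   segments of branches and w(I) is the sum of the weights of the nodes of I. The
   weights are additive, so x and t y supported on consecutive segments combine as
   a + t b with a^q + b^q <= 1, and E_q is a.u.s.; for the same reason a functional
   on E_q is small beyond a finite subtree, hence the dual is separable. Y is the
   l_2-sum of the E_q.

   To embed X, approximate each f in the dual ball by h_0 = 0, h_1, h_2, ... taken
   from a norm dense sequence so that h_i has finitely many values and f - h_i lies,
   up to a small norm error, in a weak* neighbourhood of 0 chosen after h_i; weak*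
   compactness provides such h_i. Asymptotic smoothness of X makes the dual norm
   grow by a fixed factor when comparable increments h_j - h_i and h_k - h_j are
   added, so the q-variation of (h_i) is bounded for some q depending on X only.
   Take it as the weight of the path (h_i): then x |-> (h_i(x) - h_(i-1)(x)) embeds
   X into E_q. *)
Require Import Defs.
From HB Require Import structures.
From mathcomp Require Import all_boot all_order all_algebra.
From mathcomp Require Import all_classical all_reals all_analysis.
From mathcomp Require Import ssrAC lra.

Set Implicit Arguments.
Unset Strict Implicit.
Unset Printing Implicit Defensive.

Import Order.TTheory GRing.Theory Num.Theory.
Import numFieldNormedType.Exports.

Local Open Scope classical_set_scope.
Local Open Scope ring_scope.

(** * Banach spaces defined by gauges *)

(** One countable tree must serve every X and every equivalent norm, so nothing of X may enter the
    norm of E_q. A node carries natural numbers only: its label is an index into a dense sequence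
    that each X chooses for itself, and its weight is read off the last letter and the depth.
    Rounding the increments of the variation up to multiples of 2^-depth adds a bounded amount to
    the weight of a path and keeps every weight at least 2^-depth. This confines the image to the
    closure of the finitely supported functions: on a dense sequence of X the increments along paths
    decay like 4^-i, and each depth has finitely many path nodes. That finiteness requires test
    vectors common to all f, so the weak* neighbourhoods are built level by level for all candidates
    h_i at once. Reflexivity makes the dual separable, which provides the labels. The exponent q
    depends on the smoothness of X, hence a sequence of spaces. The smoothness of E_q degrades as q
    grows, so functionals on Y are handled by splitting off first the far summands, then in each
    remaining summand the nodes outside a finite subtree. *)

Lemma eventually_invn_lt (R : realType) (e : R) : 0 < e ->
  exists N : nat, forall n, (N <= n)%N -> n.+1%:R^-1 < e.
Proof.
move=> e0; exists (Num.bound e^-1) => n Nn.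
rewrite -[ltRHS]invrK ltf_pV2 ?posrE ?invr_gt0// ?ltr0n//.
rewrite (lt_le_trans (archi_boundP _))// ?invr_ge0 ?(ltW e0)// ler_nat.
exact: leqW.
Qed.

(** An extended norm given by its closed sublevel sets: [gauge_le x r] is read as norm of [x] at
    most [r], and vectors with no admissible [r] are left out of [gspace]. A norm can thus be
    introduced as a list of conditions on a plain function space. *)
Record gauge (R : realType) (L : lmodType R) := Gauge {
  gauge_le :> L -> R -> Prop;
  gauge00 : gauge_le 0 0;
  gauge_ge0 : forall x r, gauge_le x r -> 0 <= r;
  gauge_mono : forall x r s, gauge_le x r -> r <= s -> gauge_le x s;
  gaugeD : forall x y r s,
    gauge_le x r -> gauge_le y s -> gauge_le (x + y) (r + s);
  gaugeZ : forall a x r, gauge_le x r -> gauge_le (a *: x) (`|a| * r);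
  gauge_eq0 : forall x, gauge_le x 0 -> x = 0;
  gauge_closed : forall x r,
    (forall e, 0 < e -> gauge_le x (r + e)) -> gauge_le x r;
  gauge_complete : forall u : nat -> L,
    (forall e, 0 < e -> exists N, forall m n,
       (N <= m)%N -> (N <= n)%N -> gauge_le (u m - u n) e) ->
    exists l, forall e, 0 < e -> exists N, forall n,
       (N <= n)%N -> gauge_le (u n - l) e }.

Section gauge_space.
Context {R : realType} {L : lmodType R} (g : gauge L).

Definition gauge_fin : {pred L} := fun x => `[< exists r, g x r >].

Record gspace := Gspace { gval :> L; gval_fin : gauge_fin gval }.

HB.instance Definition _ := [isSub for gval].
HB.instance Definition _ := [Choice of gspace by <:].

Lemma gauge_finP x : x \in gauge_fin <-> exists r, g x r.
Proof. by split=> [/asboolP|?]//; apply/asboolP. Qed.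

Lemma gauge_fin_submod : submod_closed gauge_fin.
Proof.
split=> [|a x y]; first by apply/gauge_finP; exists 0; exact: gauge00.
move=> /gauge_finP[r xr] /gauge_finP[s ys].
by apply/gauge_finP; exists (`|a| * r + s); apply: gaugeD => //; exact: gaugeZ.
Qed.

HB.instance Definition _ :=
  GRing.isSubmodClosed.Build _ _ gauge_fin gauge_fin_submod.
HB.instance Definition _ := [SubChoice_isSubLmodule of gspace by <:].

Definition gauge_inf (x : L) : R := inf [set r | g x r].

(** [gauge_closed] makes the infimum attained, so bounding the norm amounts to checking the gauge
    conditions. *)
Lemma gauge_inf_le x r : x \in gauge_fin -> gauge_inf x <= r <-> g x r.
Proof.
move=> /gauge_finP[r0 gr0].
have hi : has_inf [set r | g x r].
  by split; [exists r0|exists 0 => y /= /gauge_ge0].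
split=> [xr|xr]; last first.
  by apply: ge_inf => //; case: hi.
apply: gauge_closed => e e0.
have [s /= gs sl] := inf_adherent e0 hi.
apply: gauge_mono gs _; apply/ltW/(lt_le_trans sl).
by rewrite lerD2r.
Qed.

Definition gauge_norm (x : gspace) : R := gauge_inf (val x).

Lemma gauge_norm_le (x : gspace) r : gauge_norm x <= r <-> g (val x) r.
Proof. by apply: gauge_inf_le; exact: gval_fin. Qed.

Lemma gauge_norm_self (x : gspace) : g (val x) (gauge_norm x).
Proof. exact/gauge_norm_le. Qed.

Lemma gauge_normD (x y : gspace) :
  gauge_norm (x + y) <= gauge_norm x + gauge_norm y.
Proof. by apply/gauge_norm_le/gaugeD; exact: gauge_norm_self. Qed.

Lemma gauge_normZ a (x : gspace) : gauge_norm (a *: x) = `|a| * gauge_norm x.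
Proof.
have le b (y : gspace) : gauge_norm (b *: y) <= `|b| * gauge_norm y.
  by apply/gauge_norm_le/gaugeZ; exact: gauge_norm_self.
apply/le_anti; rewrite le/=; have [->|a0] := eqVneq a 0.
  by rewrite normr0 mul0r; exact: gauge_ge0 (gauge_norm_self _).
rewrite -ler_pdivlMl ?normr_gt0// -normfV -[X in gauge_norm X <= _](scalerK a0).
exact: le.
Qed.

Lemma gauge_norm_eq0 (x : gspace) : gauge_norm x = 0 -> x = 0.
Proof.
move=> x0; apply/val_inj/(@gauge_eq0 _ _ g).
by rewrite -x0; exact: gauge_norm_self.
Qed.

HB.instance Definition _ :=
  @Lmodule_isNormed.Build R gspace gauge_norm gauge_normD gauge_normZ
    gauge_norm_eq0.

Lemma gspace_norm_le (x : gspace) r : `|x| <= r <-> g (val x) r.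
Proof. exact: gauge_norm_le. Qed.

Lemma gspace_complete (F : set_system gspace) :
  ProperFilter F -> cauchy F -> cvg F.
Proof.
move=> FF /cauchyP Fc.
have /choice[u uP] (n : nat) : exists x, F (ball x (n.+1%:R^-1 : R)).
  by apply: Fc.
have udist m n : `|u m - u n| <= m.+1%:R^-1 + n.+1%:R^-1.
  have : F (ball (u m) (m.+1%:R^-1 : R) `&` ball (u n) (n.+1%:R^-1 : R)).
    exact: filterI.
  move=> /filter_ex[z []]; rewrite -!ball_normE /ball_/= => h1 h2.
  have -> : u m - u n = (u m - z) - (u n - z) by rewrite opprB addrA subrK.
  by rewrite (le_trans (ler_normB _ _))// lerD// ltW.
have [|l ul] := @gauge_complete _ _ g (fun n => val (u n)).
  move=> e e0; have [|N NP] := @eventually_invn_lt R (e / 2);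
    first by rewrite divr_gt0.
  exists N => m n Nm Nn.
  rewrite -(gspace_norm_le (u m - u n)) (le_trans (udist m n))//.
  by rewrite [leRHS]splitr lerD// ltW// NP.
(* The limit is found in the ambient space [L]; its gauge is finite because it is at distance at
   most 1 from some [u N]. *)
have fl : l \in gauge_fin.
  have [N /(_ _ (leqnn _)) h] := ul 1 ltr01.
  rewrite -[l](subKr (val (u N))); apply: rpredB; first exact: gval_fin.
  by apply/gauge_finP; exists 1.
apply/cvg_ex; exists (Gspace fl).
apply/cvgrPdist_lt => e e0.
have [|N1 N1P] := @eventually_invn_lt R (e / 2); first by rewrite divr_gt0.
have [|N2 N2P] := ul (e / 2 / 2); first by rewrite !divr_gt0.
pose n := maxn N1 N2.
have := uP n; apply: filterS => y; rewrite -ball_normE /ball_/= => uy.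
have h2 : `|u n - Gspace fl| <= e / 2 / 2.
  by apply/gspace_norm_le/N2P; rewrite leq_maxr.
have -> : Gspace fl - y = (u n - y) - (u n - Gspace fl).
  by rewrite opprB [RHS]addrC addrA subrK.
rewrite (le_lt_trans (ler_normB _ _))// [ltRHS]splitr ltr_leD//.
  by rewrite (lt_le_trans uy)// ltW// N1P// leq_maxl.
by rewrite (le_trans h2)// ler_pdivrMr// ler_peMr ?divr_ge0 ?(ltW e0)// ler1n.
Qed.

HB.instance Definition _ := Uniform_isComplete.Build gspace gspace_complete.

End gauge_space.

Definition gauge_banach (R : realType) (L : lmodType R) (g : gauge L) :
  completeNormedModType R := gspace g.

(** * Tree gauges *)

Lemma ler_addeM (R : realFieldType) (x a c : R) :
  0 <= c -> (forall e, 0 < e -> x <= a + e * c) -> x <= a.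
Proof.
move=> c0 h; apply/ler_addgt0Pr => e e0.
have c1 : 0 < c + 1 by rewrite ltr_wpDl.
apply: (le_trans (h (e / (c + 1)) _)); first by rewrite divr_gt0.
by rewrite lerD2l mulrAC ler_pdivrMr// ler_pM2l// lerDl ler01.
Qed.

Lemma cauchy_real_cvg (R : realType) (v : nat -> R) :
  (forall e, 0 < e -> exists N, forall m n,
    (N <= m)%N -> (N <= n)%N -> `|v m - v n| <= e) ->
  exists l : R, v @ \oo --> l.
Proof.
move=> h; suff vc : cvgn v by exists (limn v).
apply/cauchy_cvgP/cauchy_exP => e e0.
have [|N NP] := h (e / 2); first by rewrite divr_gt0.
exists (v N), N => // n /= Nn; rewrite -ball_normE /ball_/=.
by rewrite (le_lt_trans (NP _ _ _ Nn))// ltr_pdivrMr// ltr_pMr// ltr1n.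
Qed.

Lemma cvgn_sum (R : realType) (I : Type) (r : seq I) (f : nat -> I -> R) g :
  (forall i, f n i @[n --> \oo] --> g i) ->
  (\sum_(i <- r) f n i) @[n --> \oo] --> \sum_(i <- r) g i.
Proof.
move=> h; elim: r => [|i r IH].
  rewrite big_nil; under eq_fun do rewrite big_nil; exact: cvg_cst.
rewrite big_cons; under eq_fun do rewrite big_cons; exact: cvgD.
Qed.

Section tree_gauge.
Context {R : realType}.
Implicit Types (b : nat -> nat * nat) (m n k : nat) (s : seq (nat * nat)).

(* A node carries a label and a numerator in each letter; the label will name a
   functional and the numerator encodes the weight of the node. *)
Definition weight s : R := (last (0, 0)%N s).2.+1%:R / 2 ^+ size s.

Lemma weight_gt0 s : 0 < weight s.
Proof. by rewrite divr_gt0// ?ltr0n// exprn_gt0. Qed.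

Definition wsum b m n : R := \sum_(m <= i < n) weight (mkseq b i).

Lemma wsum_ge0 b m n : 0 <= wsum b m n.
Proof. by rewrite sumr_ge0// => i _; rewrite ltW// weight_gt0. Qed.

Lemma wsum_cat b m k n : (m <= k <= n)%N ->
  wsum b m n = wsum b m k + wsum b k n.
Proof. by move=> /andP[mk kn]; rewrite /wsum (big_cat_nat mk kn). Qed.

Definition zsum (z : seq (nat * nat) -> R) b m n : R :=
  \sum_(m <= i < n) z (mkseq b i).

Lemma zsum_cat z b m k n : (m <= k <= n)%N ->
  zsum z b m n = zsum z b m k + zsum z b k n.
Proof. by move=> /andP[mk kn]; rewrite /zsum (big_cat_nat mk kn). Qed.

Lemma zsum_geq z b m n : (n <= m)%N -> zsum z b m n = 0.
Proof. by move=> nm; rewrite /zsum big_geq. Qed.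

Lemma zsumD z1 z2 b m n : zsum (z1 + z2) b m n = zsum z1 b m n + zsum z2 b m n.
Proof. by rewrite /zsum -big_split. Qed.

Lemma zsumZ a z b m n : zsum (a *: z) b m n = a * zsum z b m n.
Proof. by rewrite /zsum mulr_sumr. Qed.

Lemma zsumB z1 z2 b m n : zsum (z1 - z2) b m n = zsum z1 b m n - zsum z2 b m n.
Proof. by rewrite -scaleN1r zsumD zsumZ mulN1r. Qed.

Lemma zsum0 b m n : zsum 0 b m n = 0.
Proof. by rewrite /zsum big1. Qed.

(** Segments are intervals of infinite branches. The padding is arbitrary; it only turns the node
    [s] into a one-node segment of some branch. *)
Definition branch s i := nth (0, 0)%N s i.

Lemma mkseq_branch s : mkseq (branch s) (size s) = s.
Proof. exact: mkseq_nth. Qed.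

Lemma zsum1 z s : zsum z (branch s) (size s) (size s).+1 = z s.
Proof. by rewrite /zsum big_nat1 mkseq_branch. Qed.

Definition theta q b m n : R := wsum b m n `^ (q%:R^-1).

Lemma theta_ge0 q b m n : 0 <= theta q b m n.
Proof. exact: powR_ge0. Qed.

Lemma theta_gt0 q b m n : (m < n)%N -> 0 < theta q b m n.
Proof.
move=> mn; apply: powR_gt0; rewrite /wsum big_ltn//.
by rewrite ltr_pwDl ?weight_gt0//; exact: wsum_ge0.
Qed.

Lemma thetaX q b m n : (0 < q)%N -> theta q b m n ^+ q = wsum b m n.
Proof.
move=> q0; rewrite -powR_mulrn ?theta_ge0// /theta -powRrM mulVf ?pnatr_eq0
  -?lt0n//.
by rewrite powRr1// wsum_ge0.
Qed.

Lemma theta_cat q b m k n : (0 < q)%N -> (m <= k <= n)%N ->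
  theta q b m n ^+ q = theta q b m k ^+ q + theta q b k n ^+ q.
Proof. by move=> q0 mkn; rewrite !thetaX// (wsum_cat _ mkn). Qed.

Lemma theta_catl q b m k n : (0 < q)%N -> (m <= k <= n)%N ->
  theta q b m k <= theta q b m n.
Proof.
move=> q0 h; rewrite -(ler_pXn2r q0) ?nnegrE ?theta_ge0//.
by rewrite (theta_cat b q0 h) lerDl exprn_ge0 ?theta_ge0.
Qed.

Lemma theta_catr q b m k n : (0 < q)%N -> (m <= k <= n)%N ->
  theta q b k n <= theta q b m n.
Proof.
move=> q0 h; rewrite -(ler_pXn2r q0) ?nnegrE ?theta_ge0//.
by rewrite (theta_cat b q0 h) lerDr exprn_ge0 ?theta_ge0.
Qed.

Definition fin_supp (z : seq (nat * nat) -> R) :=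
  exists F : seq (seq (nat * nat)), forall s, s \notin F -> z s = 0.

Lemma fin_supp0 : fin_supp 0.
Proof. by exists [::]. Qed.

Lemma fin_suppD z1 z2 : fin_supp z1 -> fin_supp z2 -> fin_supp (z1 + z2).
Proof.
move=> [F1 h1] [F2 h2]; exists (F1 ++ F2) => s.
by rewrite mem_cat negb_or => /andP[/h1 + /h2]; rewrite fctE => -> ->;
  rewrite addr0.
Qed.

Lemma fin_suppZ a z : fin_supp z -> fin_supp (a *: z).
Proof. by move=> [F h]; exists F => s /h; rewrite fctE => ->; rewrite scaler0. Qed.

Definition tree_bound q (z : seq (nat * nat) -> R) r :=
  forall b m n, `|zsum z b m n| <= r * theta q b m n.

Definition tree_approx q z := forall e, 0 < e ->
  exists2 z0, fin_supp z0 & tree_bound q (z - z0) e.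

(** Putting approximability into the gauge makes its finite part the closure of the finitely
    supported functions. *)
Definition tree_le q z r := [/\ 0 <= r, tree_bound q z r & tree_approx q z].

Lemma tree_boundD q z1 z2 r1 r2 :
  tree_bound q z1 r1 -> tree_bound q z2 r2 -> tree_bound q (z1 + z2) (r1 + r2).
Proof.
by move=> h1 h2 b m n; rewrite zsumD mulrDl (le_trans (ler_normD _ _))// lerD.
Qed.

Lemma tree_boundZ q a z r : tree_bound q z r -> tree_bound q (a *: z) (`|a| * r).
Proof. by move=> h b m n; rewrite zsumZ normrM -mulrA ler_wpM2l. Qed.

Lemma tree_bound_mono q z r1 r2 : r1 <= r2 -> tree_bound q z r1 -> tree_bound q z
  r2.
Proof. by move=> r12 h b m n; rewrite (le_trans (h _ _ _))// ler_wpM2r//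
  theta_ge0. Qed.

Lemma tree_approxD q z1 z2 :
  tree_approx q z1 -> tree_approx q z2 -> tree_approx q (z1 + z2).
Proof.
move=> h1 h2 e e0; have e20 : 0 < e / 2 by rewrite divr_gt0.
have [y1 f1 b1] := h1 _ e20; have [y2 f2 b2] := h2 _ e20.
exists (y1 + y2); first exact: fin_suppD.
by rewrite [e]splitr opprD addrACA; exact: tree_boundD.
Qed.

Lemma tree_approxZ q a z : tree_approx q z -> tree_approx q (a *: z).
Proof.
move=> h e e0; have a0 : 0 < `|a| + 1 by rewrite ltr_wpDl.
have [|y f b] := h (e / (`|a| + 1)); first by rewrite divr_gt0.
exists (a *: y); first exact: fin_suppZ.
rewrite -scalerBr; apply: tree_bound_mono (tree_boundZ a b).
by rewrite mulrCA ler_piMr ?(ltW e0)// ler_pdivrMr// mul1r lerDl.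
Qed.

Lemma fin_supp_approx q z : fin_supp z -> tree_approx q z.
Proof.
move=> f e e0; exists z => // b m n.
by rewrite subrr zsum0 normr0 mulr_ge0 ?theta_ge0// ltW.
Qed.

Lemma tree_approx_closed q z :
  (forall e, 0 < e -> exists2 y, tree_approx q y & tree_bound q (z - y) e) ->
  tree_approx q z.
Proof.
move=> h e e0; have e20 : 0 < e / 2 by rewrite divr_gt0.
have [y1 f1 b1] := h _ e20; have [y2 f2 b2] := f1 _ e20.
exists y2 => //; rewrite [e]splitr -[z](subrK y1) -addrA.
exact: tree_boundD.
Qed.

Lemma tree_bound_closed q z r :
  (forall e, 0 < e -> tree_bound q z (r + e)) -> tree_bound q z r.
Proof.
move=> h b m n; apply: (ler_addeM (theta_ge0 q b m n)) => e e0.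
by rewrite -mulrDl; exact: h.
Qed.

Lemma tree_bound_coord q z r s :
  tree_bound q z r -> `|z s| <= r * theta q (branch s) (size s) (size s).+1.
Proof. by move=> h; rewrite -zsum1. Qed.

(** A single node is a segment of positive weight, so Cauchy sequences converge at every node.
    Segment sums are finite, so the bounds survive the pointwise limit. *)
Lemma tree_complete q (u : nat -> seq (nat * nat) -> R) :
  (forall e, 0 < e -> exists N, forall m n,
     (N <= m)%N -> (N <= n)%N -> tree_le q (u m - u n) e) ->
  exists l, forall e, 0 < e -> exists N, forall n,
     (N <= n)%N -> tree_le q (u n - l) e.
Proof.
move=> uc.
have /choice[l lP] s : exists l : R, (fun n => u n s) @ \oo --> l.
  apply: cauchy_real_cvg => e e0.
  set c := theta q (branch s) (size s) (size s).+1.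
  have c0 : 0 < c by exact: theta_gt0.
  have [|N NP] := uc (e / c); first by rewrite divr_gt0.
  exists N => m n Nm Nn; have [_ /(@tree_bound_coord _ _ _ s) + _] := NP _ _ Nm Nn.
  by rewrite fctE divfK// gt_eqF.
exists l.
have bd e : 0 < e -> exists N, forall n, (N <= n)%N -> tree_bound q (u n - l) e.
  move=> e0; have [N NP] := uc e e0; exists N => n Nn b m k.
  have h : `|zsum (u n - u p) b m k| @[p --> \oo] --> `|zsum (u n - l) b m k|.
    apply: cvg_norm; rewrite /zsum; apply: cvgn_sum => i.
    by apply: cvgB; [exact: cvg_cst|exact: lP].
  rewrite -(cvg_lim _ h)//; apply: limr_le; first by apply/cvg_ex; eexists;
    exact: h.
  by exists N => // p /= Np; have [_ + _] := NP _ _ Nn Np; exact.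
move=> e e0; have [N NP] := uc e e0; have [M MP] := bd e e0.
exists (maxn N M) => n; rewrite geq_max => /andP[Nn Mn]; split.
- exact: ltW.
- exact: MP.
- apply: tree_approx_closed => d d0; have [P PP] := bd d d0.
  exists (u n - u (maxn N P)).
    by have [|_ _] := NP n (maxn N P) Nn; first exact: leq_maxl.
  rewrite opprB addrC addrA subrK.
  by apply: PP; exact: leq_maxr.
Qed.

Definition tree_gauge (q : nat) : gauge (seq (nat * nat) -> R).
Proof.
refine (@Gauge R _ (tree_le q) _ _ _ _ _ _ _ _).
- split=> //; last exact: fin_supp_approx fin_supp0.
  by move=> b m n; rewrite zsum0 normr0 mul0r.
- by move=> x r [].
- move=> x r s [r0 h1 h2] rs; split => //; first exact: le_trans rs.
  exact: tree_bound_mono h1.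
- move=> x y r s [r0 h1 h2] [s0 h3 h4]; split; first exact: addr_ge0.
    exact: tree_boundD.
  exact: tree_approxD.
- move=> a x r [r0 h1 h2]; split; first exact: mulr_ge0.
    exact: tree_boundZ.
  exact: tree_approxZ.
- move=> x [_ /tree_bound_coord h _]; apply/funext => s; apply/eqP.
  by rewrite -normr_le0; have := h s; rewrite mul0r.
- move=> x r h; split.
  + by apply/ler_addgt0Pr => e /h[].
  + by apply: tree_bound_closed => e /h[].
  + by have [] := h 1 ltr01.
- exact: tree_complete.
Defined.

End tree_gauge.

(** * Square-summable families *)

(** Cauchy-Schwarz comes from summing the squares of [y * a n - x * b n], which needs radii x, y >
    0; [r] and [s] may vanish and are first enlarged by [d]. *)
Lemma minkowski2 (R : realType) (a b : nat -> R) (K : nat) (r s : R) :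
  0 <= r -> 0 <= s -> \sum_(n < K) a n ^+ 2 <= r ^+ 2 ->
  \sum_(n < K) b n ^+ 2 <= s ^+ 2 ->
  \sum_(n < K) (a n + b n) ^+ 2 <= (r + s) ^+ 2.
Proof.
move=> r0 s0 ar bs.
suff ab : \sum_(n < K) a n * b n <= r * s.
  have -> : \sum_(n < K) (a n + b n) ^+ 2 =
      \sum_(n < K) a n ^+ 2 + (\sum_(n < K) a n * b n) *+ 2 + \sum_(n < K) b n ^+ 2.
    by rewrite -sumrMnl -!big_split/=; apply: eq_bigr => i _; rewrite sqrrD.
  by rewrite sqrrD lerD// lerD// lerMn2r.
have key (x y : R) : 0 < x -> 0 < y -> \sum_(n < K) a n ^+ 2 <= x ^+ 2 ->
    \sum_(n < K) b n ^+ 2 <= y ^+ 2 -> \sum_(n < K) a n * b n <= x * y.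
  move=> x0 y0 ax bY.
  have xy0 : 0 < 2 * (x * y) by rewrite !mulr_gt0.
  rewrite -(ler_pM2l xy0).
  have h : 2 * (x * y) * (\sum_(n < K) a n * b n) <=
      y ^+ 2 * (\sum_(n < K) a n ^+ 2) + x ^+ 2 * (\sum_(n < K) b n ^+ 2).
    rewrite !mulr_sumr -big_split/=; apply: ler_sum => i _.
    have := sqr_ge0 (y * a i - x * b i); lra.
  apply: (le_trans h).
  have h1 : y ^+ 2 * (\sum_(n < K) a n ^+ 2) <= y ^+ 2 * x ^+ 2.
    by rewrite ler_wpM2l ?sqr_ge0.
  have h2 : x ^+ 2 * (\sum_(n < K) b n ^+ 2) <= x ^+ 2 * y ^+ 2.
    by rewrite ler_wpM2l ?sqr_ge0.
  lra.
have rs0 : 0 <= r + s + 1 by rewrite !addr_ge0.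
apply: (ler_addeM rs0) => e e0.
(* The cap at 1 makes the error [d * (r + s + d)] linear in [e]. *)
pose d := Num.min e 1.
have d0 : 0 < d by rewrite lt_min e0 ltr01.
apply: (le_trans (key (r + d) (s + d) _ _ _ _)).
- by rewrite ltr_wpDl.
- by rewrite ltr_wpDl.
- by rewrite (le_trans ar)// ler_pXn2r// ?nnegrE ?addr_ge0 ?(ltW d0)// lerDl ltW.
- by rewrite (le_trans bs)// ler_pXn2r// ?nnegrE ?addr_ge0 ?(ltW d0)// lerDl ltW.
have de : d <= e by rewrite ge_min lexx.
have d1 : d <= 1 by rewrite ge_min lexx orbT.
have : d * (r + s + d) <= e * (r + s + 1).
  by apply: ler_pM => //; [exact: ltW|rewrite !addr_ge0// ltW|rewrite lerD2l].
lra.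
Qed.

Lemma sqr_sum_le (R : realType) (a : nat -> R) (K : nat) (r : R) :
  (forall n, (n < K)%N -> 0 <= a n <= r) ->
  \sum_(n < K) a n ^+ 2 <= (K%:R * r) ^+ 2.
Proof.
case: K => [|K] h; first by rewrite big_ord0 sqr_ge0.
have r0 : 0 <= r by have /andP[] := h 0%N isT; exact: le_trans.
apply: (@le_trans _ _ (\sum_(n < K.+1) r ^+ 2)).
  apply: ler_sum => i _; have /andP[a0 ar] := h i (ltn_ord i).
  by rewrite ler_pXn2r.
rewrite sumr_const card_ord exprMn -[leLHS]mulr_natl ler_wpM2r ?sqr_ge0//.
by rewrite -natrX ler_nat leq_pmulr.
Qed.

Section l2_gauge.
Context {R : realType} {L : lmodType R} (g : nat -> gauge L).
Implicit Types (z : nat -> L).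

Definition l2_le z (r : R) := [/\ 0 <= r, forall n, z n \in gauge_fin (g n)
  & forall K, \sum_(n < K) gauge_inf (g n) (z n) ^+ 2 <= r ^+ 2].

Lemma gauge_inf_ge0 n x : x \in gauge_fin (g n) -> 0 <= gauge_inf (g n) x.
Proof. by move=> xf; apply: (@gauge_ge0 _ _ (g n) x); apply/gauge_inf_le. Qed.

Lemma gauge_infD n x y : x \in gauge_fin (g n) -> y \in gauge_fin (g n) ->
  gauge_inf (g n) (x + y) <= gauge_inf (g n) x + gauge_inf (g n) y.
Proof.
move=> xf yf; apply/gauge_inf_le; first exact: rpredD.
by apply: gaugeD; exact/gauge_inf_le.
Qed.

Lemma gauge_infZ n a x : x \in gauge_fin (g n) ->
  gauge_inf (g n) (a *: x) <= `|a| * gauge_inf (g n) x.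
Proof.
move=> xf; apply/gauge_inf_le; first exact: rpredZ.
by apply: gaugeZ; exact/gauge_inf_le.
Qed.

Lemma l2_leD z1 z2 r s : l2_le z1 r -> l2_le z2 s -> l2_le (z1 + z2) (r + s).
Proof.
move=> [r0 f1 h1] [s0 f2 h2]; split; first exact: addr_ge0.
  by move=> n; rewrite fctE rpredD.
move=> K; apply: le_trans (@minkowski2 _ (fun n => gauge_inf (g n) (z1 n))
  (fun n => gauge_inf (g n) (z2 n)) _ _ _ r0 s0 (h1 K) (h2 K)).
apply: ler_sum => i _; rewrite ler_pXn2r ?nnegrE ?addr_ge0 ?gauge_inf_ge0//.
  exact: gauge_infD.
by rewrite fctE rpredD.
Qed.

Lemma l2_le_coord z r n : l2_le z r -> g n (z n) r.
Proof.
move=> [r0 zf h]; apply/gauge_inf_le => //.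
rewrite -(@ler_pXn2r _ 2)// ?nnegrE ?gauge_inf_ge0//.
apply: le_trans (h n.+1); rewrite big_ord_recr/= lerDr.
by apply: sumr_ge0 => j _; exact: sqr_ge0.
Qed.

(** The limit is taken coordinatewise. For each K, an intermediate [u p] close to the limit on the
    first K coordinates transfers the Cauchy bound; p depends on K, the threshold for n does not. *)
Lemma l2_complete (u : nat -> nat -> L) :
  (forall e, 0 < e -> exists N, forall m n,
     (N <= m)%N -> (N <= n)%N -> l2_le (u m - u n) e) ->
  exists l, forall e, 0 < e -> exists N, forall n,
     (N <= n)%N -> l2_le (u n - l) e.
Proof.
move=> uc.
have /choice[l lP] i : exists l, forall e, 0 < e -> exists N, forall n,
     (N <= n)%N -> g i (u n i - l) e.
  apply: (@gauge_complete _ _ (g i) (fun n => u n i)) => e /uc[N NP].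
  by exists N => m n Nm Nn; exact: (l2_le_coord _ (NP m n Nm Nn)).
exists l => e e0; have e20 : 0 < e / 2 by rewrite divr_gt0.
have [N NP] := uc _ e20; exists N => n Nn.
have fin i p : (N <= p)%N -> (u p - l) i \in gauge_fin (g i).
  move=> Np; have [P PP] := lP i _ ltr01.
  have [_ f _] := NP p (maxn N P) Np (leq_maxl _ _).
  have -> : (u p - l) i = (u p - u (maxn N P)) i + (u (maxn N P) i - l i).
    by rewrite !fctE addrA subrK.
  apply: rpredD; first exact: f.
  by apply/gauge_finP; exists 1; apply: PP; exact: leq_maxr.
split; [exact: ltW|by move=> i; exact: fin|move=> K].
pose d := e / 2 / (K.+1)%:R.
have d0 : 0 < d by rewrite divr_gt0.
have [p [Np pP]] : exists p, (N <= p)%N /\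
    forall i, (i < K)%N -> g i (u p i - l i) d.
  have /choice[M MP] i := lP i d d0.
  exists (maxn N (\max_(i < K) M i)); split; first exact: leq_maxl.
  move=> i iK; apply: MP; apply: leq_trans (leq_maxr _ _).
  exact: (@leq_bigmax _ (fun i : 'I_K => M i) (Ordinal iK)).
have [_ f2 h2] := NP n p Nn Np.
have h3 : \sum_(i < K) gauge_inf (g i) ((u p - l) i) ^+ 2 <= (e / 2) ^+ 2.
  apply: (@le_trans _ _ ((K%:R * d) ^+ 2)).
    apply: (@sqr_sum_le _ (fun i => gauge_inf (g i) ((u p - l) i))) => i iK.
    rewrite gauge_inf_ge0 ?fin//=; apply/gauge_inf_le; [exact: fin|exact: pP].
  rewrite ler_pXn2r ?nnegrE ?mulr_ge0 ?(ltW d0) ?(ltW e0) ?invr_ge0//.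
  by rewrite mulrCA ler_piMr ?(ltW e20)// ler_pdivrMr// mul1r ler_nat.
rewrite [e]splitr; apply: le_trans (@minkowski2 _
  (fun i => gauge_inf (g i) ((u n - u p) i))
  (fun i => gauge_inf (g i) ((u p - l) i)) _ _ _ (ltW e20) (ltW e20) (h2 K) h3).
apply: ler_sum => i _; rewrite ler_pXn2r ?nnegrE ?addr_ge0 ?gauge_inf_ge0 ?fin//.
have -> : (u n - l) i = (u n - u p) i + (u p - l) i.
  by rewrite !fctE addrA subrK.
by apply: gauge_infD => //; exact: fin.
Qed.

Definition l2_gauge : gauge (nat -> L).
Proof.
refine (@Gauge R _ l2_le _ _ _ _ _ _ _ l2_complete).
- split=> [//|n|K]; first exact: rpred0.
  rewrite big1 ?expr0n// => i _; apply/eqP; rewrite sqrf_eq0 eq_le.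
  rewrite gauge_inf_ge0 ?rpred0// andbT; apply/gauge_inf_le; first exact: rpred0.
  exact: gauge00.
- by move=> x r [].
- move=> x r s [r0 h1 h2] rs; split => //; first exact: le_trans rs.
  by move=> K; rewrite (le_trans (h2 K))// ler_pXn2r// nnegrE// (le_trans r0).
- exact: l2_leD.
- move=> a x r [r0 h1 h2]; split; first exact: mulr_ge0.
    by move=> n; rewrite fctE rpredZ.
  move=> K; rewrite exprMn; apply: le_trans (ler_wpM2l (sqr_ge0 _) (h2 K)).
  rewrite mulr_sumr; apply: ler_sum => i _; rewrite -exprMn.
  rewrite ler_pXn2r ?nnegrE ?mulr_ge0 ?gauge_inf_ge0 ?fctE ?rpredZ//.
  exact: gauge_infZ.
- move=> x [_ h1 h2]; apply/funext => n.
  apply: (@gauge_eq0 _ _ (g n)); apply/gauge_inf_le => //.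
  have := h2 n.+1; rewrite expr0n big_ord_recr/= => h.
  have : gauge_inf (g n) (x n) ^+ 2 <= 0.
    by apply: le_trans h; rewrite lerDr sumr_ge0// => i _; exact: sqr_ge0.
  move=> h3; have /eqP : gauge_inf (g n) (x n) ^+ 2 == 0.
    by rewrite eq_le h3 sqr_ge0.
  by move/eqP; rewrite sqrf_eq0 => /eqP ->.
- move=> x r h; split.
  + by apply/ler_addgt0Pr => e /h[].
  + by have [] := h 1 ltr01.
  + have r0 : 0 <= r by apply/ler_addgt0Pr => e /h[].
    move=> K; have c0 : 0 <= 2 * r + 1 by lra.
    apply: (ler_addeM c0) => e e0; pose d := Num.min e 1.
    have d0 : 0 < d by rewrite lt_min e0 ltr01.
    have [_ _ /(_ K)/le_trans] := h d d0; apply.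
    have de : d <= e by rewrite ge_min lexx.
    have d1 : d <= 1 by rewrite ge_min lexx orbT.
    have : d * (2 * r + d) <= e * (2 * r + 1).
      by apply: ler_pM => //; [exact: ltW|lra|lra].
    lra.
Defined.

End l2_gauge.

(** * Separability, biorthogonal systems and duals *)

Section spans.
Context {R : realType} {W : lmodType R} {I : Type} (e : I -> W).

Definition lincomb (l : seq (R * I)) : W := \sum_(p <- l) p.1 *: e p.2.

Definition in_span (w : W) := exists l, w = lincomb l.

Lemma in_span0 : in_span 0.
Proof. by exists [::]; rewrite /lincomb big_nil. Qed.

Lemma in_spanD w1 w2 : in_span w1 -> in_span w2 -> in_span (w1 + w2).
Proof. by move=> [l1 ->] [l2 ->]; exists (l1 ++ l2); rewrite /lincomb big_cat. Qed.

Lemma in_spanZ a w : in_span w -> in_span (a *: w).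
Proof.
move=> [l ->]; exists [seq (a * p.1, p.2) | p <- l].
by rewrite /lincomb big_map scaler_sumr; apply: eq_bigr => p _; rewrite scalerA.
Qed.

Lemma in_span1 i : in_span (e i).
Proof. by exists [:: (1, i)]; rewrite /lincomb big_seq1 scale1r. Qed.

Lemma in_span_sum (J : Type) (r : seq J) (F : J -> W) :
  (forall j, in_span (F j)) -> in_span (\sum_(j <- r) F j).
Proof.
move=> h; elim: r => [|j r IH]; first by rewrite big_nil; exact: in_span0.
by rewrite big_cons; exact: in_spanD.
Qed.

End spans.

Lemma separable_total {R : realType} {W : normedModType R} {I : countType} (e : I
  -> W) :
  (forall w d, 0 < d -> exists2 v, in_span e v & `|w - v| <= d) ->
  separable_space W.
Proof.
move=> h.
pose f (l : seq (rat * I)) := lincomb e [seq (ratr p.1, p.2) | p <- l].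
exists (range f); split.
  by apply: sub_countable (card_image_le f setT) _; exact: countableP.
have rat_approx (l : seq (R * I)) d : 0 < d ->
    exists l', `|lincomb e l - f l'| <= d.
  elim: l d => [|[a i] l IH] d d0.
    by exists [::]; rewrite /f/= /lincomb !big_nil subr0 normr0 ltW.
  have d20 : 0 < d / 2 by rewrite divr_gt0.
  have [l' hl'] := IH _ d20.
  have [r ra] : exists r : rat, `|a - ratr r| * `|e i| <= d / 2.
    pose c := d / 2 / (`|e i| + 1).
    have c0 : 0 < c by rewrite divr_gt0// ltr_wpDl.
    have [r] := @rat_in_itvoo R (a - c) (a + c) ltac:(lra).
    rewrite in_itv/= => /andP[h1 h2]; exists r.
    have : `|a - ratr r| <= c by rewrite ler_norml; apply/andP; split; lra.
    move=> /(ler_wpM2r (normr_ge0 (e i)))/le_trans; apply.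
    by rewrite /c mulrAC ler_pdivrMr ?ltr_wpDl// ler_pM2l// lerDl.
  exists ((r, i) :: l'); rewrite /f /lincomb/= !big_cons/= opprD addrACA -scalerBl.
  by rewrite [d]splitr (le_trans (ler_normD _ _))// lerD// normrZ.
move=> O [w Ow] oO.
have /nbhs_ballP[d /= d0 dO] : nbhs w O by exact: open_nbhs_nbhs.
have d40 : 0 < d / 4 by rewrite divr_gt0.
have [_ [l ->] wl] := h w _ d40.
have [l' ll'] := rat_approx l _ d40.
exists (f l'); split; last by exists l'.
apply: dO; rewrite -ball_normE /ball_/=.
rewrite -(subrK (lincomb e l) w) -addrA (le_lt_trans (ler_normD _ _))//.
lra.
Qed.

(** If n vectors spanned the space, the identity matrix of size n + 1 would factor through dimension
    n. *)
Lemma infinite_dim_biorthogonal {R : realType} {W : lmodType R}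
  (e : nat -> W) (phi : nat -> {linear W -> R^o}) :
  (forall i j, phi i (e j) = (i == j)%:R) -> infinite_dim W.
Proof.
move=> h [n [v vP]].
have /choice[c cP] (j : 'I_n.+1) := vP (e j).
pose M := \matrix_(j < n.+1, i < n) c j i.
pose N := \matrix_(i < n, l < n.+1) (phi l (v i) : R).
have MN : M *m N = 1%:M.
  apply/matrixP => j l; rewrite !mxE eq_sym.
  rewrite -[RHS](h l j) -[e j](subrK (\sum_(i < n) c j i *: v i)) linearD.
  rewrite (cP j : _ = 0) linear0 add0r linear_sum.
  by apply: eq_bigr => i _; rewrite !mxE linearZ.
by have := mulmx1_min MN; rewrite ltnn.
Qed.

Lemma dual_norm_ub {R : realType} {W : normedModType R} (f : dual W) x :
  `|f x| <= `|f| * `|x|.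
Proof.
have ub y : `|y| <= 1 -> `|f y| <= `|f|.
  move=> y1; apply: sup_upper_bound; last by exists y.
  split; first by exists `|f 0|, 0; rewrite //= normr0.
  have /(linear_bounded_continuous f)/bounded_funP/(_ 1)[M fM] := @dual_continuous
    _ _ f.
  by exists M => _ [z z1 <-]; exact: fM.
have [->|x0] := eqVneq x 0; first by rewrite linear0 !normr0 mulr0.
have nx0 : 0 < `|x| by rewrite normr_gt0.
have /ub : `| `|x|^-1 *: x| <= 1.
  by rewrite normrZ normfV normr_id mulVf ?gt_eqF.
by rewrite linearZ normrM normfV normr_id ler_pdivrMl// mulrC.
Qed.

Lemma dual_norm_lub {R : realType} {W : normedModType R} (f : dual W) C :
  0 <= C -> (forall x, `|f x| <= C * `|x|) -> `|f| <= C.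
Proof.
move=> C0 fC; apply: ge_sup; first by exists `|f 0|, 0; rewrite //= normr0.
by move=> _ [x /= x1 <-]; rewrite (le_trans (fC x))// ler_piMr.
Qed.

Lemma linear_le_continuous {R : realType} {W : normedModType R}
  (f : {linear W -> R^o}) (C : R) :
  (forall x, `|f x| <= C * `|x|) -> continuous f.
Proof.
move=> fC; apply/linear_bounded_continuous/bounded_funP => r.
exists (`|C| * `|r|) => x xr; apply: (le_trans (fC x)).
apply: (@le_trans _ _ (`|C| * `|x|)); first by rewrite ler_wpM2r// ler_norm.
by rewrite ler_wpM2l// (le_trans xr)// ler_norm.
Qed.

Lemma bounded_dual {R : realType} {W : normedModType R} (f : {linear W -> R^o}) C :
  (forall x, `|f x| <= C * `|x|) -> exists F : dual W, forall x, F x = f x.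
Proof.
move=> fC.
have fP : is_functional f.
  apply/asboolP; split; last exact: linear_le_continuous fC.
  by move=> a x y; rewrite linearP.
by exists (Dual fP).
Qed.

(** For one of the two signs, u and t v add up in absolute value; since |u| is almost maximal, no
    room is left for t v. *)
Lemma norm_le_of_both_signs (R : realType) (u v M t e : R) :
  `|u + t * v| <= M + e / 2 * t -> `|u - t * v| <= M + e / 2 * t ->
  M - e * t / 2 <= `|u| -> `|t * v| <= t * e.
Proof.
rewrite !ler_norml => /andP[g1 g2] /andP[g3 g4] h.
by apply/andP; split; case: (ler0P u) h => u0 h; lra.
Qed.

(* Moving from a nearly norming vector in a direction of flatness raises the norm
   by o(t) only, so the functional has to be small in that direction. *)
Lemma flat_direction_small {R : realType} {W : normedModType R}
  (f : {linear W -> R^o}) (C : R) (A : set W) (Z : W -> set W) :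
  (forall x, `|f x| <= C * `|x|) ->
  (forall x (e : R), `|x| <= 1 -> 0 < e -> exists a, [/\ A a, `|a| <= 1 & `|x - a|
    <= e]) ->
  (forall e : R, 0 < e -> exists2 t : R, 0 < t & forall a y, A a -> Z a y ->
     `|a| <= 1 -> `|y| <= 1 -> `|a + t *: y| <= 1 + e * t) ->
  (forall a y, Z a y -> Z a (- y)) ->
  forall e : R, 0 < e -> exists2 a, A a & forall y, Z a y -> `|y| <= 1 -> `|f y|
    <= e.
Proof.
move=> fC Ad sm ZN e e0.
pose S := [set `|f x| | x in [set x : W | `|x| <= 1]].
have hS : has_sup S.
  split; first by exists `|f 0|, 0; rewrite //= normr0.
  exists `|C| => _ [x /= x1 <-]; rewrite (le_trans (fC x))//.
  apply: (@le_trans _ _ (`|C| * `|x|)); first by rewrite ler_wpM2r// ler_norm.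
  by rewrite ler_piMr.
pose M := sup S.
have fM x : `|x| <= 1 -> `|f x| <= M.
  by move=> x1; apply: sup_upper_bound => //; exists x.
have M0 : 0 <= M by apply: le_trans (fM 0 _); rewrite ?normr0.
have M10 : 0 < M + 1 by rewrite ltr_wpDl.
(* The flatness constant gets multiplied by M when f is applied; M + 1 is used because M may be
   0. *)
have [|t t0 tP] := sm (e / 2 / (M + 1)); first by rewrite !divr_gt0.
(* Two errors e t / 4, one for the supremum M and one for replacing the almost norming x by a in A,
   give |f a| >= M - e t / 2. *)
have et0 : 0 < e * t / 4 by rewrite divr_gt0// mulr_gt0.
have [_ [x /= x1 <-] xM] := sup_adherent et0 hS.
have C10 : 0 < `|C| + 1 by rewrite ltr_wpDl.
have [|a [Aa a1 xa]] := Ad x (e * t / 4 / (`|C| + 1)) x1; first by rewrite divr_gt0.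
have fxa : `|f x - f a| <= e * t / 4.
  rewrite -linearB (le_trans (fC _))//.
  apply: (@le_trans _ _ ((`|C| + 1) * `|x - a|)).
    by rewrite ler_wpM2r// (le_trans (ler_norm C))// lerDl.
  by rewrite -ler_pdivlMl// mulrC.
have fMg x' r : `|x'| <= r -> 0 < r -> `|f x'| <= M * r.
  move=> x'r r0; rewrite -ler_pdivrMr// -[X in _ / X]gtr0_norm// -normrV ?unitfE
    ?gt_eqF//.
  rewrite mulrC -normrM.
  have -> : r^-1 * f x' = f (r^-1 *: x') by rewrite linearZ.
  by apply: fM; rewrite normrZ normrV ?unitfE ?gt_eqF// gtr0_norm// ler_pdivrMl//
    mulr1.
exists a => // y Zy y1.
have r0 : 0 < 1 + e / 2 / (M + 1) * t.
  by rewrite addr_gt0// mulr_gt0// !divr_gt0.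
have h1 := fMg _ _ (tP a y Aa Zy a1 y1) r0.
have h2 : `|f (a + t *: - y)| <= M * (1 + e / 2 / (M + 1) * t).
  by apply: fMg => //; apply: tP => //; [exact: ZN|rewrite normrN].
have h3 : M * (1 + e / 2 / (M + 1) * t) <= M + e / 2 * t.
  rewrite mulrDr mulr1 lerD2l mulrA ler_pM2r// mulrCA ler_piMr ?ltW ?divr_gt0//.
  by rewrite ltr_pdivrMr// mul1r ltrDl.
rewrite linearD linearZ/= in h1; rewrite linearD linearZ linearN/= in h2.
have h4 : M - e * t / 2 <= `|f a|.
  move: xM; rewrite -/M => xM.
  have := ler_normD (f x - f a) (f a); rewrite subrK => h.
  have := le_trans h (lerD fxa (lexx _));
    have := lt_le_trans xM (le_trans h (lerD fxa (lexx _))).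
  lra.
have := @norm_le_of_both_signs R (f a) (f y) M t e (le_trans h1 h3) _ h4.
rewrite normrM gtr0_norm// ler_pM2l//; apply.
by rewrite -mulrN; exact: le_trans h2 h3.
Qed.

(** * Flatness of the tree norms *)

Lemma bernoulli_le (R : realDomainType) (a : R) n :
  -1 <= a -> 1 + n%:R * a <= (1 + a) ^+ n.
Proof.
move=> a1; elim: n => [|n IH]; first by rewrite mul0r addr0 expr0.
rewrite exprS; apply: (@le_trans _ _ ((1 + a) * (1 + n%:R * a))).
  have : 0 <= n%:R * a ^+ 2 by rewrite mulr_ge0// sqr_ge0.
  rewrite -natr1; lra.
by rewrite ler_wpM2l// addrC -lerBlDr sub0r.
Qed.

Section tree_smooth.
Context {R : realType}.
Implicit Types (b : nat -> nat * nat) (m n k q : nat) (s : seq (nat * nat)).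
Implicit Types (F : seq (seq (nat * nat))) (x y z : seq (nat * nat) -> R).

(** The subtree generated by F. Closure under prefixes lets [branch_split] cut every segment into a
    part inside followed by a part outside. *)
Definition below F s := has (prefix s) F.

Lemma mem_below F s : s \in F -> below F s.
Proof. by move=> sF; apply/hasP; exists s => //; exact: prefix_refl. Qed.

Lemma prefix_mkseq b i j : (i <= j)%N -> prefix (mkseq b i) (mkseq b j).
Proof.
by move=> ij; rewrite prefixE size_mkseq -map_take take_iota (minn_idPl ij).
Qed.

Lemma branch_split F b m n : (m <= n)%N -> exists k,
  [/\ (m <= k <= n)%N, forall i, (m <= i < k)%N -> below F (mkseq b i)
    & forall i, (k <= i < n)%N -> ~~ below F (mkseq b i)].
Proof.
move=> mn; pose P i := ((n <= i) || ~~ below F (mkseq b i) && (m <= i))%N.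
have exP : exists i, P i by exists n; rewrite /P leqnn.
case: (ex_minnP exP) => k Pk kmin.
have kn : (k <= n)%N by apply: kmin; rewrite /P leqnn.
have mk : (m <= k)%N.
  by move: Pk; rewrite /P => /orP[|/andP[]//]; exact: leq_trans.
exists k; split; first by rewrite mk.
  move=> i /andP[mi ik]; apply: contraTT ik => h.
  by rewrite -leqNgt; apply: kmin; rewrite /P h mi orbT.
move=> i /andP[ki ki2]; move: Pk; rewrite /P => /orP[nk|/andP[+ _]].
  by have := leq_trans nk ki; rewrite leqNgt ki2.
apply: contra => /hasP[f fF fp]; apply/hasP; exists f => //.
exact: prefix_trans (prefix_mkseq b ki) fp.
Qed.

Lemma zsum_eq0 z b m n :
  (forall i, (m <= i < n)%N -> z (mkseq b i) = 0) -> zsum z b m n = 0.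
Proof. by move=> h; rewrite /zsum big_nat; apply: big1. Qed.

Definition vanish_below F y := forall s, below F s -> y s = 0.
Definition vanish_off F x := forall s, ~~ below F s -> x s = 0.

(** If b <= e, then t b <= e t suffices. If b > e, then a ^+ q <= 1 - e ^+ q, so Bernoulli gives a
    <= 1 - e ^+ q / q, and the deficit pays for t b <= t. Hence the threshold e ^+ q / q. *)
Lemma add_le_of_expr_le1 (a b t e : R) q : (0 < q)%N -> 0 <= a -> 0 <= b -> 0 < e ->
  0 <= t -> t <= e ^+ q / q%:R -> a ^+ q + b ^+ q <= 1 -> a + t * b <= 1 + e * t.
Proof.
move=> q0 a0 b0 e0 t0 te ab.
have q0R : 0 < q%:R :> R by rewrite ltr0n.
have bq0 : 0 <= b ^+ q by rewrite exprn_ge0.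
have aq0 : 0 <= a ^+ q by rewrite exprn_ge0.
have a1 : a <= 1 by rewrite -(@expr_le1 _ q)//; lra.
have b1 : b <= 1 by rewrite -(@expr_le1 _ q)//; lra.
have [be|eb] := leP b e.
  by rewrite lerD// mulrC ler_wpM2r.
have e1 : e < 1 by exact: lt_le_trans b1.
have eq1 : e ^+ q <= 1 by rewrite exprn_ile1// ltW.
have ebq : e ^+ q <= b ^+ q by rewrite ler_pXn2r// ?nnegrE// ltW.
pose s := e ^+ q / q%:R.
have s0 : 0 <= s by rewrite divr_ge0// exprn_ge0// ltW.
have s1 : s <= 1 by rewrite ler_pdivrMr// mul1r (le_trans eq1)// ler1n.
have as1 : a <= 1 - s.
  rewrite -(ler_pXn2r q0) ?nnegrE ?subr_ge0//.
  apply: (@le_trans _ _ (1 - e ^+ q)); first lra.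
  have -> : e ^+ q = q%:R * s by rewrite mulrCA mulfV ?mulr1// gt_eqF.
  by rewrite -[leLHS]/(1 - _) -mulrN; apply: bernoulli_le; rewrite lerN2.
have tb : t * b <= t by rewrite ler_piMr.
have et : 0 <= e * t by rewrite mulr_ge0// ltW.
rewrite -/s in te; lra.
Qed.

(** A segment leaves the subtree of F once: x is seen before the exit, y after it. The threshold
    depends on q and e alone, so one t works for all finitely supported x. *)
Lemma tree_bound_flat q e : (0 < q)%N -> 0 < e -> exists2 t0 : R, 0 < t0 &
  forall t F x y, 0 <= t -> t <= t0 -> vanish_off F x -> vanish_below F y ->
  tree_bound q x 1 -> tree_bound q y 1 -> tree_bound q (x + t *: y) (1 + e * t).
Proof.
move=> q0 e0; exists (e ^+ q / q%:R); first by rewrite divr_gt0 ?exprn_gt0 ?ltr0n.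
move=> t F x y t0 tt0 xF yF x1 y1 b m n.
have [nm|mn] := leqP n m.
  by rewrite zsum_geq// normr0 mulr_ge0 ?theta_ge0// addr_ge0// mulr_ge0// ltW.
have [k [mkn kF knF]] := branch_split F b (ltnW mn).
rewrite zsumD zsumZ (zsum_cat x _ mkn) (zsum_cat y _ mkn).
rewrite (@zsum_eq0 x b k n) ?addr0; last by move=> i /knF /xF.
rewrite (@zsum_eq0 y b m k) ?add0r; last by move=> i /kF /yF.
pose a : R := theta q b m k; pose c : R := theta q b k n; set d := theta q b m n.
have d0 : 0 < d by exact: theta_gt0.
rewrite (le_trans (ler_normD _ _))// normrM (ger0_norm t0).
apply: (@le_trans _ _ (a + t * c)).
  by apply: lerD; [|apply: ler_wpM2l => //]; rewrite -[leRHS]mul1r.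
rewrite -ler_pdivrMr// mulrDl -mulrA.
apply: add_le_of_expr_le1 tt0 _ => //; rewrite ?divr_ge0 ?theta_ge0//.
rewrite !expr_div_n -mulrDl -/a -/c -/d /a /c -(theta_cat b q0 mkn) -/d.
by rewrite mulfV// gt_eqF// exprn_gt0.
Qed.

Definition restr F z := fun s => if below F s then z s else 0 : R.

Lemma restr_vanish F z : vanish_off F (restr F z).
Proof. by move=> s /negPf; rewrite /restr => ->. Qed.

Lemma sub_restr_vanish F z : vanish_below F (z - restr F z).
Proof. by move=> s sF; change (z s - restr F z s = 0); rewrite /restr sF subrr. Qed.

(** Removing the subtree replaces each segment by its final part, which weighs no more. *)
Lemma tree_bound_restr q F z r : (0 < q)%N -> 0 <= r ->
  tree_bound q z r -> tree_bound q (z - restr F z) r.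
Proof.
move=> q0 r0 h b m n; have [nm|mn] := leqP n m.
  by rewrite zsum_geq// normr0 mulr_ge0 ?theta_ge0.
have [k [mkn kF knF]] := branch_split F b (ltnW mn).
rewrite (zsum_cat _ _ mkn) zsum_eq0 ?add0r; last first.
  by move=> i /kF iF; exact: sub_restr_vanish.
have -> : zsum (z - restr F z) b k n = zsum z b k n.
  rewrite zsumB (zsum_eq0 (z := restr F z)) ?subr0//.
  by move=> i /knF; exact: restr_vanish.
by rewrite (le_trans (h _ _ _))// ler_wpM2l// theta_catr.
Qed.

Definition nodes_below F := undup (flatten [seq [seq take i f | i <- iota 0 (size
  f).+1] | f <- F]).

Lemma mem_nodes_below F s : (s \in nodes_below F) = below F s.
Proof.
rewrite mem_undup; apply/flatten_mapP/hasP => -[f fF].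
  by move=> /mapP[i _ ->]; exists f => //; exact: prefix_take.
move=> sf; exists f => //; apply/mapP; exists (size s).
  by rewrite mem_iota ltnS (size_prefix sf).
by move: sf; rewrite prefixE => /eqP ->.
Qed.

Definition unit_at s : seq (nat * nat) -> R := fun s' => (s' == s)%:R.

Lemma vanish_offE F x : vanish_off F x ->
  x = \sum_(s <- nodes_below F) x s *: unit_at s.
Proof.
move=> xF; apply/funext => s; rewrite fct_sumE.
have [sF|sF] := boolP (below F s).
  rewrite (bigD1_seq s) ?mem_nodes_below ?undup_uniq//= big1 ?addr0.
    by rewrite fctE /unit_at eqxx [RHS]mulr1.
  by move=> s' ss'; rewrite fctE /unit_at eq_sym (negPf ss') [LHS]mulr0.
rewrite xF// big_seq big1// => s'; rewrite mem_nodes_below => s'F.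
rewrite fctE /unit_at; have [ss'|_] := eqVneq s s'; last by rewrite [LHS]mulr0.
by rewrite ss' s'F in sF.
Qed.

Lemma fin_supp_vanish x : fin_supp x -> exists F, vanish_off F x.
Proof. by move=> [F h]; exists F => s sF; apply: h; apply: contra sF;
  exact: mem_below. Qed.

(** A segment meets s at most once, and then weighs at least as much as s. *)
Lemma tree_fin_unit q s : (0 < q)%N -> unit_at s \in gauge_fin (tree_gauge q).
Proof.
move=> q0; pose c := theta q (branch s) (size s) (size s).+1 : R.
have c0 : 0 < c by exact: theta_gt0.
apply/gauge_finP; exists c^-1; split; first by rewrite invr_ge0 ltW.
  move=> b m n; rewrite ler_pdivlMl//.
  have [nm|mn] := leqP n m; first by rewrite zsum_geq// normr0 mulr0 theta_ge0.
  have [/andP[h /eqP bs]|h] := boolP ((m <= size s < n)%N && (mkseq b (size s) ==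
    s)).
    have cE : c = theta q b (size s) (size s).+1.
      by rewrite /c /theta /wsum !big_nat1 mkseq_branch bs.
    have -> : zsum (unit_at s) b m n = 1.
      rewrite /zsum (bigD1_seq (size s)) ?mem_index_iota ?iota_uniq//= big1 ?addr0.
        by rewrite /unit_at bs eqxx.
      move=> i /negPf is_; rewrite /unit_at; case: eqP => // /(congr1 size).
      by rewrite size_mkseq => /eqP; rewrite is_.
    rewrite normr1 mulr1 cE.
    have /andP[h1 h2] := h.
    have h3 : (m <= size s <= n)%N by rewrite h1 ltnW.
    apply: (le_trans _ (theta_catr b q0 h3)).
    by apply: theta_catl => //; rewrite leqnSn.
  rewrite zsum_eq0 ?normr0 ?mulr0 ?theta_ge0// => i mi.
  rewrite /unit_at; case: eqP => // his; case/negP: h.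
  have si : size s = i by rewrite -his size_mkseq.
  by rewrite si mi his eqxx.
apply: fin_supp_approx; exists [:: s] => s'.
by rewrite inE /unit_at => /negPf ->.
Qed.

End tree_smooth.

(** * The spaces of the universal sum *)

Section l2_space.
Context {R : realType} {L : lmodType R} (g : nat -> gauge L).
Local Notation E n := (gauge_banach (g n)).
Local Notation Y := (gauge_banach (l2_gauge g)).

Lemma l2_coord_fin (z : Y) n : gval z n \in gauge_fin (g n).
Proof. by have [_ + _] := gauge_norm_self z; apply. Qed.

Definition l2_proj n (z : Y) : E n := Gspace (l2_coord_fin z n).

Lemma l2_proj_linear n : linear (l2_proj n).
Proof. by move=> a x y; exact: val_inj. Qed.

HB.instance Definition _ n :=
  GRing.isLinear.Build R Y (E n) *:%R (l2_proj n) (l2_proj_linear n).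

Lemma l2_normP (z : Y) r : 0 <= r ->
  `|z| <= r <-> forall K, \sum_(n < K) `|l2_proj n z| ^+ 2 <= r ^+ 2.
Proof.
move=> r0; split=> [/gspace_norm_le[]//|h].
by apply/gspace_norm_le; split => // n; exact: l2_coord_fin.
Qed.

Lemma l2_sum_le (z : Y) K : \sum_(n < K) `|l2_proj n z| ^+ 2 <= `|z| ^+ 2.
Proof. by move: K; apply/l2_normP. Qed.

Lemma l2_proj_le n (z : Y) : `|l2_proj n z| <= `|z|.
Proof.
rewrite -(@ler_pXn2r _ 2)// ?nnegrE//; apply: le_trans (l2_sum_le z n.+1).
by rewrite big_ord_recr/= lerDr sumr_ge0// => i _; exact: sqr_ge0.
Qed.

Lemma l2_series_cvg (z : Y) :
  series (fun n => `|l2_proj n z| ^+ 2) @ \oo --> `|z| ^+ 2.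
Proof.
set u := series _.
have und : nondecreasing_seq u.
  by apply/nondecreasing_seqP => n;
    rewrite /u /series/= big_nat_recr//= lerDl sqr_ge0.
have ub : forall n, u n <= `|z| ^+ 2.
  by move=> n; rewrite /u /series/= big_mkord; exact: l2_sum_le.
have uc : cvgn u.
  by apply: nondecreasing_is_cvgn => //; exists (`|z| ^+ 2) => _ [n _ <-].
have ul n : u n <= limn u by exact: nondecreasing_cvgn_le.
suff -> : `|z| ^+ 2 = limn u by [].
apply/le_anti/andP; split; last by apply: limr_le => //; near=> n.
have l0 : 0 <= limn u by apply: le_trans (ul 0%N); rewrite /u /series/= big_geq.
rewrite -[leRHS]sqr_sqrtr// ler_pXn2r// ?nnegrE ?sqrtr_ge0//.
apply/l2_normP; first exact: sqrtr_ge0.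
by move=> K; rewrite sqr_sqrtr//; have := ul K; rewrite /u /series/= big_mkord.
Unshelve. all: by end_near. Qed.

Lemma l2_surj (e : forall n, E n) : cvgn (series (fun n => `|e n| ^+ 2)) ->
  exists y : Y, forall n, l2_proj n y = e n.
Proof.
set u := series _ => uc.
have und : nondecreasing_seq u.
  by apply/nondecreasing_seqP => n;
    rewrite /u /series/= big_nat_recr//= lerDl sqr_ge0.
have ul n : u n <= limn u by exact: nondecreasing_cvgn_le.
have l0 : 0 <= limn u by apply: le_trans (ul 0%N); rewrite /u /series/= big_geq.
have yf : (fun n => val (e n)) \in gauge_fin (l2_gauge g).
  apply/gauge_finP; exists (Num.sqrt (limn u)); split; first exact: sqrtr_ge0.
    by move=> n; exact: gval_fin.
  by move=> K; rewrite sqr_sqrtr//; have := ul K; rewrite /u /series/= big_mkord.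
by exists (Gspace yf) => n; exact: val_inj.
Qed.

Lemma l2_is_l2_sum : is_l2_sum Y (fun n => E n).
Proof.
exists (fun n => l2_proj n); split; first exact: l2_series_cvg.
exact: l2_surj.
Qed.

Definition inj_fun (n : nat) (x : L) (k : nat) : L := if k == n then x else 0.

Lemma l2_inj_le n (x : E n) : l2_gauge g (inj_fun n (val x)) `|x|.
Proof.
split; first exact: normr_ge0.
  by move=> k; rewrite /inj_fun; case: eqP => [->|_];
    [exact: gval_fin|exact: rpred0].
move=> K; have z0 k : gauge_inf (g k) 0 = 0.
  by rewrite -[LHS]/(`|0 : E k|) normr0.
have [nK|Kn] := ltnP n K.
  rewrite (bigD1 (Ordinal nK))//= big1 ?addr0 /inj_fun ?eqxx//.
  move=> i ni; case: eqP => [h|_]; last by rewrite z0 expr0n.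
  by case/negP: ni; apply/eqP/val_inj.
rewrite big1 ?sqr_ge0// => i _; rewrite /inj_fun; case: eqP => [h|_].
  by have := ltn_ord i; rewrite h ltnNge Kn.
by rewrite z0 expr0n.
Qed.

Lemma l2_inj_fin n (x : E n) : inj_fun n (val x) \in gauge_fin (l2_gauge g).
Proof. by apply/gauge_finP; exists `|x|; exact: l2_inj_le. Qed.

Definition l2_inj n (x : E n) : Y := Gspace (l2_inj_fin x).

Lemma l2_inj_linear n : linear (@l2_inj n).
Proof.
move=> a x y; apply: val_inj; apply/funext => k /=.
change (inj_fun n (a *: val x + val y) k = a *: inj_fun n (val x) k + inj_fun n
  (val y) k).
by rewrite /inj_fun; case: eqP => // _; rewrite scaler0 addr0.
Qed.

HB.instance Definition _ n :=
  GRing.isLinear.Build R (E n) Y *:%R (@l2_inj n) (@l2_inj_linear n).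

Lemma l2_proj_inj n (x : E n) : l2_proj n (l2_inj x) = x.
Proof. by apply: val_inj => /=; rewrite /inj_fun eqxx. Qed.

Lemma l2_norm_inj n (x : E n) : `|l2_inj x| = `|x|.
Proof.
apply/le_anti/andP; split; first by apply/gspace_norm_le; exact: l2_inj_le.
by rewrite -{1}(l2_proj_inj x) l2_proj_le.
Qed.

Definition l2_head K (z : Y) : Y := \sum_(n < K) l2_inj (l2_proj n z).

Lemma l2_headE K z n : gval (l2_head K z) n = if (n < K)%N then gval z n else 0.
Proof.
have -> : gval (l2_head K z) n = \sum_(i < K) inj_fun i (gval z i) n.
  rewrite /l2_head; elim: K => [|K IH]; first by rewrite !big_ord0.
  rewrite !big_ord_recr/= -IH.
  by [].
have [nK|Kn] := ltnP n K.
  rewrite (bigD1 (Ordinal nK))//= big1 ?addr0 /inj_fun ?eqxx//.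
  move=> i ni; case: eqP => // h.
  by case/negP: ni; apply/eqP/val_inj.
rewrite big1// => i _; rewrite /inj_fun; case: eqP => // h.
by have := ltn_ord i; rewrite -h ltnNge Kn.
Qed.

Lemma l2_proj_head K z n : l2_proj n (l2_head K z) = if (n < K)%N then l2_proj n z
  else 0.
Proof. by apply: val_inj => /=; rewrite l2_headE; case: ifP. Qed.

Lemma l2_tail_le K z : `|z - l2_head K z| <= `|z|.
Proof.
apply/l2_normP => // M; apply: le_trans (l2_sum_le z M); apply: ler_sum => i _.
rewrite linearB/= l2_proj_head; case: ifP => // _; last by rewrite subr0.
by rewrite subrr normr0 expr0n sqr_ge0.
Qed.

Lemma l2_head_cvg z (e : R) : 0 < e -> exists K, `|z - l2_head K z| <= e.
Proof.
move=> e0; have := @l2_series_cvg z.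
have e20 : 0 < e ^+ 2 by rewrite exprn_gt0.
move=> /cvgrPdist_le/(_ _ e20)[K _ /(_ K (leqnn _))/= hK].
exists K; apply/l2_normP; [exact: ltW|move=> M].
move: hK; rewrite /series/= big_mkord => hK.
have [MK|/ltnW KM] := leqP M K.
  rewrite big1 ?sqr_ge0// => i _; rewrite linearB/= l2_proj_head.
  by rewrite (leq_trans (ltn_ord i) MK) subrr normr0 expr0n.
have := l2_sum_le z M; rewrite -!(big_mkord xpredT (fun n => `|l2_proj n _| ^+ 2)).
rewrite (big_cat_nat (leq0n K) KM)/= => h.
rewrite (big_cat_nat (leq0n K) KM)/= big_nat big1 ?add0r; last first.
  by move=> i /andP[_ iK]; rewrite linearB/= l2_proj_head iK subrr normr0 expr0n.
rewrite big_nat (eq_bigr (fun n => `|l2_proj n z| ^+ 2)); last first.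
  by move=> i /andP[Ki _]; rewrite linearB/= l2_proj_head ltnNge Ki/= subr0.
rewrite -big_nat; move: hK h; rewrite big_mkord ler_norml => /andP[h1 h2] h3.
lra.
Qed.

(** The growth t ^+ 2 is o(t): this is the flatness that makes a functional small on far
    summands. *)
Lemma l2_flat (a y : Y) (t : R) : `|a| <= 1 -> `|y| <= 1 ->
  (forall n, l2_proj n a = 0 \/ l2_proj n y = 0) ->
  `|a + t *: y| ^+ 2 <= 1 + t ^+ 2.
Proof.
move=> a1 y1 ay.
have h0 : 0 <= 1 + t ^+ 2 by rewrite addr_ge0// sqr_ge0.
rewrite -[leRHS]sqr_sqrtr// ler_pXn2r// ?nnegrE ?sqrtr_ge0//.
apply/l2_normP => [|K]; first exact: sqrtr_ge0.
rewrite sqr_sqrtr//.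
apply: (@le_trans _ _ (\sum_(n < K) `|l2_proj n a| ^+ 2 + t ^+ 2 * \sum_(n < K)
  `|l2_proj n y| ^+ 2)).
  rewrite mulr_sumr -big_split; apply: ler_sum => i _.
  rewrite linearD linearZ/=; case: (ay i) => ->.
    by rewrite normr0 expr0n add0r normrZ exprMn real_normK ?num_real// add0r.
  by rewrite scaler0 addr0 normr0 expr0n mulr0 addr0.
apply: lerD; first by rewrite (le_trans (l2_sum_le a K))// expr_le1.
by rewrite ler_piMr ?sqr_ge0// (le_trans (l2_sum_le y K))// expr_le1.
Qed.

End l2_space.

(** An approximant within e / 2 has norm at most 1 + e / 2; dividing by this number moves it by at
    most another e / 2. *)
Lemma ball_dense {R : realType} {W : normedModType R} (A : set W) :
  (forall a x, A x -> A (a *: x)) ->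
  (forall x (e : R), 0 < e -> exists2 a, A a & `|x - a| <= e) ->
  forall x (e : R), `|x| <= 1 -> 0 < e -> exists a, [/\ A a, `|a| <= 1 & `|x - a|
    <= e].
Proof.
move=> AZ Ad x e x1 e0; have e20 : 0 < e / 2 by rewrite divr_gt0.
have [a Aa xa] := Ad x _ e20.
have a1 : `|a| <= 1 + e / 2.
  by rewrite -[a](subKr x) (le_trans (ler_normB _ _))// lerD.
have c0 : 0 < 1 + e / 2 by rewrite addr_gt0.
exists ((1 + e / 2)^-1 *: a); split; first exact: AZ.
  by rewrite normrZ normfV gtr0_norm// ler_pdivrMl// mulr1.
rewrite -[x](subrK a) -addrA (le_trans (ler_normD _ _))//.
apply: (@le_trans _ _ (e / 2 + e / 2)); last by rewrite -splitr.
rewrite lerD//.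
rewrite -{1}[a]scale1r -scalerBl normrZ.
have -> : 1 - (1 + e / 2)^-1 = (e / 2) / (1 + e / 2).
  have c1 : 1 + e / 2 != 0 by rewrite gt_eqF.
  rewrite -{1}(mulfV c1).
  by rewrite -[X in _ - X]mul1r -mulrBl addrAC subrr add0r.
rewrite gtr0_norm ?divr_gt0// -[leLHS]mulrA ler_piMr ?(ltW e20)//.
by rewrite mulrC ler_pdivrMr// mul1r.
Qed.

(** * Tree spaces: finite subtrees and asymptotic smoothness *)

Section tree_space.
Context {R : realType} (q : nat) (q0 : (0 < q)%N).
Local Notation E := (gauge_banach (@tree_gauge R q)).
Local Notation node := (seq (nat * nat)).
Implicit Types (F : seq node) (s : node).

Definition tcoord s (z : E) : R^o := gval z s.

Lemma tcoord_linear s : linear (tcoord s).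
Proof. by []. Qed.

HB.instance Definition _ s :=
  GRing.isLinear.Build R E R^o *:%R (tcoord s) (tcoord_linear s).

Lemma tcoord_le s (z : E) :
  `|tcoord s z| <= theta q (branch s) (size s) (size s).+1 * `|z|.
Proof.
rewrite mulrC; apply: tree_bound_coord.
by have [_ + _] := gauge_norm_self z.
Qed.

Definition tunit s : E := Gspace (tree_fin_unit (R:=R) s q0).

Lemma tcoord_unit s s' : tcoord s (tunit s') = (s == s')%:R.
Proof. by []. Qed.

Definition trestr F (z : E) : E := \sum_(s <- nodes_below F) tcoord s z *: tunit s.

Lemma gval_sum (r : seq node) (c : node -> R) :
  gval (\sum_(s <- r) c s *: tunit s) = \sum_(s <- r) c s *: unit_at s.
Proof.
elim: r => [|s r IH]; first by rewrite !big_nil.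
by rewrite !big_cons/= -IH.
Qed.

Lemma gval_trestr F z : gval (trestr F z) = restr F (gval z).
Proof.
rewrite gval_sum [RHS](vanish_offE (@restr_vanish _ F (gval z))).
apply: eq_big_seq => s; rewrite mem_nodes_below /restr => ->.
by [].
Qed.

Lemma trestr_sub F z : vanish_below F (gval (z - trestr F z)).
Proof.
move=> s sF; have := @sub_restr_vanish _ F (gval z) s sF.
by rewrite -gval_trestr.
Qed.

Lemma trestr_sub_le F z : `|z - trestr F z| <= `|z|.
Proof.
have [z0 zb za] := gauge_norm_self z.
apply/gspace_norm_le; split => //.
  have -> : val (z - trestr F z) = gval z - restr F (gval z).
    by rewrite -gval_trestr.
  exact: tree_bound_restr.
by have [] := gauge_norm_self (z - trestr F z).
Qed.

Lemma tree_flat e : 0 < e -> exists2 t0 : R, 0 < t0 &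
  forall t F (x y : E), 0 <= t -> t <= t0 ->
  vanish_off F (gval x) -> vanish_below F (gval y) ->
  `|x| <= 1 -> `|y| <= 1 -> `|x + t *: y| <= 1 + e * t.
Proof.
move=> e0; have [t0 t00 tP] := @tree_bound_flat R q e q0 e0.
exists t0 => // t F x y t0' tt0 xF yF /gspace_norm_le[_ x1 _] /gspace_norm_le[_ y1
  _].
apply/gspace_norm_le; split; first by rewrite addr_ge0// mulr_ge0// ltW.
  change (tree_bound q (gval x + t *: gval y) (1 + e * t)).
  exact: (tP t F _ _ t0' tt0 xF yF x1 y1).
by have [] := gauge_norm_self (x + t *: y).
Qed.

Lemma tree_dense (z : E) e : 0 < e ->
  exists2 a : E, (exists F, vanish_off F (gval a)) & `|z - a| <= e.
Proof.
move=> e0; have [_ _ /(_ e e0)[z1 zf zb]] := gauge_norm_self z.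
have [F zF] := fin_supp_vanish zf.
have za : gval (\sum_(s <- nodes_below F) z1 s *: tunit s) = z1.
  by rewrite gval_sum -(vanish_offE zF).
exists (\sum_(s <- nodes_below F) z1 s *: tunit s).
  by exists F; rewrite za.
apply/gspace_norm_le; split; first exact: ltW.
  have -> // : val (z - \sum_(s <- nodes_below F) z1 s *: tunit s) = val z - z1.
  by rewrite -{2}za.
by have [] := gauge_norm_self (z - \sum_(s <- nodes_below F) z1 s *: tunit s).
Qed.

Lemma vanish_off_in_span F (a : E) : vanish_off F (gval a) -> in_span tunit a.
Proof.
move=> /vanish_offE aF.
have -> : a = \sum_(s <- nodes_below F) gval a s *: tunit s.
  by apply: val_inj; rewrite -[LHS]/(gval a) [LHS]aF -gval_sum.
by apply: in_span_sum => s; apply: in_spanZ; exact: in_span1.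
Qed.

Lemma tree_separable : separable_space E.
Proof.
apply: (separable_total (e := tunit)) => w d d0.
have [a [F /vanish_off_in_span aF] wa] := tree_dense w d0.
by exists a.
Qed.

Lemma tree_infinite_dim : infinite_dim E.
Proof.
apply: (@infinite_dim_biorthogonal _ _ (fun i => tunit (nseq i (0, 0)%N))
  (fun i => tcoord (nseq i (0, 0)%N))) => i j.
have -> // : (i == j) = (nseq i (0, 0)%N == nseq j (0, 0)%N).
by apply/eqP/eqP => [->//|/(congr1 size)]; rewrite !size_nseq.
Qed.

Lemma tree_cof F : @cof R E [set y : E | vanish_below F (gval y)].
Proof.
split.
- split=> [|a x y]; first by rewrite inE /= => s _.
  rewrite !inE /= => hx hy s sF.
  change (a * gval x s + gval y s = 0).
  by rewrite hx// hy// mulr0 addr0.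
- have -> : [set y : E | vanish_below F (gval y)] =
      \bigcap_(s in [set s | below F s]) (tcoord s @^-1` [set 0]).
    by apply/seteqP; split=> [y h s sF|y h s sF]; exact: h.
  apply: closed_bigI => s sF; apply: closed_comp; last exact: (@closed_eq R 0).
  have cs := linear_le_continuous (tcoord_le s).
  by move=> x _; exact: cs.
- exists (size (nodes_below F)), (fun i => tunit (tnth (in_tuple (nodes_below F))
  i)) => x.
  exists (fun i => tcoord (tnth (in_tuple (nodes_below F)) i) x).
  by have h := @trestr_sub F x; rewrite /trestr big_tnth in h.
Qed.

(** A unit vector x is replaced by a finitely supported a, and the test space consists of the
    vectors vanishing on the subtree of a. Half of e t is spent on x - a and half on flatness; a and
    the test space may depend on t. *)
Lemma tree_aus_le (e : R) : 0 < e -> exists2 t0 : R, 0 < t0 &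
  forall t : R, 0 < t -> t <= t0 ->
  (aus_modulus (fun x : E => `|x|)%R t <= (e * t)%:E)%E.
Proof.
move=> e0; have [|t0 t00 tP] := @tree_flat (e / 2); first by rewrite divr_gt0.
exists t0 => // t t0' tt0; rewrite /aus_modulus leeBlDr// -EFinD.
apply: ub_ereal_sup => _ [x /= x1 <-].
have et0 : 0 < e / 2 * t by rewrite !mulr_gt0.
have Ad : forall x (e : R), `|x| <= 1 -> 0 < e ->
   exists a : E, [/\ (exists F, vanish_off F (gval a)), `|a| <= 1 & `|x - a| <= e].
  apply: (@ball_dense _ E) => [c y [F yF]|]; last exact: tree_dense.
  exists F => s /yF ys; change (c * gval y s = 0).
  by rewrite ys mulr0.
have [|a [[F aF] a1 xa]] := Ad x _ _ et0; first by rewrite x1.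
apply: le_trans.
  apply: ereal_inf_lbound.
  by exists [set y : E | vanish_below F (gval y)]; first exact: tree_cof.
apply: ub_ereal_sup => _ [y [yF /= y1] <-]; rewrite lee_fin.
have -> : x + t *: y = (x - a) + (a + t *: y) by rewrite addrA subrK.
rewrite (le_trans (ler_normD _ _))//.
have := tP t F a y (ltW t0') tt0 aF yF a1 y1; lra.
Qed.

Lemma tree_unit_vector : exists x : E, `|x| = 1.
Proof.
have t0 : tunit [::] != 0.
  apply/eqP => /(congr1 (tcoord [::])); rewrite tcoord_unit eqxx linear0 => /eqP.
  by rewrite oner_eq0.
exists (`|tunit [::]|^-1 *: tunit [::]).
by rewrite normrZ normfV normr_id mulVf// normr_eq0.
Qed.

(** Test with y = 0 at a unit vector; over an empty set the supremum would be -oo. With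
    [tree_aus_le] this makes the modulus finite for small t, so the limit can be taken in R. *)
Lemma tree_aus_ge0 (t : R) : (0 <= aus_modulus (fun x : E => `|x|)%R t)%E.
Proof.
have [x x1] := tree_unit_vector.
rewrite /aus_modulus leeBrDr// add0e.
apply: le_trans; last by apply: ereal_sup_ubound; exists x.
apply: le_ereal_inf_tmp => _ [V [[V0 _] _ _] <-].
apply: le_trans; last first.
  apply: ereal_sup_ubound; exists 0; last reflexivity.
  by split; [move: V0; rewrite inE|rewrite /= normr0 ler01].
by rewrite scaler0 addr0 x1.
Qed.

Lemma tree_aus : aus (fun x : E => `|x|).
Proof.
have key (e : R) : 0 < e -> \forall t \near 0^'+, exists2 r : R,
    (aus_modulus (fun x : E => `|x|)%R t * (t^-1)%:E)%E = r%:E & 0 <= r <= e.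
  move=> e0; have [t0 t00 tP] := tree_aus_le e0.
  near=> t.
  have t1 : 0 < t by near: t; exact: nbhs_right_gt.
  have t2 : t <= t0 by near: t; exact: nbhs_right_le.
  have h1 := tP t t1 t2; have h0 := tree_aus_ge0 t.
  have mfin : aus_modulus (fun x : E => `|x|)%R t \is a fin_num.
    by rewrite fin_numE; case: (aus_modulus _ t) h1 h0.
  move: h0 h1; rewrite -(fineK mfin) !lee_fin -EFinM => h0 h1.
  exists (fine (aus_modulus (fun x : E => `|x|)%R t) * t^-1) => //.
  by rewrite divr_ge0 ?(ltW t1)//= ler_pdivrMr.
apply/fine_cvgP; split.
  by apply: filterS (key 1 ltr01) => t [r -> _].
apply/cvgr0Pnorm_le => e e0; apply: filterS (key e e0) => t [r /= -> /andP[r0 re]].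
by rewrite /= ger0_norm.
Unshelve. all: by end_near. Qed.

End tree_space.

Lemma norm_sum_le (R : realType) (W : normedModType R) (K : nat) (F : nat -> W) (c
  : R) :
  (forall n, (n < K)%N -> `|F n| <= c) -> `|\sum_(n < K) F n| <= K%:R * c.
Proof.
elim: K => [|K IH] h; first by rewrite big_ord0 normr0 mul0r.
rewrite big_ord_recr/= -natr1 mulrDl mul1r (le_trans (ler_normD _ _))// lerD//.
  by apply: IH => n nK; apply: h; exact: leqW.
exact: h.
Qed.

Lemma dual_sumE (R : realType) (W : normedModType R) (J : Type) (r : seq J)
  (F : J -> dual W) x : (\sum_(j <- r) F j) x = \sum_(j <- r) F j x.
Proof.
elim: r => [|j r IH]; first by rewrite !big_nil.
by rewrite !big_cons -IH.
Qed.

Lemma homogeneous_bound (R : realType) (W : normedModType R) (f : {linear W -> R^o})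
  (V : set W) (e : R) : 0 <= e -> (forall (c : R) y, V y -> V (c *: y)) ->
  (forall y, V y -> `|y| <= 1 -> `|f y| <= e) -> forall y, V y -> `|f y| <= e *
    `|y|.
Proof.
move=> e0 VZ h y Vy; have [->|y0] := eqVneq y 0.
  by rewrite linear0 !normr0 mulr0.
have ny0 : 0 < `|y| by rewrite normr_gt0.
have : `|f (`|y|^-1 *: y)| <= e.
  by apply: h; [exact: VZ|rewrite normrZ normfV normr_id mulVf ?gt_eqF].
by rewrite linearZ normrM normfV normr_id ler_pdivrMl// mulrC.
Qed.

(** * The l_2-sum of the tree spaces and its dual *)

Section universal_space.
Context {R : realType}.
Local Notation E n := (gauge_banach (@tree_gauge R n.+1)).
Local Notation Y := (gauge_banach (l2_gauge (fun n => @tree_gauge R n.+1))).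
Local Notation node := (seq (nat * nat)).
Local Notation inj n := (@l2_inj R _ (fun k => @tree_gauge R k.+1) n).
Local Notation proj n := (@l2_proj R _ (fun k => @tree_gauge R k.+1) n).

Definition Yunit (p : nat * node) : Y := inj p.1 (tunit (ltn0Sn p.1) p.2).

Lemma Y_separable : separable_space Y.
Proof.
apply: (separable_total (e := Yunit)) => w d d0.
have d20 : 0 < d / 2 by rewrite divr_gt0.
have [K wK] := l2_head_cvg w d20.
have d' : 0 < d / 2 / K.+1%:R by rewrite divr_gt0.
have ex n : exists a : E n,
    in_span (tunit (ltn0Sn n)) a /\ `|proj n w - a| <= d / 2 / K.+1%:R.
  have [a [F /(vanish_off_in_span (ltn0Sn n)) aF] wa] := tree_dense (ltn0Sn n)
    (proj n w) d'.
  by exists a.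
pose a n := projT1 (cid (ex n)); pose aP n := projT2 (cid (ex n)).
exists (\sum_(n < K) inj n (a n)).
  apply: in_span_sum => n; have [[l al] _] := aP n; rewrite /a al.
  rewrite /lincomb linear_sum; apply: in_span_sum => p; rewrite linearZ/=.
  by apply: in_spanZ; exact: (in_span1 Yunit (nat_of_ord n, p.2)).
rewrite -(subrK (l2_head K w) w) -addrA (le_trans (ler_normD _ _))//.
apply: (@le_trans _ _ (d / 2 + d / 2)); last by rewrite -splitr.
apply: lerD; first exact: wK.
rewrite /l2_head -sumrB.
apply: le_trans (norm_sum_le (c := d / 2 / K.+1%:R)
  (F := fun n => inj n (proj n w) - inj n (a n)) _) _.
  by move=> n _; rewrite -linearB l2_norm_inj; have [] := aP n.
by rewrite mulrCA ler_piMr ?(ltW d20)// ler_pdivrMr// mul1r ler_nat.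
Qed.

Lemma Y_infinite_dim : infinite_dim Y.
Proof.
apply: (@infinite_dim_biorthogonal _ _ (fun i => Yunit (0%N, nseq i (0, 0)%N))
  (fun i => tcoord (nseq i (0, 0)%N) \o proj 0%N)) => i j.
change (tcoord (nseq i (0, 0)%N) (proj 0%N (inj 0%N
  (tunit (ltn0Sn 0) (nseq j (0, 0)%N)))) = (i == j)%:R).
rewrite l2_proj_inj.
have -> // : (i == j) = (nseq i (0, 0)%N == nseq j (0, 0)%N).
by apply/eqP/eqP => [->//|/(congr1 size)]; rewrite !size_nseq.
Qed.

Lemma Y_dual_small_tail (f : dual Y) (d : R) : 0 < d ->
  exists K, forall z, `|f (z - l2_head K z)| <= d * `|z|.
Proof.
move=> d0.
have [| | | |a [K aK] fa] := @flat_direction_small R Y f `|f|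
    [set a : Y | exists K, forall n, (K <= n)%N -> proj n a = 0]
    (fun a => [set y : Y | forall n, proj n a = 0 \/ proj n y = 0]) _ _ _ _ d d0.
- exact: dual_norm_ub.
- apply: ball_dense => [c x [K xK]|x e e0].
    by exists K => n /xK h; rewrite linearZ/= h scaler0.
  have [K xK] := l2_head_cvg x e0; exists (l2_head K x) => //.
  by exists K => n Kn; rewrite l2_proj_head ltnNge Kn.
(* With t = 2 e one has 1 + t ^+ 2 = 1 + 4 e ^+ 2 <= (1 + 2 e ^+ 2) ^+ 2 = (1 + e t) ^+ 2. *)
- move=> e e0; exists (2 * e) => [|a y _ Zay a1 y1]; first by rewrite mulr_gt0.
  have h0 : 0 <= 1 + e * (2 * e) by rewrite addr_ge0// mulr_ge0 ?mulr_ge0 ?(ltW e0).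
  rewrite -(@ler_pXn2r _ 2)// ?nnegrE//.
  apply: (le_trans (l2_flat (2 * e) a1 y1 Zay)).
  have : 0 <= e ^+ 4 by rewrite exprn_ge0// ltW.
  lra.
- by move=> a y h n; case: (h n) => hn; [left|right; rewrite linearN/= hn oppr0].
exists K => z.
have h : forall y : Y, (forall n, (n < K)%N -> proj n y = 0) -> `|f y| <= d * `|y|.
  apply: (@homogeneous_bound R Y f [set y | forall n, (n < K)%N -> proj n y = 0])
    => //.
  - exact: ltW.
  - by move=> c y hy n /hy hn; rewrite linearZ/= hn scaler0.
  - move=> y hy y1; apply: fa => // n; have [nK|Kn] := ltnP n K.
      by right; exact: hy.
    by left; exact: aK.
apply: (le_trans (h _ _)).
  by move=> n nK; rewrite linearB/= l2_proj_head nK subrr.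
by rewrite ler_wpM2l ?(ltW d0)// l2_tail_le.
Qed.

(** An almost norming vector can be taken supported in a finite subtree; the vectors vanishing there
    are flat directions, and passing to the tail [z - trestr _ F z] does not increase the norm. *)
Lemma Y_dual_small_below (f : dual Y) (d : R) n : 0 < d ->
  exists F, forall z : E n, `|f (inj n (z - trestr (ltn0Sn n) F z))| <= d * `|z|.
Proof.
move=> d0;
have lfn : linear (f \o inj n : E n -> R^o).
  by move=> a x y; rewrite /= !linearP.
pose fn : {linear E n -> R^o} :=
  HB.pack (f \o inj n : E n -> R^o) (GRing.isLinear.Build R (E n) R^o *:%R _ lfn).
have [| | | |a [F aF] fa] := @flat_direction_small R (E n) fn `|f|
    [set a : E n | exists F, vanish_off F (gval a)]
    (fun a => [set y : E n | exists F, vanish_off F (gval a) /\ vanish_below F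
      (gval y)])
    _ _ _ _ d d0.
- move=> x; have h := @dual_norm_ub R Y f (inj n x).
  by rewrite l2_norm_inj in h.
- apply: (@ball_dense R (E n)) => [c y [F yF]|z e];
  last exact: (tree_dense (ltn0Sn n)).
  exists F => s /yF ys; change (c * gval y s = 0).
  by rewrite ys mulr0.
- move=> e e0; have [t0 t00 tP] := tree_flat (R := R) (ltn0Sn n) e0.
  exists t0 => // x y _ [F [xF yF]] x1 y1.
  by apply: (tP t0 F) => //; exact: ltW.
- move=> x y [F [xF yF]]; exists F; split => // s /yF ys.
  by change (- gval y s = 0); rewrite ys oppr0.
exists F => z; apply: (@le_trans _ _ (d * `|z - trestr (ltn0Sn n) F z|));
  last first.
  by rewrite ler_wpM2l ?(ltW d0)//; exact: trestr_sub_le.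
apply: (@homogeneous_bound R (E n) fn [set y | vanish_below F (gval y)]).
- exact: ltW.
- by move=> c y hy s /hy ys; change (c * gval y s = 0); rewrite ys mulr0.
- by move=> y hy; apply: fa; exists F.
- exact: trestr_sub.
Qed.

Lemma Y_coord_ex (p : nat * node) : exists c : dual Y, forall z,
  c z = tcoord p.2 (proj p.1 z).
Proof.
apply: (@bounded_dual _ _ (tcoord p.2 \o proj p.1) (theta p.1.+1 (branch p.2)
  (size p.2) (size p.2).+1)) => x /=.
apply: (le_trans (tcoord_le p.2 (proj p.1 x))).
apply: ler_wpM2l; first exact: theta_ge0.
exact: (@l2_proj_le R _ (fun k => @tree_gauge R k.+1) p.1 x).
Qed.

(** The node coordinates are total: up to d / 2 only the first K summands matter, and in each of
    them f is determined, up to [d / 2 / K.+1], by its values on the units of a finite subtree. *)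
Lemma Y_dual_separable : separable_space (dual Y).
Proof.
have /choice[c cP] := Y_coord_ex.
apply: (separable_total (e := c)) => f d d0.
have d20 : 0 < d / 2 by rewrite divr_gt0.
have [K fK] := Y_dual_small_tail f d20.
have d' : 0 < d / 2 / K.+1%:R by rewrite divr_gt0.
have /choice[F FP] n := Y_dual_small_below f n d'.
exists (\sum_(n < K) \sum_(s <- nodes_below (F n))
  (f (inj n (tunit (ltn0Sn n) s)) : R) *: c (nat_of_ord n, s)).
  by apply: in_span_sum => n; apply: in_span_sum => s; apply: in_spanZ;
    exact: in_span1.
apply: dual_norm_lub => [|z]; first exact: ltW.
have -> : (f - \sum_(n < K) \sum_(s <- nodes_below (F n))
    (f (inj n (tunit (ltn0Sn n) s)) : R) *: c (nat_of_ord n, s)) z =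
   f (z - l2_head K z) +
   \sum_(n < K) f (inj n (proj n z - trestr (ltn0Sn n) (F n) (proj n z))).
  rewrite linearB/= -addrA; change (f z - (\sum_(n < K) \sum_(s <- nodes_below (F
    n))
    (f (inj n (tunit (ltn0Sn n) s)) : R) *: c (nat_of_ord n, s)) z = f z +
    (- f (l2_head K z) + \sum_(n < K) f (inj n (proj n z - trestr (ltn0Sn n) (F n)
      (proj n z))))).
  congr (_ + _); rewrite /l2_head linear_sum -sumrN -big_split/= dual_sumE -sumrN.
  apply: eq_bigr => n _; rewrite !linearB/= addKr; congr (- _).
  rewrite dual_sumE /trestr !linear_sum; apply: eq_bigr => s _.
  rewrite !linearZ/=.
  change (f (inj n (tunit (ltn0Sn n) s)) * c (nat_of_ord n, s) z =
    tcoord s (proj n z) * f (inj n (tunit (ltn0Sn n) s))).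
  by rewrite cP; exact: mulrC.
rewrite (le_trans (ler_normD _ _))// [d]splitr mulrDl lerD//.
apply: le_trans (norm_sum_le (W := R^o) (c := d / 2 / K.+1%:R * `|z|)
  (F := fun n => f (inj n (proj n z - trestr (ltn0Sn n) (F n) (proj n z)))) _) _.
  move=> n _; apply: (le_trans (FP n _)).
  apply: ler_wpM2l; first exact: ltW.
  exact: (@l2_proj_le R _ (fun k => @tree_gauge R k.+1) n z).
rewrite mulrA ler_wpM2r//.
by rewrite mulrCA ler_piMr ?(ltW d20)// ler_pdivrMr// mul1r ler_nat.
Qed.

End universal_space.

(** * The Hahn-Banach theorem and separable preduals *)

Section hahn_banach.
Context {R : realType} {X : lmodType R}.
Implicit Types (p q : X -> R).

Definition sublin q := (forall x y, q (x + y) <= q x + q y) /\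
  (forall a x, 0 < a -> q (a *: x) <= a * q x).

Lemma sublin0 q : sublin q -> q 0 = 0.
Proof.
move=> [_ h]; have := h 2 0 ltac:(lra); have := h 2^-1 0 ltac:(lra).
rewrite !scaler0; lra.
Qed.

Lemma sublin_opp q x : sublin q -> - q (- x) <= q x.
Proof.
move=> sq; have [h _] := sq; have := h x (- x).
rewrite subrr sublin0//; lra.
Qed.

Lemma sublinZ q a x : sublin q -> 0 < a -> q (a *: x) = a * q x.
Proof.
move=> [_ qZ] a0; apply/le_anti; rewrite qZ//=.
have : 0 < a^-1 by rewrite invr_gt0.
move=> /(qZ _ (a *: x)); rewrite scalerA mulVf ?gt_eqF// scale1r.
by rewrite ler_pdivlMl.
Qed.

(** This weak, pointwise directedness covers three uses: translates along a ray, chains for Zorn's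
    lemma, and the distance to a span. The function p keeps the infimum finite and passes on lower
    bounds. *)
Lemma sublin_inf (A : set (X -> R)) (p : X -> R) : A !=set0 ->
  (forall q, A q -> forall x, p x <= q x) ->
  (forall q1 q2, A q1 -> A q2 -> forall x y, exists2 q, A q & q (x + y) <= q1 x +
    q2 y) ->
  (forall q1 a, A q1 -> 0 < a -> exists2 q, A q & forall x, q (a *: x) <= a * q1
    x) ->
  exists r, [/\ sublin r, forall q, A q -> forall x, r x <= q x & forall x, p x <=
    r x].
Proof.
move=> [q0 Aq0] pA AD AZ.
have hi x : has_inf [set q x | q in A].
  by split; [exists (q0 x), q0|exists (p x) => _ [q Aq <-]; exact: pA].
exists (fun x => inf [set q x | q in A]).
have le q x : A q -> inf [set q x | q in A] <= q x.
  by move=> Aq; apply: ge_inf; [case: (hi x)|exists q].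
split; last 2 first.
- by move=> q Aq x; exact: le.
- move=> x; apply: lb_le_inf; [by case: (hi x)|].
  by move=> _ [q Aq <-]; exact: pA.
split.
- move=> x y; apply/ler_addgt0Pr => e e0.
  have e20 : 0 < e / 2 by rewrite divr_gt0.
  have [_ [q1 A1 <-] h1] := inf_adherent e20 (hi x).
  have [_ [q2 A2 <-] h2] := inf_adherent e20 (hi y).
  have [q Aq h3] := AD _ _ A1 A2 x y.
  have := le q (x + y) Aq; lra.
- move=> a x a0; apply/ler_addgt0Pr => e e0.
  have ea0 : 0 < e / a by rewrite divr_gt0.
  have [_ [q1 A1 <-] h1] := inf_adherent ea0 (hi x).
  have [q Aq h3] := AZ _ _ A1 a0.
  apply: (le_trans (le q _ Aq)); apply: (le_trans (h3 x)).
  move: h1; rewrite -(ltr_pM2l a0) mulrDr mulrCA mulfV ?gt_eqF// mulr1.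
  exact: ltW.
Qed.

(** r is the infimum over t >= 0 of [q (x + t *: y) - t * q y]; t = 0 and t = 1 give the two bounds.
    If q is minimal, then r = q and the second bound is superadditivity. *)
Lemma sublin_shift q y : sublin q -> exists r, [/\ sublin r,
  forall x, r x <= q x & forall x, r x <= q (x + y) - q y].
Proof.
move=> sq; have [qD qZ] := sq.
pose A := [set (fun x => q (x + t *: y) - t * q y) | t in [set t : R | 0 <= t]].
have [| | | |r [sr rA _]] := @sublin_inf A (fun x => - q (- x)).
- by exists (fun x => q (x + 0 *: y) - 0 * q y); exists 0 => /=.
- move=> _ [t t0 <-] x.
  have := qD (x + t *: y) (- x); rewrite addrAC subrr add0r.
  suff -> : q (t *: y) = t * q y by lra.
  move: t0; rewrite /= le_eqVlt => /predU1P[<-|]; last exact: sublinZ.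
  by rewrite scale0r sublin0// mul0r.
- move=> _ _ [t1 t10 <-] [t2 t20 <-] x z;
  exists (fun x => q (x + (t1 + t2) *: y) - (t1 + t2) * q y).
    by exists (t1 + t2) => //=; exact: addr_ge0.
  have := qD (x + t1 *: y) (z + t2 *: y); rewrite addrACA -scalerDl; lra.
- move=> _ a [t t0 <-] a0; exists (fun x => q (x + (a * t) *: y) - (a * t) * q y).
    by exists (a * t) => //=; apply: mulr_ge0 => //; exact: ltW.
  move=> x; have := qZ a (x + t *: y) a0; rewrite scalerDr scalerA; lra.
exists r; split => // x.
  have := rA _ (ex_intro2 _ _ 0 (lexx 0) erefl) x.
  by rewrite scale0r addr0 mul0r subr0.
have := rA _ (ex_intro2 _ _ 1 ler01 erefl) x.
by rewrite scale1r mul1r.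
Qed.

(* A minimal sublinear functional is linear: apply minimality to sublin_shift. *)
Lemma sublin_min p : sublin p -> exists q, [/\ sublin q, forall x, q x <= p x &
  forall r, sublin r -> (forall x, r x <= q x) -> r = q].
Proof.
move=> sp.
pose T := {q : X -> R | sublin q /\ forall x, q x <= p x}.
pose Rel (s t : T) := `[< forall x, sval t x <= sval s x >].
have [| | | |[q [sq qp]] qmax] := @Zorn T Rel.
- by move=> t; apply/asboolP.
- move=> r s t /asboolP h1 /asboolP h2; apply/asboolP => x.
  exact: le_trans (h1 x).
- move=> [s hs] [t ht] /asboolP/= h1 /asboolP/= h2.
  have st : s = t by apply/funext => x; apply/le_anti; rewrite h1 h2.
  by subst t; congr exist; exact: Prop_irrelevance.
- move=> A Atot; have [->|/set0P[t0 At0]] := eqVneq A set0.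
    by exists (exist _ p (conj sp (fun x => lexx (p x)))).
  have [| | | |r [sr rA _]] := @sublin_inf [set sval t | t in A] (fun x => - p (-
    x)).
  + by exists (sval t0), t0.
  + move=> _ [t At <-] x; have [st tp] := svalP t.
    by apply: le_trans (sublin_opp x st); rewrite lerN2.
  + move=> _ _ [s As <-] [t At <-] x y.
    have [[sD _] sp'] := svalP s; have [[tD _] tp'] := svalP t.
    have [/asboolP h|/asboolP h] := Atot s t As At.
      by exists (sval t); [exists t|rewrite (le_trans (tD x y))// lerD2r].
    by exists (sval s); [exists s|rewrite (le_trans (sD x y))// lerD2l].
  + move=> _ a [s As <-] a0; exists (sval s); first by exists s.
    by move=> x; have [[_ sZ] _] := svalP s; exact: sZ.
  have rp x : r x <= p x.
    have [_ tp] := svalP t0; apply: le_trans (tp x).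
    by apply: rA; exists t0.
  exists (exist _ r (conj sr rp)) => s As; apply/asboolP => x /=.
  by apply: rA; exists s.
exists q; split => // r sr rq.
have rp x : r x <= p x by apply: le_trans (qp x).
have := qmax (exist _ r (conj sr rp)).
rewrite /Rel => h; have /asboolP/h/(congr1 sval)//= : forall x, r x <= q x by [].
Qed.

(** Shifting p by x0 before minimising fixes the value at x0, because the shifted functional is at
    most [- p x0] at [- x0]. *)
Lemma hahn_banach p x0 : sublin p -> exists f : X -> R^o,
  [/\ linear f, forall x, f x <= p x & f x0 = p x0].
Proof.
move=> sp; have [p' [sp' p'p p'x0]] := sublin_shift x0 sp.
have [q [sq qp' qmin]] := sublin_min sp'.
have qD x y : q (x + y) = q x + q y.
  have [r [sr rq rxy]] := sublin_shift y sq.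
  have rE := qmin r sr rq; have := rxy x; rewrite rE => h.
  have [h2 _] := sq; have := h2 x y; move=> h3; apply/le_anti; rewrite h3/=; lra.
have qN x : q (- x) = - q x.
  have := qD x (- x); rewrite subrr sublin0//; lra.
have qZr a x : q (a *: x) = a * q x.
  have [a0|a0|->] := ltrgtP a 0; last by rewrite scale0r mul0r sublin0.
    by rewrite -{1}[a]opprK scaleNr qN sublinZ ?oppr_gt0// mulNr opprK.
  exact: sublinZ.
exists q; split.
- by move=> a x y; rewrite qD qZr.
- by move=> x; exact: le_trans (p'p x).
- have := qp' (- x0); have := p'x0 (- x0); rewrite addNr sublin0// qN => h1 h2.
  have h3 := qp' x0; have h4 := p'p x0.
  apply/le_anti; rewrite (le_trans h3 h4)/=; lra.
Qed.

End hahn_banach.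

(** * Separability of the dual of a separable reflexive space *)

Lemma dense_sequence (R : realType) (W : normedModType R) : separable_space W ->
  exists x : nat -> W, forall y (e : R), 0 < e -> exists n, `|y - x n| < e.
Proof.
move=> [D [/countable_injP[f finj] Dd]].
have /choice[x xP] n : exists x, (exists2 y, D y & f y = n) -> D x /\ f x = n.
  have [[y Dy fy]|h] := pselect (exists2 y, D y & f y = n); first by exists y.
  by exists 0 => /h.
exists x => y e e0.
have [| |z [/= yz Dz]] := Dd (ball y e).
- by exists y; exact: ballxx.
- exact: ball_open.
exists (f z); have [|Dx fx] := xP (f z); first by exists z.
have -> : x (f z) = z by apply: finj => //; exact: mem_set.
by move: yz; rewrite -ball_normE.
Qed.

Section functionals.
Context {R : realType} {X : lmodType R}.
Implicit Types u v f : X -> R.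

Definition lin u :=
  (forall x y, u (x + y) = u x + u y) /\ (forall a x, u (a *: x) = a * u x).

Lemma lin0 u : lin u -> u 0 = 0.
Proof. by move=> [_ uZ]; rewrite -(scale0r 0) uZ mul0r. Qed.

Lemma linN u x : lin u -> u (- x) = - u x.
Proof. by move=> [_ uZ]; rewrite -scaleN1r uZ mulN1r. Qed.

Lemma linB u x y : lin u -> u (x - y) = u x - u y.
Proof. by move=> lu; have [uD _] := lu; rewrite uD linN. Qed.

Lemma lin_cst0 : lin (fun=> 0).
Proof. by split=> [x y|a x]; rewrite ?addr0 ?mulr0. Qed.

Lemma lin_add u v : lin u -> lin v -> lin (fun x => u x + v x).
Proof.
move=> [uD uZ] [vD vZ]; split=> [x y|a x].
  by rewrite uD vD addrACA.
by rewrite uZ vZ mulrDr.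
Qed.

Lemma lin_sub u v : lin u -> lin v -> lin (fun x => u x - v x).
Proof.
move=> [uD uZ] [vD vZ]; split=> [x y|a x].
  by rewrite uD vD opprD addrACA.
by rewrite uZ vZ mulrBr.
Qed.

Lemma lin_linear u : lin u -> linear (u : X -> R^o).
Proof. by move=> [uD uZ] a x y; rewrite uD uZ. Qed.

Lemma linear_lin (u : X -> R^o) : linear u -> lin u.
Proof.
move=> h; have uD x y : u (x + y) = u x + u y.
  by rewrite -{1}[x]scale1r h scale1r.
split=> // a x; have u0 : u 0 = 0.
  by have := uD 0 0; rewrite addr0 => /eqP;
    rewrite -subr_eq0 opprD addrA subrr add0r oppr_eq0 => /eqP.
by rewrite -[a *: x]addr0 h u0 addr0.
Qed.

Lemma norming_functional (N : X -> R) x : sublin N -> (forall y, N (- y) = N y) ->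
  exists f, [/\ lin f, forall y, `|f y| <= N y & f x = N x].
Proof.
move=> sN NN; have [f [/linear_lin lf fN fx]] := hahn_banach x sN.
exists f; split => // y; rewrite ler_norml fN andbT.
by have := fN (- y); rewrite linN// NN; lra.
Qed.

End functionals.

Lemma lin_dual (R : realType) (X : normedModType R) (u : X -> R) C :
  lin u -> (forall x, `|u x| <= C * `|x|) -> exists F : dual X, forall x, F x = u x.
Proof.
move=> /lin_linear lu uC.
pose m := GRing.isLinear.Build R X R^o *:%R u lu.
exact: (@bounded_dual R X (HB.pack (u : X -> R^o) m) C uC).
Qed.

Lemma sublin_norm (R : realType) (X : normedModType R) :
  sublin (fun x : X => `|x|).
Proof.
by split=> [x y|a x a0]; [exact: ler_normD|rewrite normrZ gtr0_norm].
Qed.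

Lemma dual_lin (R : realType) (X : normedModType R) (f : dual X) : lin f.
Proof. exact/linear_lin/dual_linear. Qed.

(** Let g n norm x n. If the span of the g n were not dense, Hahn-Banach would give a nonzero
    functional on the dual killing every g n; by reflexivity it is evaluation at some z, and density
    of the x n forces z = 0. *)
Lemma separable_predual (R : realType) (X : normedModType R) :
  separable_space X -> reflexive_space X -> separable_space (dual X).
Proof.
move=> /dense_sequence[x xd] Xr.
have /choice[g gP] n : exists g : dual X, (forall y, `|g y| <= `|y|) /\ g (x n) =
  `|x n|.
  have [f [lf f1 fx]] := norming_functional (x n) (@sublin_norm R X) (@normrN _ X).
  have [|F FE] := @lin_dual R X f 1 lf; first by move=> y; rewrite mul1r.
  by exists F; split=> [y|]; rewrite FE.
apply: (separable_total (e := g)) => f0 d d0; apply: contrapT => hf.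
have far v : in_span g v -> d < `|f0 - v|.
  by move=> sv; rewrite ltNge; apply/negP => h; apply: hf; exists v.
pose A := [set (fun f : dual X => `|f - v|) | v in [set v | in_span g v]].
(* r is the distance to the span; the lower bound handed over records that it is at least d at
   f0. *)
have [| | | |r [sr rA rd]] := @sublin_inf R (dual X) A (fun f => if f == f0 then d
  else 0).
- by exists (fun f => `|f - 0|); exists 0 => //; exact: in_span0.
- move=> _ [v sv <-] f; case: eqP => [->|_]; last exact: normr_ge0.
  exact/ltW/far.
- move=> _ _ [v sv <-] [w sw <-] f h; exists (fun f => `|f - (v + w)|).
    by exists (v + w) => //; exact: in_spanD.
  by rewrite opprD addrACA; exact: ler_normD.
- move=> _ a [v sv <-] a0; exists (fun f => `|f - a *: v|).
    by exists (a *: v) => //; exact: in_spanZ.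
  by move=> f; rewrite -scalerBr normrZ gtr0_norm.
have [phi [/linear_lin lphi phir phi0]] := hahn_banach f0 sr.
have phi_le f : phi f <= `|f|.
  apply: le_trans (phir f) _; have := rA (fun f => `|f - 0|).
  rewrite -[X in _ <= `|X|]subr0; apply.
  by exists 0 => //; exact: in_span0.
have phi1 f : `|phi f| <= 1 * `|f|.
  rewrite mul1r ler_norml phi_le andbT.
  by have := phi_le (- f); rewrite linN// normrN; lra.
have [Phi PhiE] := lin_dual lphi phi1.
have [z zP] := Xr Phi.
have phig n : phi (g n) = 0.
  have le0 w : in_span g w -> phi w <= 0.
    move=> sw; apply: le_trans (phir _) _.
    have := rA (fun f => `|f - w|) (ex_intro2 _ _ w sw erefl) w.
    by rewrite subrr normr0.
  apply/le_anti; rewrite le0; last exact: in_span1.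
  have : phi (- g n) <= 0.
    by apply: le0; rewrite -scaleN1r; apply: in_spanZ; exact: in_span1.
  by rewrite linN//; lra.
have z0 : z = 0.
  apply/eqP; apply: contrapT => /negP zn0; have nz : 0 < `|z| by rewrite normr_gt0.
  (* Since g n vanishes at z, |x n| <= |z - x n|; closeness |z| / 3 would then give |z| <= 2 |z| /
     3. *)
  have [|n zx] := xd z (`|z| / 3); first by rewrite divr_gt0.
  have [gn1 gnx] := gP n.
  have gz : g n z = 0 by rewrite -zP PhiE phig.
  have h1 : `|x n| <= `|z - x n|.
    rewrite -gnx -[leLHS]subr0 -gz -linB; last exact: dual_lin.
    by rewrite (le_trans (ler_norm _))// (le_trans (gn1 _))// distrC.
  have := ler_normD (z - x n) (x n); rewrite subrK; lra.
have := rd f0; rewrite eqxx -phi0 -PhiE zP z0 lin0; last exact: dual_lin.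
by rewrite leNgt d0.
Qed.

(** d 0 = 0 is the common start of all paths. Entries of a dense sequence that violate the bound 2 N
    are replaced by 0; those approximating a functional bounded by N survive, because the accuracy
    is capped at 1. *)
Lemma functional_sequence (R : realType) (X : normedModType R) (N : X -> R) :
  separable_space (dual X) -> (exists2 c, 0 < c & forall x, c * `|x| <= N x) ->
  exists d : nat -> X -> R,
    [/\ forall n, lin (d n), forall n x, `|d n x| <= 2 * N x, forall x, d 0%N x = 0
      & forall f e, lin f -> (forall x, `|f x| <= N x) -> (exists C, forall x, N x
        <= C * `|x|) ->
        0 < e -> exists n, forall x, `|f x - d n x| <= e * N x].
Proof.
move=> /dense_sequence[D Dd] [c c0 cN].
have N0 x : 0 <= N x by apply: le_trans (cN x); rewrite mulr_ge0// ltW.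
pose P n := `[< forall x, `|D n x| <= 2 * N x >].
exists (fun n => if n is m.+1 then if P m then D m : X -> R else fun=> 0 else
  fun=> 0).
split=> [[|n]|[|n] x|//|f e lf fN [C NC] e0].
- exact: lin_cst0.
- by case: (P n); [exact: dual_lin|exact: lin_cst0].
- by rewrite normr0 mulr_ge0.
- by case: ifP => [/asboolP//|_]; rewrite normr0 mulr_ge0.
have [|F FE] := @lin_dual R X f C lf; first by move=> x; apply: le_trans (NC x).
have [|n nP] := Dd F (c * Num.min e 1); first by rewrite mulr_gt0// lt_min e0 ltr01.
have h x : `|f x - D n x| <= Num.min e 1 * N x.
  rewrite -FE (_ : F x - D n x = (F - D n) x)//.
  apply: (le_trans (dual_norm_ub _ _)).
  apply: (@le_trans _ _ (c * Num.min e 1 * `|x|)); first by rewrite ler_wpM2r// ltW.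
  by rewrite mulrAC mulrC ler_wpM2l// le_min ?ltW.
exists n.+1 => x.
have -> : P n.
  apply/asboolP => y; have := h y.
  have : Num.min e 1 * N y <= N y by rewrite ler_piMl// ge_min lexx orbT.
  have := fN y; have := ler_normD (f y) (D n y - f y).
  rewrite addrC subrK distrC; lra.
by apply: (le_trans (h x)); rewrite ler_wpM2r// ge_min lexx.
Qed.

(** * Bounded variation of almost growing sequences *)

Lemma half_cut (R : realFieldType) (s : nat -> R) a b :
  (a <= b)%N -> 0 < \sum_(a <= n < b) s n -> exists c, [/\ (a <= c < b)%N,
    \sum_(a <= n < c) s n <= (\sum_(a <= n < b) s n) / 2 &
    \sum_(c.+1 <= n < b) s n <= (\sum_(a <= n < b) s n) / 2].
Proof.
move=> ab; set S := \sum_(a <= n < b) s n => S0.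
pose P k := ((a < k <= b)%N && (S / 2 < \sum_(a <= n < k) s n)).
have exP : exists k, P k.
  exists b; rewrite /P leqnn -/S andbT ltr_pdivrMr// ltr_pMr// ltr1n andbT.
  rewrite ltn_neqAle ab andbT; apply: contraTN S0 => /eqP ab0.
  by rewrite /S ab0 big_geq// ltxx.
case: (ex_minnP exP) => -[//|c] /andP[/andP[ac cb] hc] cmin.
exists c; split; first by rewrite -ltnS ac.
  have [ca|ca] := leqP c a; first by rewrite big_geq// divr_ge0// ltW.
  rewrite leNgt; apply/negP => h.
  have := cmin c; rewrite /P ca h ltnW//= => /(_ isT).
  by rewrite ltnn.
have : S = \sum_(a <= n < c.+1) s n + \sum_(c.+1 <= n < b) s n.
  by rewrite /S (big_cat_nat (ltnW ac) cb).
lra.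
Qed.

Section variation.
Context {R : realType}.
Variables (delta : R) (q : nat).
Hypotheses (delta0 : 0 < delta) (delta1 : delta <= 1) (q_gt0 : (0 < q)%N)
  (hq : 4 <= (1 + delta / 2) ^+ q).

(** [D a b] stands for the dual norm of h_b - h_a. The error is indexed by the middle point, because
    the weak* neighbourhood controlling later terms is chosen there. *)
Definition almost_growing (D : nat -> nat -> R) (tau : nat -> R) :=
  [/\ forall a b, 0 <= D a b, forall a, D a a = 0,
      forall a c d, (a < c < d)%N ->
        (1 + delta) * Num.min (D a c) (D c d) - tau c <= D a d &
      forall a b c, (a < b < c)%N -> D a b - tau b <= D a c].

(* Cut the sum where it passes one half. Either one block carries a quarter of it,
   or the blocks found on the two sides merge into one on which D is larger by the
   factor 1 + delta / 2; the subtracted terms absorb the errors tau. *)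
Lemma sum_blocks (D : nat -> nat -> R) (tau : nat -> R) :
  (forall i, 0 <= tau i) -> (forall i j, (i <= j)%N -> tau j <= tau i) ->
  almost_growing D tau -> forall a b, (a <= b)%N -> exists a' b',
    [/\ (a <= a')%N, (a' <= b')%N, (b' <= b)%N &
     \sum_(a <= n < b) (D n n.+1 ^+ q - 5 * (24 * tau n / delta) ^+ q) <=
       4 * D a' b' ^+ q].
Proof.
move=> tau0 taud [D0 Daa D1 D2].
pose eta i := 24 * tau i / delta.
pose s n := D n n.+1 ^+ q - 5 * eta n ^+ q.
have eta0 i : 0 <= eta i by rewrite divr_ge0 ?(ltW delta0)// mulr_ge0.
have Dq0 i j : 0 <= D i j ^+ q by rewrite exprn_ge0.
move=> a b; move: {2}(b - a)%N (leqnn (b - a)) => k; elim: k a b => [|k IH] a b.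
  rewrite leqn0 subn_eq0 => ba ab; exists a, a; split => //.
  by rewrite big_geq// mulr_ge0.
move=> bak ab; set S := \sum_(a <= n < b) _.
have [S0|S0] := leP S 0.
  by exists a, a; split => //; rewrite (le_trans S0)// mulr_ge0.
have ab' : (a < b)%N.
  rewrite ltn_neqAle ab andbT; apply: contraTN S0 => /eqP ab0.
  by rewrite /S ab0 big_geq// ltxx.
(* Here 5 = 1 + 4: if no such block existed, the first term and four times the q-th power from the
   induction hypothesis would be absorbed by 5 eta a ^+ q, so S <= 0. *)
have [a0 [b0 [aa0 ab0 bb0 etaJ]]] : exists a0 b0,
    [/\ (a <= a0)%N, (a0 <= b0)%N, (b0 <= b)%N & eta a < D a0 b0].
  have [a'' [b'' [h1 h2 h3 h4]]] : exists a'' b'', [/\ (a.+1 <= a'')%N, (a'' <=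
    b'')%N, (b'' <= b)%N &
     \sum_(a.+1 <= n < b) s n <= 4 * D a'' b'' ^+ q].
    by apply: IH => //; rewrite subnS -ltnS prednK// subn_gt0.
  have SE : S = s a + \sum_(a.+1 <= n < b) s n by rewrite /S big_ltn.
  have [h5|h5] := ltP (eta a) (D a a.+1); first by exists a, a.+1.
  have [h6|h6] := ltP (eta a) (D a'' b'').
    by exists a'', b''; split => //; exact: ltnW.
  have h7 : D a a.+1 ^+ q <= eta a ^+ q by rewrite ler_pXn2r// nnegrE.
  have h8 : D a'' b'' ^+ q <= eta a ^+ q by rewrite ler_pXn2r// nnegrE.
  exfalso; move: S0; rewrite SE /s; lra.
have [c [/andP[ac cb] pre suf]] := half_cut ab S0.
rewrite -/S -/(s _) in pre suf.
have Ssplit : S = \sum_(a <= n < c) s n + s c + \sum_(c.+1 <= n < b) s n.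
  by rewrite /S (big_cat_nat ac (ltnW cb))/= [X in _ + X]big_ltn// addrA.
have [sc|sc] := leP (S / 4) (s c).
  exists c, c.+1; split => //; have : 0 <= eta c ^+ q by exact: exprn_ge0.
  rewrite /s in sc; lra.
have [|a1 [b1 [aa1 ab1 bc1 I1]]] := IH a c _ ac.
  by rewrite -ltnS (leq_trans _ bak)// ltn_sub2r.
have [|a2 [b2 [ca2 ab2 bb2 I2]]] := IH c.+1 b _ cb.
  by rewrite -ltnS (leq_trans _ bak)// ltn_sub2l// ltnS.
rewrite -/(s _) in I1 I2.
(* The left part exceeds S - S / 4 - S / 2 = S / 4, and so does the right part. *)
have E1 : S / 16 < D a1 b1 ^+ q.
  have : \sum_(a <= n < c) s n <= 4 * D a1 b1 ^+ q by exact: I1.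
  lra.
have E2 : S / 16 < D a2 b2 ^+ q.
  have : \sum_(c.+1 <= n < b) s n <= 4 * D a2 b2 ^+ q by exact: I2.
  lra.
have pos i j : S / 16 < D i j ^+ q -> i != j.
  move=> h; apply/eqP => ij; move: h; rewrite ij Daa expr0n gtn_eqF//=.
  rewrite ltNge divr_ge0// ltW//.
have a1b1 : (a1 < b1)%N by rewrite ltn_neqAle ab1 andbT; exact: pos.
have a2b2 : (a2 < b2)%N by rewrite ltn_neqAle ab2 andbT; exact: pos.
have b1a2 : (b1 < a2)%N by exact: leq_ltn_trans bc1 ca2.
pose m := Num.min (D a1 b1) (D a2 b2).
have m0 : 0 <= m by rewrite le_min !D0.
have mS : S / 16 < m ^+ q by rewrite /m minEle; case: ifP.
have tb1 : tau b1 <= tau a by apply: taud; apply: leq_trans ab1.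
have ta2 : tau a2 <= tau a by apply: taud; rewrite ltnW// (leq_ltn_trans ac).
have big : (1 + delta) * (m - tau a) - tau a <= D a1 b2.
  have h1 : (1 + delta) * Num.min (D a1 a2) (D a2 b2) - tau a2 <= D a1 b2.
    by apply: D1; rewrite (ltn_trans a1b1 b1a2).
  have h2 : D a1 b1 - tau b1 <= D a1 a2 by apply: D2; rewrite a1b1.
  have h3 : m - tau a <= Num.min (D a1 a2) (D a2 b2).
    rewrite le_min; have : m <= D a1 b1 by rewrite ge_min lexx.
    have : m <= D a2 b2 by rewrite ge_min lexx orbT.
    have := tau0 a; move=> *; apply/andP; split; lra.
  have : (1 + delta) * (m - tau a) <= (1 + delta) * Num.min (D a1 a2) (D a2 b2).
    by rewrite ler_pM2l// addr_gt0.
  lra.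
(* If the errors are small against m, the merged block keeps a factor 1 + delta / 2, whose q-th
   power is at least 4 by [hq]. *)
have [le3|lt3] := leP ((2 + delta) * tau a) (delta / 2 * m).
  exists a1, b2; split.
  - exact: leq_trans aa1 _.
  - by rewrite ltnW// (ltn_trans a1b1)// (ltn_trans b1a2).
  - exact: bb2.
  - have h1 : (1 + delta / 2) * m <= D a1 b2 by lra.
    have h2 : ((1 + delta / 2) * m) ^+ q <= D a1 b2 ^+ q.
      by rewrite ler_pXn2r// nnegrE ?D0// mulr_ge0// addr_ge0// divr_ge0// ltW.
    rewrite exprMn in h2.
    have h3 : 4 * m ^+ q <= (1 + delta / 2) ^+ q * m ^+ q.
      by rewrite ler_wpM2r// exprn_ge0.
    lra.
(* Otherwise m < 2 (2 + delta) tau a / delta <= 6 tau a / delta. So 4 m <= eta a, the origin of the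
   constant 24, and the block with D > eta a is large enough. *)
exists a0, b0; split => //.
have meta : 4 * m <= eta a.
  rewrite /eta ler_pdivlMr//; have := tau0 a.
  have : delta * tau a <= tau a by rewrite ler_piMl.
  lra.
have h1 : 4 ^+ q * m ^+ q <= D a0 b0 ^+ q.
  rewrite -exprMn ler_pXn2r// ?nnegrE ?D0 ?mulr_ge0//.
  exact/ltW/(le_lt_trans meta).
have h2 : 4 * m ^+ q <= 4 ^+ q * m ^+ q.
  rewrite ler_wpM2r ?exprn_ge0// -[leLHS]expr1.
  by rewrite ler_weXn2l// ler1n.
lra.
Qed.

Lemma geometric_sum_le (m : nat) : \sum_(0 <= n < m) (2 ^+ n)^-1 <= 2 :> R.
Proof.
suff -> : \sum_(0 <= n < m) (2 ^+ n)^-1 = 2 - 2 / 2 ^+ m :> R.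
  by rewrite lerBlDr lerDl divr_ge0// exprn_ge0.
elim: m => [|m IH]; first by rewrite big_geq// expr0 divr1 subrr.
rewrite big_nat_recr//= IH exprS invfM mulrA mulfV// mul1r; lra.
Qed.

Lemma leq_increasing (i : nat -> nat) : (forall n, i n < i n.+1)%N ->
  forall n, (n <= i n)%N.
Proof. by move=> h; elim=> // n IH; exact: leq_ltn_trans IH (h n). Qed.

Lemma increasing_ltn (i : nat -> nat) : (forall n, i n < i n.+1)%N ->
  forall m n, (m < n)%N -> (i m < i n)%N.
Proof.
move=> h m; elim=> // n IH; rewrite ltnS leq_eqVlt => /predU1P[->|/IH mn];
  first exact: h.
exact: ltn_trans mn (h n).
Qed.

(** A subsequence is again almost growing, so [sum_blocks] applies. The subtracted terms add up to
    at most 5 * 2 = 10, since each base is at most 2^-n <= 1. *)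
Lemma variation_bound (D : nat -> nat -> R) (tau : nat -> R) (M : R) :
  (forall i, 0 <= tau i) -> (forall i j, (i <= j)%N -> tau j <= tau i) ->
  (forall i, 24 * tau i / delta <= (2 ^+ i)^-1) ->
  almost_growing D tau -> (forall a b, D a b <= M) ->
  forall (i : nat -> nat) m, (forall n, i n < i n.+1)%N ->
  \sum_(0 <= n < m) D (i n) (i n.+1) ^+ q <= 4 * M ^+ q + 10.
Proof.
move=> tau0 taud tau2 [D0 Daa D1 D2] DM i m iS.
have iM := increasing_ltn iS.
have ile a b : (a <= b)%N -> (i a <= i b)%N.
  by rewrite leq_eqVlt => /predU1P[->//|/iM/ltnW].
have [||||a' [b' [_ _ _ h]]] := @sum_blocks (fun a b => D (i a) (i b)) (tau \o i)
  _ _ _ 0 m.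
- by move=> n; exact: tau0.
- by move=> a b ab; apply: taud; exact: ile.
- split=> [//|//|a c d /andP[ac cd]|a b c /andP[ab bc]].
    by apply: D1; rewrite !iM.
  by apply: D2; rewrite !iM.
- by [].
have h1 : D (i a') (i b') ^+ q <= M ^+ q.
  by rewrite ler_pXn2r// nnegrE// (le_trans (D0 _ _) (DM (i a') (i b'))).
have h2 : \sum_(0 <= n < m) 5 * (24 * (tau \o i) n / delta) ^+ q <= 10.
  rewrite -mulr_sumr; apply: (@le_trans _ _ (5 * (\sum_(0 <= n < m) (2 ^+ n)^-1))).
    rewrite ler_wpM2l//; apply: ler_sum => n _ /=.
    have p0 : 0 <= 24 * tau (i n) / delta by rewrite divr_ge0 ?(ltW delta0)//
      mulr_ge0.
    have p1 : 24 * tau (i n) / delta <= (2 ^+ n)^-1.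
      apply: (le_trans (tau2 _)); rewrite lef_pV2 ?posrE ?exprn_gt0//.
      by rewrite ler_weXn2l ?ler1n// leq_increasing.
    apply: le_trans p1; rewrite -[leRHS]expr1 ler_wiXn2l//.
    by apply: (le_trans (tau2 _)); rewrite invf_le1 ?exprn_gt0// exprn_ege1// ler1n.
  apply: (@le_trans _ _ (5 * 2)); last by lra.
  by rewrite ler_pM2l//; exact: geometric_sum_le.
move: h; rewrite sumrB => h; rewrite /= in h h2.
lra.
Qed.

(* Witness: H j is the largest q-variation of D over partitions of [0, j]. *)
Lemma variation_measure (D : nat -> nat -> R) (tau : nat -> R) (M : R) :
  (forall i, 0 <= tau i) -> (forall i j, (i <= j)%N -> tau j <= tau i) ->
  (forall i, 24 * tau i / delta <= (2 ^+ i)^-1) ->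
  almost_growing D tau -> (forall a b, D a b <= M) ->
  exists H : nat -> R, [/\ forall j, 0 <= H j, forall j, H j <= 4 * M ^+ q + 10 &
    forall i j, (i < j)%N -> H i + D i j ^+ q <= H j].
Proof.
move=> tau0 taud tau2 DG DM.
pose P j (im : (nat -> nat) * nat) := [/\ forall n, (im.1 n < im.1 n.+1)%N,
  im.1 0%N = 0%N & im.1 im.2 = j].
pose S (im : (nat -> nat) * nat) := \sum_(0 <= n < im.2) D (im.1 n) (im.1 n.+1) ^+
  q.
have SB im j : P j im -> S im <= 4 * M ^+ q + 10.
  by move=> [h1 h2 h3]; apply: variation_bound DM _ _ _ => //; exact: tau2.
have D0 : forall a b, 0 <= D a b by case: DG.
have hs j : has_sup [set S im | im in P j].
  split; first by exists (S (id, j)), (id, j).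
  by exists (4 * M ^+ q + 10) => _ [im /SB h <-].
exists (fun j => sup [set S im | im in P j]); split=> [j|j|i j ij].
- apply: (@le_trans _ _ (S (id, j))).
    by apply: sumr_ge0 => n _; rewrite exprn_ge0.
  by apply: sup_upper_bound => //; exists (id, j).
- by apply: ge_sup; [case: (hs j)|move=> _ [im /SB h <-]].
- rewrite -lerBrDr; apply: ge_sup; first by case: (hs i).
  move=> _ [[k m] [/= k1 k2 k3] <-]; rewrite lerBrDr.
  (* Append j to the partition of [0, i]; the values beyond are chosen only to keep the sequence
     increasing. *)
  pose k' n := if (n <= m)%N then k n else (j + (n - m.+1))%N.
  have kE n : (n <= m)%N -> k' n = k n by rewrite /k' => ->.
  have kS : k' m.+1 = j by rewrite /k' ltnn subnn addn0.
  have -> : S (k, m) + D i j ^+ q = S (k', m.+1).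
    rewrite /S/= big_nat_recr//= kS kE// k3; congr (_ + _).
    rewrite !big_nat; apply: eq_bigr => n /andP[_ nm].
    by rewrite !kE// ltnW.
  apply: sup_upper_bound => //; exists (k', m.+1) => //; split=> [n||]/=.
  + rewrite /k'; case: (ltngtP n m) => [nm|mn|->].
    * exact: k1.
    * by rewrite ltn_add2l ltn_sub2r// ltnS.
    * by rewrite subnn addn0 k3.
  + by rewrite /k' leq0n.
  + by rewrite /k' ltnn subnn addn0.
Qed.

End variation.

(** * Growth of the dual norm *)

Section seminorm.
Context {R : realType} {X : lmodType R}.

Definition normlike (N : X -> R) := [/\ forall x y, N (x + y) <= N x + N y,
  forall a x, N (a *: x) = `|a| * N x & forall x, 0 <= N x].

Variable (N : X -> R).
Hypothesis normN : normlike N.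

Lemma nlD x y : N (x + y) <= N x + N y. Proof. by case: normN. Qed.
Lemma nlZ a x : N (a *: x) = `|a| * N x. Proof. by case: normN. Qed.
Lemma nl_ge0 x : 0 <= N x. Proof. by case: normN. Qed.
Lemma nlN x : N (- x) = N x. Proof. by rewrite -scaleN1r nlZ normrN normr1 mul1r.
  Qed.
Lemma nl0 : N 0 = 0. Proof. by rewrite -(scale0r 0) nlZ normr0 mul0r. Qed.
Lemma nlB x y : N (x - y) <= N x + N y. Proof. by rewrite -(nlN y); exact: nlD. Qed.

Lemma real_grid (B d : R) : 0 < d -> exists G : seq R, forall c, `|c| <= B ->
  exists2 g, g \in G & `|c - g| <= d.
Proof.
move=> d0; exists [seq k%:R * d - B | k <- iota 0 (Num.truncn (2 * B / d)).+1] =>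
  c cB.
have cB0 : 0 <= (c + B) / d.
  by rewrite divr_ge0 ?(ltW d0)//; move: cB; rewrite ler_norml => /andP[]; lra.
have /andP[h1 h2] := truncn_itv cB0.
exists ((Num.truncn ((c + B) / d))%:R * d - B).
  apply/mapP; exists (Num.truncn ((c + B) / d)) => //.
  rewrite mem_iota/= ltnS; apply: le_truncn.
  rewrite ler_pM2r ?invr_gt0//; move: cB; rewrite ler_norml => /andP[]; lra.
move: h1 h2; rewrite ler_pdivlMr// ltr_pdivrMr// -natr1 => h1 h2.
by rewrite ler_norml; apply/andP; split; lra.
Qed.

Definition submod (V : set X) := V 0 /\ forall a x y, V x -> V y -> V (a *: x + y).

Lemma submodZ V a x : submod V -> V x -> V (a *: x).
Proof. by move=> [V0 VD] Vx; rewrite -[a *: x]addr0; exact: VD. Qed.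

Lemma submodD V x y : submod V -> V x -> V y -> V (x + y).
Proof. by move=> [V0 VD] Vx Vy; rewrite -[x]scale1r; exact: VD. Qed.

Lemma submodB V x y : submod V -> V x -> V y -> V (x - y).
Proof. by move=> sV Vx Vy; apply: submodD => //; rewrite -scaleN1r;
  exact: submodZ. Qed.

Lemma list_bound (A : seq X) : exists2 M, 0 <= M & forall a, a \in A -> N a <= M.
Proof.
exists (\sum_(a <- A) N a); first by apply: sumr_ge0 => a _; exact: nl_ge0.
move=> a; elim: A => // b A IH; rewrite inE big_cons => /predU1P[->|/IH h].
  by rewrite lerDl; apply: sumr_ge0 => c _; exact: nl_ge0.
by rewrite (le_trans h)// lerDr nl_ge0.
Qed.

(** Total boundedness of the r-ball modulo V, by induction on the number of vectors spanning modulo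
    V. If e0 is in the N-closure of V, elements of V replace it. Otherwise a positive lower bound
    for its distance to V bounds its coefficient, and a finite grid suffices. *)
Lemma finite_codim_net n (V : set X) (e : 'I_n -> X) (r eta : R) :
  submod V -> (forall x, exists c : 'I_n -> R, V (x - \sum_(i < n) c i *: e i)) ->
  0 <= r -> 0 < eta ->
  exists A : seq X, forall x, N x <= r -> exists a v,
    [/\ a \in A, V v & N (x - a - v) <= eta].
Proof.
move=> + + r0; elim: n V e eta => [|n IH] V e eta sV Ve eta0.
  exists [:: 0] => x _; exists 0, x; rewrite mem_head subr0 subrr nl0 (ltW eta0).
  by have [c] := Ve x; rewrite big_ord0 subr0.
have e20 : 0 < eta / 2 by rewrite divr_gt0.
pose e0 := e ord0.
pose V' := [set x | exists c : R, V (x - c *: e0)].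
have sV' : submod V'.
  split; first by exists 0; rewrite scale0r subr0; case: sV.
  move=> a x y [c Vc] [d Vd]; exists (a * c + d).
  rewrite scalerDl -scalerA opprD addrACA -scalerBr.
  by apply: submodD => //; exact: submodZ.
have [|A' A'P] := IH V' (fun i => e (lift ord0 i)) _ sV' _ e20.
  move=> x; have [c] := Ve x; rewrite big_ord_recl => Vx.
  exists (fun i => c (lift ord0 i)); exists (c ord0).
  by rewrite -addrA -opprD [X in - X]addrC.
have [d0|] := pselect (forall d : R, 0 < d -> exists2 w, V w & N (e0 - w) <= d).
  exists A' => x /A'P[a [v [aA [c Vc] h]]].
  have [|w Vw wd] := d0 (eta / 2 / (`|c| + 1)).
    by rewrite divr_gt0// ltr_wpDl.
  exists a, (v - c *: e0 + c *: w); split => //.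
    by apply: submodD => //; exact: submodZ.
  have -> : x - a - (v - c *: e0 + c *: w) = (x - a - v) + c *: (e0 - w).
    by rewrite scalerBr !opprD opprK !addrA.
  rewrite (le_trans (nlD _ _))// [leRHS]splitr lerD// nlZ.
  apply: (@le_trans _ _ (`|c| * (eta / 2 / (`|c| + 1))));
    first by rewrite ler_wpM2l.
  rewrite mulrCA ler_piMr ?(ltW e20)// ler_pdivrMr ?ltr_wpDl// mul1r lerDl//.
move=> /existsNP[d /not_implyP[d0 dP]].
have far w : V w -> d < N (e0 - w).
  by move=> Vw; rewrite ltNge; apply/negP => h; apply: dP; exists w.
have [M M0 MA] := list_bound A'.
have Ne1 : 0 < N e0 + 1 by rewrite ltr_wpDl ?nl_ge0.
have [|G GP] := @real_grid ((r + M + eta / 2) / d) (eta / 2 / (N e0 + 1)).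
  by rewrite divr_gt0.
exists [seq a + g *: e0 | a <- A', g <- G] => x xr.
have [a [v [aA [c Vc] h]]] := A'P x xr.
have cb : `|c| <= (r + M + eta / 2) / d.
  rewrite ler_pdivlMr//; have [->|c0] := eqVneq c 0.
    by rewrite normr0 mul0r !addr_ge0// ltW.
  have nc0 : 0 < `|c| by rewrite normr_gt0.
  have Nv : N v <= r + M + eta / 2.
    have -> : v = (x - a) - (x - a - v) by rewrite opprB addrC subrK.
    rewrite (le_trans (nlB _ _))// lerD// (le_trans (nlB _ _))// lerD//.
    exact: MA.
  apply: le_trans Nv; have := far (- c^-1 *: (v - c *: e0)) (submodZ _ sV Vc).
  have -> : e0 - - c^-1 *: (v - c *: e0) = c^-1 *: v.
    by rewrite scaleNr opprK scalerBr scalerA mulVf// scale1r addrC subrK.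
  by rewrite nlZ normfV ltr_pdivlMl// => /ltW.
have [g gG cg] := GP c cb.
exists (a + g *: e0), (v - c *: e0); split => //.
  exact: (allpairs_f (fun a (g : R) => a + g *: e0)).
have -> : x - (a + g *: e0) - (v - c *: e0) = (x - a - v) + (c - g) *: e0.
  by rewrite scalerBl !opprD !opprK !addrA [LHS](ACl (1*2*4*5*3)%AC).
rewrite (le_trans (nlD _ _))// [leRHS]splitr lerD// nlZ.
apply: (@le_trans _ _ (eta / 2 / (N e0 + 1) * N e0));
  first by rewrite ler_wpM2r// nl_ge0.
by rewrite mulrAC ler_pdivrMr// ler_pM2l// lerDl.
Qed.

(** Each useful centre is exchanged for a point of the unit ball near it modulo V, at the price of
    doubling the error. Centres in the ball are what keeps N v <= 3 in [dual_growth]. *)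
Lemma unit_ball_net n (V : set X) (e : 'I_n -> X) (eta : R) :
  submod V -> (forall x, exists c : 'I_n -> R, V (x - \sum_(i < n) c i *: e i)) ->
  0 < eta ->
  exists A : seq X, (forall a, a \in A -> N a <= 1) /\
    forall x, N x <= 1 -> exists a v, [/\ a \in A, V v & N (x - a - v) <= eta].
Proof.
move=> sV Ve eta0; have e20 : 0 < eta / 2 by rewrite divr_gt0.
have [A AP] := finite_codim_net sV Ve ler01 e20.
pose Q a y := N y <= 1 /\ exists2 v, V v & N (y - a - v) <= eta / 2.
have /choice[y yP] a : exists y, N y <= 1 /\ ((exists x, Q a x) -> Q a y).
  have [[x Qx]|h] := pselect (exists x, Q a x).
    by exists x; split => //; case: Qx.
  by exists 0; rewrite nl0 ler01.
exists (map y A); split=> [_ /mapP[a _ ->]|x x1]; first by have [] := yP a.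
have [a [v [aA Vv h]]] := AP x x1.
have [ya /(_ _)[|_ [w Vw h2]]] := yP a; first by exists x; split => //; exists v.
exists (y a), (v - w); split; [exact: map_f|exact: submodB|].
have -> : x - y a - (v - w) = (x - a - v) - (y a - a - w).
  rewrite !opprD !opprK !addrA [RHS](ACl (1*4*3*6*2*5)%AC)/=.
  by rewrite -[RHS]addrA addNr addr0.
by rewrite (le_trans (nlB _ _))// [leRHS]splitr lerD.
Qed.

Lemma codim_ker n (V : set X) (e : 'I_n -> X) (h : X -> R) :
  submod V -> (forall x, exists c : 'I_n -> R, V (x - \sum_(i < n) c i *: e i)) ->
  lin h -> exists n' (e' : 'I_n' -> X), submod (V `&` [set x | h x = 0]) /\
   forall x, exists c : 'I_n' -> R, (V `&` [set x | h x = 0]) (x - \sum_(i < n') c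
     i *: e' i).
Proof.
move=> sV Ve lh; have [hD hZ] := lh.
have sW : submod (V `&` [set x | h x = 0]).
  split; first by split; [case: sV|exact: lin0].
  move=> a x y [Vx hx] [Vy hy]; split; first by case: sV => _; exact.
  by rewrite /= hD hZ hx hy mulr0 addr0.
have [[v0 Vv0 hv0]|hV] := pselect (exists2 v, V v & h v != 0); last first.
  exists n, e; split=> // x; have [c Vc] := Ve x; exists c; split=> //=.
  by apply/eqP; apply: contrapT => /negP hx; apply: hV;
    exists (x - \sum_(i < n) c i *: e i).
exists n.+1, (fun i => if unlift ord0 i is Some j then e j else v0); split=> // x.
have [c Vc] := Ve x; pose w := x - \sum_(i < n) c i *: e i.
exists (fun i => if unlift ord0 i is Some j then c j else h w / h v0).
rewrite big_ord_recl unlift_none.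
under eq_bigr do rewrite liftK.
have -> : x - (h w / h v0 *: v0 + \sum_(i < n) c i *: e i) = w - h w / h v0 *: v0.
  by rewrite opprD addrAC addrA addrAC.
split; first by apply: submodB => //; exact: submodZ.
by rewrite /= linB// hZ divfK// subrr.
Qed.

End seminorm.

Section dual_seminorm.
Context {R : realType} {X : lmodType R}.
Variable (N : X -> R).
Hypothesis normN : normlike N.
Implicit Types u h v : X -> R.

Definition bdd u := lin u /\ exists C, forall x, `|u x| <= C * N x.

Definition dual_norm_for u : R := sup [set `|u x| | x in [set x | N x <= 1]].

Lemma dual_norm_for_has_sup u : bdd u -> has_sup [set `|u x| | x in [set x | N x
  <= 1]].
Proof.
move=> [lu [C uC]]; split; first by exists `|u 0|, 0 => //=; rewrite nl0 ?ler01.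
exists `|C| => _ [x /= x1 <-]; rewrite (le_trans (uC x))//.
apply: (@le_trans _ _ (`|C| * N x)).
  by rewrite ler_wpM2r ?ler_norm//; exact: nl_ge0.
by rewrite ler_piMr.
Qed.

Lemma dual_norm_for_unit u x : bdd u -> N x <= 1 -> `|u x| <= dual_norm_for u.
Proof. by move=> /dual_norm_for_has_sup hs x1; apply: sup_upper_bound => //;
  exists x. Qed.

Lemma dual_norm_for_ge0 u : bdd u -> 0 <= dual_norm_for u.
Proof. by move=> bu; apply: le_trans (@dual_norm_for_unit u 0 bu _) => //;
  rewrite nl0 ?ler01. Qed.

Lemma dual_norm_for_ub u x : bdd u -> `|u x| <= dual_norm_for u * N x.
Proof.
move=> bu; have [[uD uZ] [C uC]] := bu.
have [Nx0|Nx0] := eqVneq (N x) 0.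
  by have := uC x; rewrite Nx0 !mulr0.
have Nx : 0 < N x by rewrite lt_neqAle eq_sym Nx0 nl_ge0.
have := @dual_norm_for_unit u ((N x)^-1 *: x) bu; rewrite uZ nlZ// normrM normfV.
by rewrite (gtr0_norm Nx) mulVf// lexx ler_pdivrMl// mulrC; exact.
Qed.

Lemma dual_norm_for_lub u C : 0 <= C -> (forall x, `|u x| <= C * N x) ->
  dual_norm_for u <= C.
Proof.
move=> C0 uC; apply: ge_sup; first by exists `|u 0|, 0 => //=; rewrite nl0 ?ler01.
by move=> _ [x /= x1 <-]; rewrite (le_trans (uC x))// ler_piMr.
Qed.

Lemma bdd_add u v : bdd u -> bdd v -> bdd (fun x => u x + v x).
Proof.
move=> [lu [C uC]] [lv [D vD]]; split; first exact: lin_add.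
by exists (C + D) => x; rewrite mulrDl (le_trans (ler_normD _ _))// lerD.
Qed.

Lemma bdd_sub u v : bdd u -> bdd v -> bdd (fun x => u x - v x).
Proof.
move=> [lu [C uC]] [lv [D vD]]; split; first exact: lin_sub.
by exists (C + D) => x; rewrite mulrDl (le_trans (ler_normB _ _))// lerD.
Qed.

Lemma dual_norm_forD u v : bdd u -> bdd v -> dual_norm_for (fun x => u x + v x) <=
  dual_norm_for u + dual_norm_for v.
Proof.
move=> bu bv; apply: dual_norm_for_lub;
  first by rewrite addr_ge0// dual_norm_for_ge0.
by move=> x; rewrite mulrDl (le_trans (ler_normD _ _))// lerD// dual_norm_for_ub.
Qed.

Lemma dual_norm_for_attained u d : bdd u -> 0 < d -> exists2 x, N x <= 1 &
  dual_norm_for u - d <= u x.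
Proof.
move=> bu d0; have [_ [x /= x1 <-] h] := sup_adherent d0 (dual_norm_for_has_sup bu).
have [[uD uZ] _] := bu.
have [ux|ux] := leP 0 (u x); first by exists x => //; rewrite ltW// -(ger0_norm ux).
exists (- x); first by rewrite nlN.
by rewrite linN; [rewrite ltr0_norm in h => //; exact: ltW|case: bu].
Qed.

(* Asymptotic smoothness is used at one fixed scale t only. *)
Definition flat_at (t : R) := forall x, N x = 1 -> exists n (V : set X) (e : 'I_n
  -> X),
  [/\ submod V, forall x, exists c : 'I_n -> R, V (x - \sum_(i < n) c i *: e i) &
      forall y, V y -> N y <= 1 -> N (x + t *: y) <= 1 + t / 24].

(* Test h + u on x + t y, where x norms h and y, in the finite-codimensional space
   V `&` ker h, norms u up to a factor 3. A finite net of the unit ball modulo that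
   space turns the existence of y into finitely many smallness conditions on u. *)
Lemma dual_growth (t : R) (h : X -> R) (B tau : R) :
  0 < t -> t <= 1 -> flat_at t -> bdd h -> 0 < tau -> 0 <= B ->
  exists A : seq X, forall u, bdd u -> dual_norm_for u <= B ->
    (forall a, a \in A -> `|u a| <= 2) ->
    dual_norm_for h - tau <= dual_norm_for (fun x => h x + u x) /\
    (1 + t / 6) * Num.min (dual_norm_for h) (dual_norm_for u) - tau <=
      dual_norm_for (fun x => h x + u x).
Proof.
move=> t0 t1 flat bh tau0 B0.
have [h0|h0] := leP (dual_norm_for h) 0.
  exists [::] => u bu uB _.
  have g0 := dual_norm_for_ge0 (bdd_add bh bu).
  have hE : dual_norm_for h = 0 by apply/le_anti; rewrite h0 dual_norm_for_ge0.
  have m0 : Num.min (dual_norm_for h) (dual_norm_for u) = 0 by rewrite hE min_l//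
    dual_norm_for_ge0.
  rewrite m0 hE mulr0; split; lra.
(* The second bound makes h positive at an almost norming vector, which can then be normalised to N
   x = 1 as [flat_at] demands. *)
pose z := Num.min (tau / 4) (dual_norm_for h / 2).
have z0 : 0 < z by rewrite lt_min !divr_gt0.
have [x [x1 hx]] : exists x, N x = 1 /\ dual_norm_for h - z <= h x.
  have [x x1 hx] := dual_norm_for_attained bh z0.
  have hx0 : 0 < h x.
    have : z <= dual_norm_for h / 2 by rewrite ge_min lexx orbT.
    lra.
  have [lh _] := bh; have [hD hZ] := lh.
  have Nx : 0 < N x.
    have := @dual_norm_for_ub h x bh; rewrite lt_neqAle nl_ge0// andbT.
    rewrite (gtr0_norm hx0); case: (eqVneq 0 (N x)) => // <-.
    by rewrite mulr0 leNgt hx0.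
  exists ((N x)^-1 *: x); split.
    by rewrite nlZ// normfV gtr0_norm// mulVf// gt_eqF.
  rewrite hZ (le_trans hx)// ler_peMl ?(ltW hx0)//.
  by rewrite invf_ge1.
have [n [V [e [sV Ve Vflat]]]] := flat x x1.
have [n' [e' [sW We]]] := codim_ker sV Ve (proj1 bh).
pose eta := Num.min 1 (tau / 4 / (B + 1)).
have eta0 : 0 < eta by rewrite lt_min ltr01 !divr_gt0// ltr_wpDl.
have [A [A1 AP]] := unit_ball_net normN sW We eta0.
have z4 : z <= tau / 4 by rewrite ge_min lexx.
(* Scaling by 2 / z turns the smallness condition with bound 2 into |u a| <= z. *)
exists [seq (2 / z) *: a | a <- x :: A] => u bu uB uA.
have [lu _] := bu; have [uD uZ] := lu.
have [lh _] := bh; have [hD hZ] := lh.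
have uz a : a \in x :: A -> `|u a| <= z.
  move=> aA; have := uA _ (map_f (fun a => (2 / z) *: a) aA).
  rewrite uZ normrM gtr0_norm ?divr_gt0// mulrAC ler_pdivrMr//.
  by rewrite ler_pM2l.
have ux : - z <= u x by have := uz x (mem_head _ _); rewrite ler_norml => /andP[].
have bhu := bdd_add bh bu.
have nhu0 := dual_norm_for_ge0 bhu.
split.
  have := @dual_norm_for_unit (fun x => h x + u x) x bhu;
    rewrite x1 lexx => /(_ isT).
  have := ler_norm (h x + u x); lra.
have [y' y'1 uy'] := dual_norm_for_attained bu z0.
have [a [v [aA [Vv hv] av]]] := AP y' y'1.
have uav : dual_norm_for u - 3 * (tau / 4) <= u v.
  have -> : v = y' - a - (y' - a - v) by rewrite opprB [RHS]addrC subrK.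
  rewrite (linB _ _ lu) (linB _ _ lu).
  have h1 : u a <= z.
    by have := uz a; rewrite inE aA orbT => /(_ isT); exact: le_trans (ler_norm _).
  have h2 : u (y' - a - v) <= tau / 4.
    rewrite (le_trans (ler_norm _))// (le_trans (dual_norm_for_ub _ bu))//.
    apply: (@le_trans _ _ (B * eta));
      first by rewrite ler_pM ?dual_norm_for_ge0 ?nl_ge0.
    apply: (@le_trans _ _ (B * (tau / 4 / (B + 1)))).
      by rewrite ler_wpM2l// ge_min lexx orbT.
    by rewrite mulrCA ler_piMr ?divr_ge0 ?(ltW tau0)// ler_pdivrMr ?ltr_wpDl//
      mul1r lerDl.
  lra.
have Nv : N v <= 3.
  have -> : v = y' - a - (y' - a - v) by rewrite opprB [RHS]addrC subrK.
  have h1 := nlB normN (y' - a) (y' - a - v).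
  have h2 := nlB normN y' a; have h3 := A1 a aA.
  have h4 : eta <= 1 by rewrite ge_min lexx.
  lra.
pose y := 3^-1 *: v.
have Ny : N y <= 1 by rewrite nlZ// gtr0_norm// ler_pdivrMl// mulr1.
have Nxy : N (x + t *: y) <= 1 + t / 24.
  by apply: Vflat => //; exact: submodZ.
have hy : h y = 0 by rewrite /y hZ (hv : h v = 0) mulr0.
have huxy : dual_norm_for h - 2 * z + t * ((dual_norm_for u - 3 * (tau / 4)) / 3) <=
    dual_norm_for (fun x => h x + u x) * (1 + t / 24).
  apply: (@le_trans _ _ (h (x + t *: y) + u (x + t *: y))).
    rewrite hD uD (hZ t) (uZ t) hy mulr0 addr0 (uZ 3^-1).
    have : t * ((dual_norm_for u - 3 * (tau / 4)) / 3) <= t * (3^-1 * u v).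
      by rewrite ler_pM2l// mulrC ler_pM2l.
    lra.
  apply: le_trans (ler_norm _) _;
    apply: (le_trans (@dual_norm_for_ub _ (x + t *: y) bhu)).
  by rewrite ler_wpM2l.
set m := Num.min _ _.
have m1 : m <= dual_norm_for h by rewrite ge_min lexx.
have m2 : m <= dual_norm_for u by rewrite ge_min lexx orbT.
have m0 : 0 <= m by rewrite le_min !dual_norm_for_ge0.
have t240 : 0 < 1 + t / 24 by rewrite addr_gt0// divr_gt0.
(* The gain t / 3, coming from y = v / 3, outweighs the flatness loss: (1 + t / 6) (1 + t / 24) <= 1
   + t / 3 for t <= 1. *)
rewrite -(ler_pM2r t240); apply: le_trans huxy.
have e1 : t * (m / 3) <= t * (dual_norm_for u / 3) by rewrite ler_pM2l// ler_pM2r.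
have e2 : t * tau <= tau by rewrite ler_piMl// ltW.
have e3 : 0 <= t * tau by rewrite mulr_ge0// ltW.
have e4 : t * m <= m by rewrite ler_piMl.
have e5 : t * (t * m) <= t * m by rewrite ler_pM2l.
have e6 : 0 <= t * m by rewrite mulr_ge0// ltW.
lra.
Qed.

End dual_seminorm.

(** * Paths of approximants *)

(** Weak* compactness of the dual ball, by Tychonoff on the product of the segments [- N x, N x].
    The sequence need not converge, hence the arbitrarily late index for each finite list. *)
Lemma pointwise_cluster (R : realType) (X : choiceType) (N : X -> R) (f_ : nat ->
  X -> R) :
  (forall n x, `|f_ n x| <= N x) -> exists f : X -> R,
  forall (l : seq X) (e : R) n0, 0 < e ->
  exists2 n, (n0 <= n)%N & forall x, x \in l -> `|f_ n x - f x| < e.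
Proof.
move=> fN.
have := @tychonoff X (fun=> R) (fun x => `[- N x, N x]%classic) (fun x =>
  @segment_compact R _ _).
move=> /(_ (f_ @ \oo) _)[|f [_ fc]].
  by exists 0%N => // n _ x /=; rewrite in_itv/= -ler_norml.
exists f => l e n0 e0; have FF := @nbhs_filter _ f.
have nl : nbhs f [set g : X -> R | forall x, x \in l -> `|g x - f x| < e].
  elim: l => [|x l IH]; first exact: filterS filterT.
  have h : nbhs f [set g : X -> R | `|g x - f x| < e].
    apply: (@proj_continuous X (fun=> R) x f [set y : R | `|y - f x| < e]).
    apply/nbhs_ballP; exists e => // y; rewrite -ball_normE /ball_/= distrC.
    exact.
  apply: (@filterS _ _ FF _ _ _ (@filterI _ _ FF _ _ h IH)) => g [g1 g2] y.
  by rewrite inE => /predU1P[->|/g2].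
have [|_ [[n n0n <-] h]] := fc [set f_ n | n in [set n | (n0 <= n)%N]] _ _ nl.
  by exists n0 => // n /= n0n; exists n.
by exists n.
Qed.

Section paths.
Context {R : realType} {X : lmodType R}.
Variable (N : X -> R).
Hypothesis normN : normlike N.
Variable (d : nat -> X -> R).
Hypothesis (d_lin : forall n, lin (d n)) (d_le : forall n x, `|d n x| <= 2 * N x)
  (d0 : forall x, d 0%N x = 0).

Definition unit_functional (f : X -> R) := lin f /\ forall x, `|f x| <= N x.

Hypothesis d_dense : forall f e, unit_functional f -> 0 < e ->
  exists n, forall x, `|f x - d n x| <= e * N x.

(* The sets d n + {|.| <= 1 on A n} + e B are weak* neighbourhoods that cover the
   weak* compact dual ball, because (d n) is norm dense in it. *)
Lemma weak_star_cover (A : nat -> seq X) (e : R) : 0 < e ->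
  exists L, forall f, unit_functional f -> exists n w, [/\ (n <= L)%N, lin w,
    forall x, `|w x| <= e * N x & forall a, a \in A n -> `|f a - d n a - w a| <= 1].
Proof.
move=> e0; apply: contrapT => /forallNP hL.
have /choice[f_ fP] L : exists f, unit_functional f /\
    ~ exists n w, [/\ (n <= L)%N, lin w, forall x, `|w x| <= e * N x &
        forall a, a \in A n -> `|f a - d n a - w a| <= 1].
  by have /existsNP[f /not_implyP[uf hf]] := hL L; exists f.
have [f fc] := @pointwise_cluster R X N f_ (fun n => (fP n).1.2).
have uf : unit_functional f.
  split; first split.
  - move=> x y; apply/eqP; rewrite -subr_eq0 -normr_le0.
    apply/ler_addgt0Pr => e' e'0; rewrite add0r.
    have e30 : 0 < e' / 3 by rewrite divr_gt0.
    have [n _ h] := fc [:: x; y; x + y] _ 0%N e30.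
    have hx := h x; have hy := h y; have hxy := h (x + y).
    rewrite !inE !eqxx ?orbT in hx hy hxy.
    have := hx isT; have := hy isT; have := hxy isT.
    have [fD _] := (fP n).1.1; rewrite fD !ltr_norml => /andP[? ?] /andP[? ?]
      /andP[? ?].
    by rewrite ler_norml; apply/andP; split; lra.
  - move=> a x; apply/eqP; rewrite -subr_eq0 -normr_le0.
    apply/ler_addgt0Pr => e' e'0; rewrite add0r.
    have c0 : 0 < `|a| + 1 by rewrite ltr_wpDl.
    have e30 : 0 < e' / 2 / (`|a| + 1) by rewrite !divr_gt0.
    have [n _ h] := fc [:: x; a *: x] _ 0%N e30.
    have hx := h x; have hax := h (a *: x).
    rewrite !inE !eqxx ?orbT in hx hax.
    have [_ fZ] := (fP n).1.1; have := hax isT; rewrite fZ.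
    have -> : f (a *: x) - a * f x = a * (f_ n x - f x) - (a * f_ n x - f (a *: x)).
      by rewrite mulrBr; lra.
    have h1 : `|a| * `|f_ n x - f x| <= e' / 2.
      apply: (@le_trans _ _ ((`|a| + 1) * (e' / 2 / (`|a| + 1)))).
        by rewrite ler_pM// ?lerDl// ltW// hx.
      by rewrite mulrC divfK// gt_eqF.
    have h2 : e' / 2 / (`|a| + 1) <= e' / 2.
      by rewrite ler_pdivrMr// ler_peMr// ?lerDr// divr_ge0// ltW.
    have := ler_normB (a * (f_ n x - f x)) (a * f_ n x - f (a *: x)).
    rewrite normrM; lra.
  - move=> x; apply/ler_addgt0Pr => e' e'0.
    have [n _ /(_ x (mem_head _ _)) h] := fc [:: x] _ 0%N e'0.
    have := (fP n).1.2 x; have := ler_normB (f_ n x) (f_ n x - f x).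
    by rewrite subKr; lra.
(* A term f_m with m >= n that is close to the cluster point f on A n lies in the n-th set, with w =
   f - d n, against the choice of f_m. *)
have [n nP] := d_dense uf e0.
have [m nm h] := fc (A n) 1 n ltr01.
have [_ []] := fP m; exists n, (fun x => f x - d n x); split=> //.
  by apply: lin_sub => //; case: uf.
move=> a aA; have := h a aA.
have -> : f_ m a - d n a - (f a - d n a) = f_ m a - f a by lra.
exact: ltW.
Qed.

End paths.

Section weak_star_paths.
Context {R : realType} {X : lmodType R}.
Variable (N : X -> R).
Hypothesis normN : normlike N.
Variable (d : nat -> X -> R).
Hypothesis (d_lin : forall n, lin (d n)) (d_le : forall n x, `|d n x| <= 2 * N x)
  (d0 : forall x, d 0%N x = 0).
Hypothesis d_dense : forall f e, unit_functional N f -> 0 < e ->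
  exists n, forall x, `|f x - d n x| <= e * N x.
Variables (t : R) (x : nat -> X).
Hypotheses (t0 : 0 < t) (t1 : t <= 1) (flat : flat_at N t).

(** With delta = t / 6 this gives 24 * level_error i / delta = 4^-i, below the 2^-i that
    [variation_measure] asks for. *)
Definition level_error (i : nat) : R := t / 6 / 24 / 4 ^+ i.

Lemma level_error_gt0 i : 0 < level_error i.
Proof. by rewrite !divr_gt0// exprn_gt0. Qed.

Lemma level_error_le i : level_error i <= (4 ^+ i)^-1.
Proof.
rewrite /level_error ler_piMl ?invr_ge0 ?exprn_ge0//.
move: t0 t1; lra.
Qed.

Lemma level_error_mono i j : (i <= j)%N -> level_error j <= level_error i.
Proof.
move=> ij; rewrite /level_error ler_pM2l ?divr_gt0// lef_pV2 ?posrE ?exprn_gt0//.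
by rewrite ler_weXn2l// ler1n.
Qed.

Lemma d_bdd n : bdd N (d n).
Proof. by split=> //; exists 2. Qed.

(** L and the test vectors are built before f is chosen: labels at most L i leave finitely many
    differences of approximants, so the test vectors of [dual_growth] for all of them fit into one
    finite list. The last two conclusions are a rate of convergence on the x k. *)
Lemma weak_star_paths : exists (L : nat -> nat) (p : (X -> R) -> nat -> nat),
  forall f, unit_functional N f -> [/\ p f 0%N = 0%N, forall i, (p f i <= L i)%N,
    almost_growing (t / 6) (fun i j => dual_norm_for N (fun y => d (p f j) y - d
      (p f i) y)) level_error,
    forall i j k, (0 < i)%N -> (i <= j)%N -> (k <= i)%N ->
      `|d (p f j) (x k) - d (p f i) (x k)| <= 2 * (1 + N (x k)) / 4 ^+ i &
    forall i k, (0 < i)%N -> (k <= i)%N ->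
      `|f (x k) - d (p f i) (x k)| <= (1 + N (x k)) / 4 ^+ i].
Proof.
(* Half of [level_error i] is the error allowed to [dual_growth]; the other half, 6 e i, absorbs the
   norm perturbations w. *)
pose e i := level_error i / 12.
have e0 i : 0 < e i by rewrite divr_gt0 ?level_error_gt0.
have e_mono i j : (i <= j)%N -> e j <= e i.
  by move=> ij; rewrite ler_pM2r ?invr_gt0// level_error_mono.
have e_le i : e i <= (4 ^+ i)^-1.
  apply: le_trans (level_error_le i); have := level_error_gt0 i; rewrite /e; lra.
have e1 i : e i <= 1.
  by rewrite (le_trans (e_le i))// invf_le1 ?exprn_gt0// exprn_ege1// ler1n.
(* The bound 8: the remainders v below are bounded by (1 + 2 + 1) N, and u will be a difference of
   two. *)
have /choice[G GP] (nmi : nat * nat * nat) : exists A : seq X, forall u, bdd N u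
  -> dual_norm_for N u <= 8 ->
    (forall a, a \in A -> `|u a| <= 2) ->
    let h := fun y => d nmi.1.1 y - d nmi.1.2 y in
    dual_norm_for N h - level_error nmi.2 / 2 <= dual_norm_for N (fun y => h y + u
      y) /\
    (1 + t / 6) * Num.min (dual_norm_for N h) (dual_norm_for N u) - level_error
      nmi.2 / 2 <=
      dual_norm_for N (fun y => h y + u y).
  apply: dual_growth => //; first exact: bdd_sub (d_bdd _) (d_bdd _).
  by rewrite divr_gt0 ?level_error_gt0.
have /choice[cov covP] (Ai : (nat -> seq X) * nat) := weak_star_cover d_lin
  d_dense Ai.1 (e0 Ai.2).
(* Tests at level i for the candidate n: all earlier tests, those of [dual_growth] for d n - d m
   with m <= L, and the multiples 4 ^+ i of the x k, which force the decay. *)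
pose B (i L : nat) (Acc : seq X) n := Acc ++ flatten [seq G (n, m, i) | m <- iota
  0 L.+1] ++
  [seq 4 ^+ i *: x k | k <- iota 0 i.+1].
pose st := fix st i : nat * seq X := if i is j.+1 then
    let L := maxn (st j).1 (cov (B i (st j).1 (st j).2, i)) in
    (L, (st j).2 ++ flatten [seq B i (st j).1 (st j).2 n | n <- iota 0 L.+1])
  else (0%N, [::]).
pose L i := (st i).1; pose Acc i := (st i).2.
pose Bl i n := B i.+1 (L i) (Acc i) n.
have LS i : L i.+1 = maxn (L i) (cov (Bl i, i.+1)) by [].
have AccS i : Acc i.+1 = Acc i ++ flatten [seq Bl i n | n <- iota 0 (L i.+1).+1]
  by [].
have Lmono i j : (i <= j)%N -> (L i <= L j)%N.
  elim: j => [|j IH]; first by rewrite leqn0 => /eqP->.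
  rewrite leq_eqVlt => /predU1P[->//|ij]; apply: leq_trans (IH ij) _.
  by rewrite LS leq_maxl.
have Amono i j a : (i <= j)%N -> a \in Acc i -> a \in Acc j.
  elim: j => [|j IH]; first by rewrite leqn0 => /eqP->.
  rewrite leq_eqVlt => /predU1P[->//|ij] /(IH ij) aj.
  by rewrite AccS mem_cat aj.
have AB i n a : a \in Acc i -> a \in Bl i n by rewrite /Bl /B mem_cat => ->.
have BA i n a : (n <= L i.+1)%N -> a \in Bl i n -> a \in Acc i.+1.
  move=> nL aB; rewrite AccS mem_cat; apply/orP; right; apply/flatten_mapP.
  by exists n => //; rewrite mem_iota.
have GB i n m a : (m <= L i)%N -> a \in G (n, m, i.+1) -> a \in Bl i n.
  move=> mL aG; rewrite /Bl /B mem_cat; apply/orP; right; rewrite mem_cat;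
    apply/orP; left.
  by apply/flatten_mapP; exists m => //; rewrite mem_iota.
have xB i n k : (k <= i.+1)%N -> 4 ^+ i.+1 *: x k \in Bl i n.
  move=> ki; rewrite /Bl /B mem_cat; apply/orP; right; rewrite mem_cat; apply/orP;
    right.
  by apply/mapP; exists k => //; rewrite mem_iota.
have /choice[pw pwP] (fi : (X -> R) * nat) : exists nw : nat * (X -> R),
  unit_functional N fi.1 ->
    [/\ (nw.1 <= L fi.2.+1)%N, lin nw.2, forall y, `|nw.2 y| <= e fi.2.+1 * N y &
      forall a, a \in Bl fi.2 nw.1 -> `|fi.1 a - d nw.1 a - nw.2 a| <= 1].
  have [uf|] := pselect (unit_functional N fi.1); last by exists (0%N, fi.1).
  have [n [w [h1 h2 h3 h4]]] := covP (Bl fi.2, fi.2.+1) _ uf.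
  exists (n, w) => _; split => //=.
  by apply: leq_trans h1 _; rewrite LS leq_maxr.
pose p f i := if i is j.+1 then (pw (f, j)).1 else 0%N.
exists L, p => f uf.
pose w i := if i is j.+1 then (pw (f, j)).2 else f.
have [lf fN] := uf.
have pL i : (p f i <= L i)%N by case: i => [//|i]; have [] := pwP (f, i) uf.
have wlin i : lin (w i) by case: i => [//|i]; have [] := pwP (f, i) uf.
have wle i y : (0 < i)%N -> `|w i y| <= e i * N y.
  by case: i => [//|i] _; have [_ _ + _] := pwP (f, i) uf; exact.
(* f splits into the approximant, a norm-small w and a remainder v that is at most 1 on the
   tests. *)
pose v i y := f y - d (p f i) y - w i y.
have vB i a : a \in Bl i (p f i.+1) -> `|v i.+1 a| <= 1.
  by have [_ _ _] := pwP (f, i) uf; exact.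
have bf : bdd N f by split=> //; exists 1 => y; rewrite mul1r.
have bw i : (0 < i)%N -> bdd N (w i) by move=> i0; split=> //; exists (e i) => y;
  exact: wle.
have bv i : (0 < i)%N -> bdd N (v i).
  by move=> i0; apply: bdd_sub (bw i i0); exact: bdd_sub bf (d_bdd _).
have v4 i y : (0 < i)%N -> `|v i y| <= 4 * N y.
  move=> i0; have h1 := fN y; have h2 := d_le (p f i) y.
  have h3 : `|w i y| <= N y.
    by rewrite (le_trans (wle i y i0))// ler_piMl//; exact: nl_ge0.
  have := ler_normB (f y - d (p f i) y) (w i y).
  have := ler_normB (f y) (d (p f i) y).
  rewrite /v; lra.
(* Tests are never discarded, so later remainders obey them too; a difference of two remainders is
   then at most 2 on them, as [dual_growth] requires. *)
have vBj i j a : (i < j)%N -> a \in Bl i (p f i.+1) -> `|v j a| <= 1.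
  case: j => // j; rewrite ltnS leq_eqVlt => /predU1P[<-|ij] aB; first exact: vB.
  by apply: vB; apply: AB; apply: Amono ij _; exact: BA (pL i.+1) aB.
have dv i j y : d (p f j) y - d (p f i) y = (v i y - v j y) + (w i y - w j y).
  by rewrite /v; lra.
pose D i j := dual_norm_for N (fun y => d (p f j) y - d (p f i) y).
have bD i j : bdd N (fun y => d (p f j) y - d (p f i) y).
  exact: bdd_sub (d_bdd _) (d_bdd _).
have step a c b : (a < c)%N -> (c < b)%N -> D a c - level_error c <= D a b /\
    (1 + t / 6) * Num.min (D a c) (D c b) - level_error c <= D a b.
  case: c => // c; rewrite ltnS => ac cb.
  pose u y := v c.+1 y - v b y.
  pose z y := w c.+1 y - w b y; pose z' y := w b y - w c.+1 y.
  have b0 : (0 < b)%N by exact: leq_ltn_trans cb.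
  have bu : bdd N u by apply: bdd_sub; exact: bv.
  have bz : bdd N z by apply: bdd_sub; exact: bw.
  have bz' : bdd N z' by apply: bdd_sub; exact: bw.
  have u8 : dual_norm_for N u <= 8.
    apply: dual_norm_for_lub => // y; have := ler_normB (v c.+1 y) (v b y).
    have := v4 c.+1 y isT; have := v4 b y b0; rewrite /u; lra.
  have ze y : `|w c.+1 y| + `|w b y| <= 2 * e c.+1 * N y.
    have h1 := wle c.+1 y isT; have h2 := wle b y b0.
    have : e b * N y <= e c.+1 * N y.
      by rewrite ler_wpM2r ?e_mono ?(ltnW cb)//; exact: nl_ge0.
    lra.
  have e20 : 0 <= 2 * e c.+1 by rewrite mulr_ge0// ltW.
  have zle : dual_norm_for N z <= 2 * e c.+1.
    by apply: dual_norm_for_lub => // y; exact: le_trans (ler_normB _ _) (ze y).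
  have z'le : dual_norm_for N z' <= 2 * e c.+1.
    by apply: dual_norm_for_lub => // y; apply: le_trans (ler_normB _ _) _;
      rewrite addrC.
  have [] := GP (p f c.+1, p f a, c.+1) u bu u8.
    move=> a0 aG.
    have aB := GB c (p f c.+1) (p f a) a0 (leq_trans (pL a) (Lmono _ _ ac)) aG.
    have := vB c a0 aB; have := vBj c b a0 (ltnW cb) aB.
    have := ler_normB (v c.+1 a0) (v b a0); rewrite /u; lra.
  rewrite /= -/(D a c.+1) => g1 g2.
  have bhu := bdd_add (bD a c.+1) bu.
  have F1 : dual_norm_for N (fun y => (d (p f c.+1) y - d (p f a) y) + u y) <= D a
    b + 2 * e c.+1.
    have -> : (fun y => (d (p f c.+1) y - d (p f a) y) + u y) =
        (fun y => (d (p f b) y - d (p f a) y) + z' y).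
      by apply/funext => y; have := dv c.+1 b y; rewrite /u /z'; lra.
    apply: (@le_trans _ _ (D a b + dual_norm_for N z')); last by rewrite lerD2l.
    exact: (dual_norm_forD normN (bD a b) bz').
  have F2 : D c.+1 b <= dual_norm_for N u + 2 * e c.+1.
    have -> : D c.+1 b = dual_norm_for N (fun y => u y + z y).
      by congr dual_norm_for; apply/funext => y; rewrite dv.
    apply: (@le_trans _ _ (dual_norm_for N u + dual_norm_for N z));
      last by rewrite lerD2l.
    exact: (dual_norm_forD normN bu bz).
  have eE : level_error c.+1 = 12 * e c.+1 by rewrite /e; lra.
  rewrite eE in g1 g2 *; have ec := e0 c.+1; split; first lra.
  have m1 : Num.min (D a c.+1) (D c.+1 b) <= Num.min (D a c.+1) (dual_norm_for N
    u) + 2 * e c.+1.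
    rewrite -lerBlDr le_min; apply/andP; split.
      have : Num.min (D a c.+1) (D c.+1 b) <= D a c.+1 by rewrite ge_min lexx.
      lra.
    have : Num.min (D a c.+1) (D c.+1 b) <= D c.+1 b by rewrite ge_min lexx orbT.
    lra.
  move: m1 g2; set m := Num.min _ _; set m' := Num.min _ _ => m1 g2.
  have h1 : (1 + t / 6) * m <= (1 + t / 6) * (m' + 2 * e c.+1).
    by rewrite ler_pM2l// addr_gt0// divr_gt0.
  have h2 : t * e c.+1 <= e c.+1 by rewrite ler_piMl// ltW.
  lra.
split=> //.
- split.
  + by move=> a b; apply: dual_norm_for_ge0 => //;
    exact: bdd_sub (d_bdd _) (d_bdd _).
  + move=> a; change (D a a = 0); apply/le_anti/andP; split; last first.
      exact: (dual_norm_for_ge0 normN (bD a a)).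
    by apply: dual_norm_for_lub => // y; rewrite subrr normr0 mul0r.
  + by move=> a c b /andP[ac cb]; have [] := step a c b ac cb.
  + by move=> a b c /andP[ab bc]; have [] := step a b c ab bc.
- move=> [//|i] j k _ ij ki; rewrite dv.
  have h4 : 0 < 4 ^+ i.+1 :> R by rewrite exprn_gt0.
  have vk l : (i < l)%N -> `|v l (x k)| <= (4 ^+ i.+1)^-1.
    move=> il; have := vBj i l _ il (xB i (p f i.+1) k ki).
    have [[_ vZ] _] := bv l (leq_ltn_trans (leq0n _) il).
    by rewrite vZ normrM gtr0_norm// -ler_pdivlMl// mulr1.
  have wk l : (i < l)%N -> `|w l (x k)| <= (4 ^+ i.+1)^-1 * N (x k).
    move=> il; apply: (le_trans (wle l (x k) (leq_ltn_trans (leq0n _) il))).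
    rewrite ler_wpM2r//; first exact: nl_ge0.
    by rewrite (le_trans (e_mono _ _ il)).
  rewrite (le_trans (ler_normD _ _))//.
  have := ler_normB (v i.+1 (x k)) (v j (x k)).
  have := ler_normB (w i.+1 (x k)) (w j (x k)).
  have := vk i.+1 (ltnSn i); have := vk j ij.
  have := wk i.+1 (ltnSn i); have := wk j ij.
  move: ((4 ^+ i.+1)^-1) => c; lra.
- move=> [//|i] k _ ki.
  have h4 : 0 < 4 ^+ i.+1 :> R by rewrite exprn_gt0.
  have vk : `|v i.+1 (x k)| <= (4 ^+ i.+1)^-1.
    have := vB i _ (xB i (p f i.+1) k ki).
    have [[_ vZ] _] := bv i.+1 isT.
    by rewrite vZ normrM gtr0_norm// -ler_pdivlMl// mulr1.
  have wk : `|w i.+1 (x k)| <= (4 ^+ i.+1)^-1 * N (x k).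
    apply: (le_trans (wle i.+1 (x k) isT)).
    by rewrite ler_wpM2r//; exact: nl_ge0.
  have -> : f (x k) - d (p f i.+1) (x k) = v i.+1 (x k) + w i.+1 (x k).
    by rewrite /v; lra.
  rewrite (le_trans (ler_normD _ _))//.
  move: ((4 ^+ i.+1)^-1) vk wk => c; lra.
Qed.

End weak_star_paths.

(** * Embedding into a tree space *)

Lemma mkseq_rcons (T : Type) (b : nat -> T) n : mkseq b n.+1 = rcons (mkseq b n)
  (b n).
Proof. by rewrite /mkseq -addn1 iotaD map_cat/= cats1. Qed.

Lemma exists_small_pow2 (R : realType) (c e : R) n0 : 0 < e ->
  exists2 K, (n0 <= K)%N & c / 2 ^+ K <= e.
Proof.
move=> e0; exists (maxn n0 (Num.bound (`|c| / e))); first exact: leq_maxl.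
set K := maxn _ _; rewrite ler_pdivrMr ?exprn_gt0// mulrC -ler_pdivrMr//.
apply: (@le_trans _ _ (`|c| / e)); first by rewrite ler_pM2r ?invr_gt0// ler_norm.
apply: (@le_trans _ _ K%:R).
  apply: (@le_trans _ _ (Num.bound (`|c| / e))%:R).
    by apply/ltW/archi_boundP; rewrite divr_ge0// ltW.
  by rewrite ler_nat leq_maxr.
by rewrite -natrX ler_nat ltnW// ltn_expl.
Qed.

Section tree_embedding.
Context {R : realType} {X : lmodType R}.
Variable (N : X -> R).
Hypothesis normN : normlike N.
Variable (d : nat -> X -> R).
Hypothesis (d_lin : forall n, lin (d n)) (d_le : forall n y, `|d n y| <= 2 * N y)
  (d0 : forall y, d 0%N y = 0).
Variables (x : nat -> X).
Hypothesis x_dense : forall y (e : R), 0 < e -> exists k, N (y - x k) < e.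
Hypothesis norming : forall y, exists2 f, unit_functional N f & f y = N y.

(* These hypotheses are delivered by weak_star_paths and variation_measure. *)
Variables (q : nat) (C : R) (L : nat -> nat) (p : (X -> R) -> nat -> nat)
  (H : (X -> R) -> nat -> R).
Hypotheses (q_gt0 : (0 < q)%N)
  (p0 : forall f, unit_functional N f -> p f 0%N = 0%N)
  (pL : forall f, unit_functional N f -> forall i, (p f i <= L i)%N)
  (H0 : forall f, unit_functional N f -> forall i, 0 <= H f i)
  (HC : forall f, unit_functional N f -> forall i, H f i <= C)
  (Hp : forall f, unit_functional N f -> forall i j, (i < j)%N ->
    H f i + dual_norm_for N (fun y => d (p f j) y - d (p f i) y) ^+ q <= H f j)
  (p_tail : forall f, unit_functional N f -> forall i j k,
     (0 < i)%N -> (i <= j)%N -> (k <= i)%N ->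
     `|d (p f j) (x k) - d (p f i) (x k)| <= 2 * (1 + N (x k)) / 4 ^+ i)
  (p_cvg : forall f, unit_functional N f -> forall i k, (0 < i)%N -> (k <= i)%N ->
     `|f (x k) - d (p f i) (x k)| <= (1 + N (x k)) / 4 ^+ i).

(** Letter i ends the node at depth i + 1; the root gets label 0 by default, which is [p f 0]. The
    increment of H is rounded down here, and the successor in [weight] lifts it above the increment
    again. *)
Definition path_word (f : X -> R) (i : nat) : nat * nat :=
  (p f i.+1, Num.truncn (2 ^+ i.+1 * (H f i.+1 - H f i))).

Definition label (s : seq (nat * nat)) := (last (0, 0)%N s).1.

Lemma label_path_word f i : unit_functional N f -> label (mkseq (path_word f) i) =
  p f i.
Proof.
move=> uf; case: i => [|i]; first by rewrite p0.
by rewrite mkseq_rcons /label last_rcons.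
Qed.

Lemma H_mono f i j : unit_functional N f -> (i <= j)%N -> H f i <= H f j.
Proof.
move=> uf; rewrite leq_eqVlt => /predU1P[->//|ij].
apply: le_trans (Hp uf ij); rewrite lerDl exprn_ge0//;
  apply: dual_norm_for_ge0 => //.
by apply: bdd_sub; exact: (d_bdd d_lin d_le).
Qed.

Lemma weight_path_word f i : unit_functional N f ->
  H f i.+1 - H f i <= weight (mkseq (path_word f) i.+1) <= H f i.+1 - H f i + (2
    ^+ i.+1)^-1.
Proof.
move=> uf; rewrite /weight mkseq_rcons last_rcons/= size_rcons size_mkseq.
have p20 : 0 < 2 ^+ i.+1 :> R by rewrite exprn_gt0.
have h0 : 0 <= 2 ^+ i.+1 * (H f i.+1 - H f i).
  by rewrite mulr_ge0 ?(ltW p20)// subr_ge0 H_mono.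
have /andP[h1 h2] := truncn_itv h0.
apply/andP; split; first by rewrite ler_pdivlMr// mulrC ltW.
rewrite ler_pdivrMr// mulrDl mulVf ?gt_eqF// -natr1 lerD2r.
move: h1; lra.
Qed.

Lemma wsum_path_word f m n : unit_functional N f -> (m <= n)%N ->
  H f n - H f m <= wsum (path_word f) m.+1 n.+1.
Proof.
move=> uf mn; rewrite -telescope_sumr// /wsum big_add1/=.
by apply: ler_sum => i _; have /andP[] := weight_path_word i uf.
Qed.

(** C bounds the total increment of H, 1 is the weight of the root, and 2 bounds the rounding
    errors. *)
Lemma wsum_path_word_le f n : unit_functional N f -> wsum (path_word f) 0 n.+1 <=
  C + 3.
Proof.
move=> uf; rewrite /wsum big_ltn//.
have -> : weight (mkseq (path_word f) 0) = 1 :> R by rewrite /weight/= expr0 divr1.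
rewrite big_add1/=.
have h1 : \sum_(0 <= i < n) weight (mkseq (path_word f) i.+1) <=
    (H f n - H f 0%N) + \sum_(0 <= i < n) (2 ^+ i)^-1 :> R.
  rewrite -telescope_sumr// -big_split/=; apply: ler_sum => i _.
  have /andP[_ h] := weight_path_word i uf; apply: (le_trans h).
  by rewrite lerD2l lef_pV2 ?posrE ?exprn_gt0// ler_weXn2l// ler1n.
have := geometric_sum_le (R := R) n; have := H0 uf 0%N; have := HC uf n.
lra.
Qed.

(** Coordinates are kept at these nodes only: elsewhere the weight need not dominate the increment
    between the labels. *)
Definition path_node (s : seq (nat * nat)) :=
  exists2 f, unit_functional N f & s = mkseq (path_word f) (size s).

(* The coordinates of y are the increments, along the paths of approximants of the
   unit functionals, of the values at y. *)
Definition tree_coord (y : X) (s : seq (nat * nat)) : R :=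
  if `[< path_node s >] then d (label s) y - d (label (take (size s).-1 s)) y else
    0.

Lemma tree_coord_lin s : lin (tree_coord^~ s).
Proof.
rewrite /tree_coord; case: asboolP => _; last exact: lin_cst0.
exact: lin_sub.
Qed.

Lemma tree_coord_path_word y f i : unit_functional N f ->
  tree_coord y (mkseq (path_word f) i) = d (p f i) y - d (p f i.-1) y.
Proof.
move=> uf; rewrite /tree_coord asboolT; last by exists f; rewrite ?size_mkseq.
rewrite label_path_word// size_mkseq; congr (_ - d _ y).
rewrite -(label_path_word i.-1 uf); congr label.
by case: i => [//|i]/=; rewrite mkseq_rcons -cats1 takel_cat ?size_mkseq//
  take_oversize// size_mkseq.
Qed.

(** Prefixes of a path node belong to the path of the same f. So on any branch the last path node
    before n yields one f for all nodes up to it, and the coordinates after it vanish. *)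
Lemma path_part b n : exists f n', [/\ unit_functional N f, (n' <= n)%N,
  forall i, (i < n')%N -> mkseq b i = mkseq (path_word f) i &
  forall i y, (n' <= i < n)%N -> tree_coord y (mkseq b i) = 0].
Proof.
elim: n => [|n [f [n' [uf n'n h1 h2]]]].
  by have [f uf _] := norming 0; exists f, 0%N; split.
have [[g ug gE]|ng] := pselect (path_node (mkseq b n)).
  exists g, n.+1; split=> // [i|i y]; last by rewrite leqNgt andNb.
  rewrite ltnS => iN; rewrite size_mkseq in gE.
  have -> : mkseq b i = take i (mkseq b n).
    by rewrite -map_take take_iota (minn_idPl iN).
  by rewrite gE -map_take take_iota (minn_idPl iN).
exists f, n'; split=> //; first exact: leqW.
move=> i y /andP[n'i]; rewrite ltnS leq_eqVlt => /predU1P[->|iN].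
  by rewrite /tree_coord asboolF.
by apply: h2; rewrite n'i.
Qed.

Lemma tree_coord_segment b m n : exists f, unit_functional N f /\
  ((forall y, zsum (tree_coord y) b m n = 0) \/
   exists n', [/\ (m < n' <= n)%N,
     forall y, zsum (tree_coord y) b m n = d (p f n'.-1) y - d (p f m.-1) y &
     wsum b m n' = wsum (path_word f) m n' :> R]).
Proof.
have [f [n' [uf n'n h1 h2]]] := path_part b n; exists f; split=> //.
have [n'm|mn'] := leqP n' m.
  left=> y; rewrite /zsum big_nat big1// => i /andP[mi ni].
  by apply: h2; rewrite (leq_trans n'm mi).
right; exists n'; split; first by rewrite mn'.
  move=> y; rewrite (@zsum_cat _ _ _ _ n'); last by rewrite (ltnW mn').
  rewrite [X in _ + X](_ : _ = 0) ?addr0; last first.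
    by rewrite /zsum big_nat big1// => i; exact: h2.
  have -> : zsum (tree_coord y) b m n' = \sum_(m <= i < n') (d (p f i) y - d (p f
    i.-1) y).
    rewrite /zsum !big_nat; apply: eq_bigr => i /andP[_ iN].
    by rewrite h1// tree_coord_path_word.
  elim: n' mn' {n'n h1 h2} => // k IH; rewrite ltnS leq_eqVlt => /predU1P[->|mk].
    by rewrite big_nat1.
  by rewrite big_nat_recr/= ?IH//; [lra|exact: ltnW].
by rewrite /wsum !big_nat; apply: eq_bigr => i /andP[_ iN]; rewrite h1.
Qed.

(** The sum telescopes to a difference of two approximants of one f. Its dual norm to the power q is
    at most an increment of H, hence at most the weight of the segment. *)
Lemma tree_coord_bound y : tree_bound q (tree_coord y) (N y).
Proof.
move=> b m n; have [f [uf [->|[n' [/andP[mn' n'n] -> wE]]]]] := tree_coord_segment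
  b m n.
  by rewrite normr0 mulr_ge0 ?theta_ge0//; exact: nl_ge0.
have bd : bdd N (fun y => d (p f n'.-1) y - d (p f m.-1) y).
  by apply: bdd_sub; exact: (d_bdd d_lin d_le).
apply: (le_trans (dual_norm_for_ub normN y bd)); rewrite mulrC ler_wpM2l//;
  first exact: nl_ge0.
rewrite -(ler_pXn2r q_gt0) ?nnegrE ?theta_ge0//; last exact: dual_norm_for_ge0.
rewrite thetaX// (@wsum_cat _ b m n'); last by rewrite (ltnW mn').
rewrite -[leLHS]addr0 lerD ?wsum_ge0// wE.
(* Segments starting at m = 0 and m = 1 telescope alike, since the coordinate at the root is 0; for
   m = 0 the weight of the root is dropped. *)
have wle : wsum (path_word f) m.-1.+1 n'.-1.+1 <= wsum (path_word f) m n' :> R.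
  have n'0 : (0 < n')%N by exact: leq_ltn_trans mn'.
  rewrite (prednK n'0); case: (m) mn' => [|k] mn' //=.
  by rewrite [leRHS](@wsum_cat _ _ _ 1)// lerDr wsum_ge0.
have [lt|ge] := ltnP m.-1 n'.-1.
  apply: le_trans wle; apply: le_trans (wsum_path_word uf (ltnW lt)).
  by rewrite lerBrDl; exact: Hp.
have -> : m.-1 = n'.-1.
  by apply/eqP; rewrite eqn_leq ge andbT -!subn1 leq_sub2r// ltnW.
rewrite [X in X ^+ q](_ : _ = 0) ?expr0n ?gtn_eqF ?wsum_ge0//.
apply/le_anti/andP; split; last by apply: dual_norm_for_ge0 => //; apply: bdd_sub;
  exact: (d_bdd d_lin d_le).
by apply: dual_norm_for_lub => // z; rewrite subrr normr0 mul0r.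
Qed.

(** Only finitely many letters can occur at each depth, because labels are at most [L] and
    increments of H at most C. *)
Fixpoint path_nodes n : seq (seq (nat * nat)) := if n is k.+1 then
  [seq rcons s a | s <- path_nodes k, a <- [seq (i, j) | i <- iota 0 (L k.+1).+1,
     j <- iota 0 (Num.truncn (2 ^+ k.+1 * C)).+1]]
  else [:: [::]].

Lemma mem_path_nodes f n : unit_functional N f -> mkseq (path_word f) n \in
  path_nodes n.
Proof.
move=> uf; elim: n => [|n IH]; first by rewrite inE.
rewrite mkseq_rcons; apply: allpairs_f => //.
apply: (allpairs_f (fun i j => (i, j))); rewrite mem_iota/= add0n ltnS;
  first exact: pL.
apply: le_truncn; rewrite ler_pM2l ?exprn_gt0//.
have := HC uf n.+1; have := H0 uf n; lra.
Qed.

(** Cut off at depth K. Beyond it, a segment entered at depth m' has a sum of order 4^-m' at x k,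
    while its weight is at least 2^-m', hence so is its q-th root. *)
Lemma tree_coord_approx_x k : tree_approx q (tree_coord (x k)).
Proof.
(* The factor 8 turns 2 (1 + N (x k)) / 4 ^+ i into at most e / 2 ^+ i.+1; K >= k + 2 makes i = m' -
   1 positive and at least k, as [p_tail] asks. *)
move=> e e0; have [K Kk hK] := @exists_small_pow2 R (8 * (1 + N (x k))) e k.+2 e0.
pose z0 s : R := if (size s < K)%N then tree_coord (x k) s else 0.
exists z0.
  exists (flatten [seq path_nodes n | n <- iota 0 K]) => s hs; rewrite /z0.
  case: ifP => // sK; rewrite /tree_coord asboolF// => -[f uf sE].
  case/negP: hs; apply/flatten_mapP; exists (size s); first by rewrite mem_iota.
  by rewrite sE size_mkseq; exact: mem_path_nodes.
move=> b m n; pose m' := maxn m K.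
have [nm'|m'n] := leqP n m'.
  rewrite /zsum big_nat big1 ?normr0 ?mulr_ge0 ?theta_ge0 ?(ltW e0)//.
  move=> i /andP[mi iN]; change (tree_coord (x k) (mkseq b i) - z0 (mkseq b i) = 0).
  rewrite /z0 size_mkseq; case: ltnP => [_|Ki]; first by rewrite subrr.
  by move: nm'; rewrite leqNgt /m' gtn_max (leq_ltn_trans mi iN) (leq_ltn_trans Ki
    iN).
have mm' : (m <= m' <= n)%N by rewrite leq_maxl ltnW.
have -> : zsum (tree_coord (x k) - z0) b m n = zsum (tree_coord (x k)) b m' n.
  rewrite (zsum_cat _ _ mm') [X in X + _](_ : _ = 0) ?add0r.
    rewrite /zsum !big_nat; apply: eq_bigr => i /andP[mi _].
    change (tree_coord (x k) (mkseq b i) - z0 (mkseq b i) = tree_coord (x k)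
      (mkseq b i)).
    by rewrite /z0 size_mkseq ltnNge (leq_trans (leq_maxr m K) mi)/= subr0.
  rewrite /zsum big_nat big1// => i /andP[mi];
    rewrite /m' leq_max ltnNge mi/= => iK.
  change (tree_coord (x k) (mkseq b i) - z0 (mkseq b i) = 0).
  by rewrite /z0 size_mkseq iK subrr.
have [f [uf [->|[n' [/andP[mn' n'n] -> _]]]]] := tree_coord_segment b m' n.
  by rewrite normr0 mulr_ge0 ?theta_ge0// ltW.
have Km' : (K <= m')%N by exact: leq_maxr.
have km' : (k.+2 <= m')%N by exact: leq_trans Km'.
have th : (2 ^+ m')^-1 <= theta q b m n :> R.
  rewrite -(ler_pXn2r q_gt0) ?nnegrE ?theta_ge0 ?invr_ge0 ?exprn_ge0// thetaX//.
  apply: (@le_trans _ _ (2 ^+ m')^-1).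
    rewrite -[leRHS]expr1 ler_wiXn2l ?invr_ge0 ?exprn_ge0//.
    by rewrite invf_le1 ?exprn_gt0// exprn_ege1// ler1n.
  rewrite (wsum_cat _ mm') -[leLHS]add0r lerD ?wsum_ge0//.
  rewrite /wsum big_ltn// -[leLHS]addr0 lerD//; last exact: wsum_ge0.
  by rewrite /weight size_mkseq -[leLHS]mul1r ler_pM2r ?invr_gt0 ?exprn_gt0// ler1n.
apply: (@le_trans _ _ (e * (2 ^+ m')^-1)); last by rewrite ler_wpM2l// ltW.
have m'0 : (0 < m'.-1)%N by rewrite -ltnS prednK;
  [exact: leq_trans km'|exact: leq_trans km'].
have [i m'E] : exists i, m' = i.+1 by exists m'.-1; rewrite prednK//;
  exact: leq_trans km'.
rewrite m'E/= in m'0 mn' km' Km' *.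
apply: (le_trans (p_tail uf m'0 _ _)).
- by rewrite -ltnS prednK// (leq_ltn_trans _ mn').
- by rewrite -ltnS ltnW.
have hK' : 8 * (1 + N (x k)) <= e * 2 ^+ i.+1.
  apply: (@le_trans _ _ (e * 2 ^+ K)); first by rewrite -ler_pdivrMr ?exprn_gt0.
  by rewrite ler_pM2l// ler_weXn2l// ler1n.
have p4 : 4 ^+ i = 2 ^+ i * 2 ^+ i :> R by rewrite -exprMn; congr (_ ^+ _); lra.
have p20 : 0 < 2 ^+ i :> R by rewrite exprn_gt0.
rewrite p4 ler_pdivrMr ?mulr_gt0// mulrAC ler_pdivlMr ?exprn_gt0// exprS in hK' *.
have : 8 * (1 + N (x k)) * 2 ^+ i <= e * (2 * 2 ^+ i) * 2 ^+ i by rewrite ler_pM2r.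
lra.
Qed.

(** [tree_coord] is linear and bounded by N, so approximability spreads from the dense sequence to
    all y. *)
Lemma tree_coord_le y : tree_le q (tree_coord y) (N y).
Proof.
split; [exact: nl_ge0|exact: tree_coord_bound|].
apply: tree_approx_closed => e e0; have [k yk] := x_dense y e0.
exists (tree_coord (x k)); first exact: tree_coord_approx_x.
have -> : tree_coord y - tree_coord (x k) = tree_coord (y - x k).
  by apply/funext => s; rewrite (linB _ _ (tree_coord_lin s)).
by apply: tree_bound_mono (tree_coord_bound _); exact: ltW.
Qed.

(** Test the bound on the path of an f norming y: the sum down to depth n telescopes to h_n y, close
    to f y = N y, and the path weighs at most C + 3. *)
Lemma tree_coord_below y r : 0 <= r -> tree_bound q (tree_coord y) r -> N y <= (C
  + 3) * r.
Proof.
move=> r0 hr; have [f uf <-] := norming y; have [lf fN] := uf.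
have C0 : 0 <= C by apply: le_trans (H0 uf 0%N) (HC uf 0%N).
(* The budget: e / 4 for f (y - x k), e / 2 for the approximant at y - x k because of its bound 2 N,
   and e / 4 for their difference at x k. *)
apply/ler_addgt0Pr => e e0; have e40 : 0 < e / 4 by rewrite divr_gt0.
have [k yk] := x_dense y e40.
have [n kn hn] := @exists_small_pow2 R (1 + N (x k)) _ k.+1 e40.
have n0 : (0 < n)%N by exact: leq_trans kn.
have := p_cvg uf n0 (ltnW kn).
have h4 : (1 + N (x k)) / 4 ^+ n <= e / 4.
  apply: le_trans hn; rewrite ler_pM2l ?ltr_pwDl ?nl_ge0//.
  by rewrite lef_pV2 ?posrE ?exprn_gt0// lerXn2r ?nnegrE//; lra.
have zE : zsum (tree_coord y) (path_word f) 0 n.+1 = d (p f n) y.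
  have h i : tree_coord y (mkseq (path_word f) i) = d (p f i) y - d (p f i.-1) y
    by exact: tree_coord_path_word.
  rewrite /zsum; elim: n {kn hn n0 h4} => [|n IH].
    by rewrite big_nat1 h subrr p0// d0.
  by rewrite big_nat_recr//= IH h /=; lra.
have := hr (path_word f) 0%N n.+1; rewrite zE => h1.
have th : theta q (path_word f) 0 n.+1 <= C + 3.
  rewrite -(ler_pXn2r q_gt0) ?nnegrE ?theta_ge0 ?addr_ge0// thetaX//.
  apply: (le_trans (wsum_path_word_le n uf)); rewrite -[leLHS]expr1 ler_weXn2l//;
    lra.
have h2 : r * theta q (path_word f) 0 n.+1 <= (C + 3) * r by rewrite mulrC
  ler_wpM2r.
have h3 : `|f (y - x k)| <= e / 4 by apply: le_trans (fN _) (ltW yk).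
have h5 : `|d (p f n) (y - x k)| <= e / 2.
  by apply: (le_trans (d_le _ _)); move: yk; lra.
rewrite (linB _ _ lf) in h3; rewrite (linB _ _ (d_lin _)) in h5.
move: h1 h3 h5; rewrite !ler_norml => /andP[? ?] /andP[? ?] /andP[? ?] /andP[? ?].
lra.
Qed.

End tree_embedding.

Lemma closed_range (R : realType) (X : completeNormedModType R) (Y : normedModType
  R)
  (T : {linear X -> Y}) (c C : R) : 0 < c ->
  (forall x, c * `|x| <= `|T x| <= C * `|x|) -> closed (range T).
Proof.
move=> c0 TcC y yT.
have ex (e : R) : 0 < e -> exists x, `|y - T x| < e.
  move=> e0; have [_ [[x _ <-] h]] := yT _ (nbhsx_ballx y e e0).
  by exists x; move: h; rewrite -ball_normE.
have /choice[x xP] n : exists x, `|y - T x| < n.+1%:R^-1 by apply: ex;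
  rewrite invr_gt0.
have : cvgn x.
  apply/cauchy_cvgP/cauchy_exP => e e0.
  have [|M MP] := @eventually_invn_lt R (c * (e / 2));
    first by rewrite !mulr_gt0// invr_gt0.
  exists (x M), M => // n /= Mn; rewrite -ball_normE /ball_/=.
  rewrite -(ltr_pM2l c0); have /andP[+ _] := TcC (x M - x n); move=> /le_lt_trans;
    apply.
  rewrite linearB.
  have -> : T (x M) - T (x n) = (y - T (x n)) - (y - T (x M)).
    by rewrite opprB [RHS]addrC addrA subrK.
  rewrite (le_lt_trans (ler_normB _ _))// [X in c * X]splitr mulrDr ltrD//.
    exact: lt_trans (xP n) (MP n Mn).
  exact: lt_trans (xP M) (MP M (leqnn _)).
move=> /cvg_ex[/= l xl]; exists l => //; apply/eqP;
  rewrite eq_sym -subr_eq0 -normr_le0.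
have C0 : 0 < `|C| + 1 by rewrite ltr_wpDl.
apply/ler_addgt0Pr => e e0; rewrite add0r.
have e20 : 0 < e / 2 by rewrite divr_gt0.
have [M MP] := eventually_invn_lt e20.
have e3 : 0 < e / 2 / (`|C| + 1) by rewrite divr_gt0.
move/cvgrPdist_lt : xl => /(_ _ e3)[K _ KP].
pose n := maxn M K.
have h1 : `|y - T (x n)| <= e / 2 by apply/ltW/(lt_trans (xP n))/MP;
  exact: leq_maxl.
have h2 : `|T (l - x n)| <= e / 2.
  have /andP[_ h] := TcC (l - x n); apply: (le_trans h).
  have /= h3 := KP n (leq_maxr _ _).
  apply: (@le_trans _ _ ((`|C| + 1) * `|l - x n|)).
    by rewrite ler_wpM2r// (le_trans (ler_norm C))// lerDl.
  by rewrite mulrC -ler_pdivlMr// ltW.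
have -> : y - T l = (y - T (x n)) - T (l - x n) by rewrite linearB opprB addrA
  subrK.
by rewrite (le_trans (ler_normB _ _))//; lra.
Qed.

(** * Choice of the scale and the exponent, and the final embedding *)

Lemma bernoulli_power (R : realType) (a : R) : 0 < a ->
  exists n, 4 <= (1 + a) ^+ n.+1.
Proof.
move=> a0; have a1 : -1 <= a by apply: le_trans (ltW a0); rewrite oppr_le0.
exists (Num.bound (4 / a)); apply: le_trans (bernoulli_le _ a1).
have : 4 / a < (Num.bound (4 / a))%:R by apply: archi_boundP;
  rewrite divr_ge0// ltW.
rewrite ltr_pdivrMr// -natr1; lra.
Qed.

Lemma equivalent_norm_normlike (R : realType) (X : normedModType R) (N : X -> R) :
  equivalent_norm N -> normlike N.
Proof.
move=> [ND NZ [c [C [c0 h]]]]; split=> // x.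
by have /andP[h1 _] := h x; apply: le_trans h1; rewrite mulr_ge0// ltW.
Qed.

(** Any t with modulus below t / 24 will do; the strict inequality lets a single V realise the bound
    for each x. *)
Lemma aus_flat_at (R : realType) (X : normedModType R) (N : X -> R) :
  aus N -> exists t, [/\ 0 < t, t <= 1 & flat_at N t].
Proof.
move=> ausN.
have c0 : (0%E < (24^-1 : R)%:E)%E by rewrite lte_fin.
have := ausN _ (open_ereal_lt' c0); rewrite !near_simpl => near_t.
have : \forall t \near 0^'+, [/\ 0 < t, t <= 1 &
    (aus_modulus N t * (t^-1)%:E < (24^-1 : R)%:E)%E].
  near=> t; split; [near: t; exact: nbhs_right_gt|near: t;
    exact: nbhs_right_le|near: t; exact: near_t].
move=> /filter_ex[t [t0 t1 ht]]; exists t; split=> // x x1.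
rewrite lte_pdivrMr// in ht.
move: ht; rewrite /aus_modulus lteBlDr// -EFinM -EFinD => ht.
have := le_lt_trans (ereal_sup_ubound (ex_intro2 _ _ x x1 erefl)) ht.
move=> /ereal_inf_lt[_ [V [[V0 VD] _ [n [e Ve]]] <-] hV].
exists n, V, e; split.
- split; first by move: V0; rewrite inE.
  by move=> a y z Vy Vz; have := VD a y z; rewrite !inE; exact.
- exact: Ve.
- move=> y Vy Ny; rewrite -lee_fin.
  apply: (@le_trans _ _ (ereal_sup [set (N (x + t *: z))%:E | z in V `&` [set z |
    N z <= 1]]%R)).
    by apply: ereal_sup_ubound; exists y.
  by apply/ltW; rewrite addrC [t / 24]mulrC.
Unshelve. all: by end_near. Qed.

Lemma embeds_in_tree_space (R : realType) (X : normedModType R) (N : X -> R) :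
  separable_space X -> reflexive_space X -> equivalent_norm N -> aus N ->
  exists n (T : {linear X -> gauge_banach (@tree_gauge R n.+1)}) (c C : R),
    0 < c /\ forall x, c * `|x| <= `|T x| <= C * `|x|.
Proof.
move=> sX rX eN /aus_flat_at[t [t0 t1 flat]].
have normN := equivalent_norm_normlike eN.
have [_ _ [c [C [c0 cNC]]]] := eN.
have cN x : c * `|x| <= N x by have /andP[] := cNC x.
have NC x : N x <= C * `|x| by have /andP[] := cNC x.
have [x xd] := dense_sequence sX.
have x_dense y (e : R) : 0 < e -> exists k, N (y - x k) < e.
  move=> e0; have C0 : 0 < `|C| + 1 by rewrite ltr_wpDl.
  have [|k yk] := xd y (e / (`|C| + 1)); first by rewrite divr_gt0.
  exists k; apply: (le_lt_trans (NC _)).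
  apply: (@le_lt_trans _ _ ((`|C| + 1) * `|y - x k|)).
    by rewrite ler_wpM2r// (le_trans (ler_norm C))// lerDl.
  by rewrite mulrC -ltr_pdivlMr.
have sN : sublin N.
  by split=> [y z|a y a0]; [exact: nlD|rewrite nlZ// gtr0_norm].
have norming y : exists2 f, unit_functional N f & f y = N y.
  have [f [lf fN fy]] := norming_functional y sN (nlN normN).
  by exists f.
have [d [d_lin d_le d0 d_dense']] := functional_sequence (separable_predual sX rX)
  (ex_intro2 _ _ c c0 cN).
have d_dense f e : unit_functional N f -> 0 < e ->
    exists n, forall y, `|f y - d n y| <= e * N y.
  by move=> [lf fN] e0; apply: d_dense' => //; exists C.
have [L [p pP]] := weak_star_paths normN d_lin d_le d_dense x t0 t1 flat.
have d60 : 0 < t / 6 by rewrite divr_gt0.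
have d61 : t / 6 <= 1 by lra.
(* The exponent n + 1 is fixed by the smoothness of X, through the growth constant delta = t / 6. *)
have [n hq] := @bernoulli_power R (t / 6 / 2) ltac:(lra).
have bD f i j : bdd N (fun y => d (p f j) y - d (p f i) y).
  by apply: bdd_sub; exact: (d_bdd d_lin d_le).
have /choice[H HP] (f : X -> R) : exists H : nat -> R, unit_functional N f ->
    [/\ forall j, 0 <= H j, forall j, H j <= 4 * 4 ^+ n.+1 + 10 &
      forall i j, (i < j)%N ->
        H i + dual_norm_for N (fun y => d (p f j) y - d (p f i) y) ^+ n.+1 <= H j].
  have [uf|] := pselect (unit_functional N f); last by exists (fun=> 0).
  have [_ _ grow _ _] := pP f uf.
  (* The bound M = 4 holds for a difference of two functionals bounded by 2 N. *)
  have [||||H HP] := @variation_measure R (t / 6) n.+1 d60 d61 (ltn0Sn n) hq _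
    (level_error t) 4 _ _ _ grow.
  - by move=> i; apply/ltW/level_error_gt0.
  - by move=> i j; exact: level_error_mono.
  - move=> i; rewrite /level_error.
    rewrite ler_pdivrMr//.
    have : t / 6 * (4 ^+ i)^-1 <= t / 6 * (2 ^+ i)^-1.
      by rewrite ler_pM2l// lef_pV2 ?posrE ?exprn_gt0// lerXn2r ?nnegrE//; lra.
    lra.
  - move=> i j; apply: dual_norm_for_lub => // y.
    have := ler_normB (d (p f j) y) (d (p f i) y).
    have := d_le (p f j) y; have := d_le (p f i) y; lra.
  by exists H.
have p0 f : unit_functional N f -> p f 0%N = 0%N by case/pP.
have pL f : unit_functional N f -> forall i, (p f i <= L i)%N by case/pP.
have H0 f : unit_functional N f -> forall i, 0 <= H f i by case/HP.
have HC f : unit_functional N f -> forall i, H f i <= 4 * 4 ^+ n.+1 + 10 by case/HP.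
have Hp f : unit_functional N f -> forall i j, (i < j)%N ->
    H f i + dual_norm_for N (fun y => d (p f j) y - d (p f i) y) ^+ n.+1 <= H f j.
  by case/HP.
have p_tail f : unit_functional N f -> forall i j k,
    (0 < i)%N -> (i <= j)%N -> (k <= i)%N ->
    `|d (p f j) (x k) - d (p f i) (x k)| <= 2 * (1 + N (x k)) / 4 ^+ i.
  by case/pP.
have p_cvg f : unit_functional N f -> forall i k, (0 < i)%N -> (k <= i)%N ->
    `|f (x k) - d (p f i) (x k)| <= (1 + N (x k)) / 4 ^+ i.
  by case/pP.
pose tau := tree_coord N d p H.
have tau_le y : tree_le n.+1 (tau y) (N y).
  exact: (tree_coord_le normN d_lin d_le x_dense norming (ltn0Sn n) p0 pL H0 HC Hp
    p_tail).
have tau_ge y r : 0 <= r -> tree_bound n.+1 (tau y) r -> N y <= (4 * 4 ^+ n.+1 +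
  10 + 3) * r.
  exact: (tree_coord_below normN d_lin d_le d0 x_dense norming (ltn0Sn n) p0 H0 HC
    Hp p_cvg).
have tau_fin y : tau y \in gauge_fin (@tree_gauge R n.+1).
  by apply/gauge_finP; exists (N y); exact: tau_le.
pose T y : gauge_banach (@tree_gauge R n.+1) := Gspace (tau_fin y).
have T_linear : linear T.
  move=> a y z; apply: val_inj; apply/funext => s.
  have [tD tZ] := tree_coord_lin N d_lin p H s.
  change (tau (a *: y + z) s = a * tau y s + tau z s).
  by rewrite /tau tD tZ.
pose K : R := 4 * 4 ^+ n.+1 + 10 + 3.
have K0 : 0 < K by rewrite !addr_gt0// mulr_gt0// exprn_gt0.
pose TL : {linear X -> gauge_banach (@tree_gauge R n.+1)} :=
  HB.pack T (GRing.isLinear.Build R X (gauge_banach (@tree_gauge R n.+1)) *:%R T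
    T_linear).
exists n, TL, (c / K), C; split; first by rewrite divr_gt0.
move=> y; change (c / K * `|y| <= `|T y| <= C * `|y|).
have h : N y <= K * `|T y|.
  apply: tau_ge; first exact: normr_ge0.
  by have [] := gauge_norm_self (T y).
apply/andP; split.
  rewrite mulrAC ler_pdivrMr//; apply: (le_trans (cN y)).
  by rewrite mulrC.
by apply: le_trans (NC y); apply/gspace_norm_le; exact: tau_le.
Qed.

Theorem proposition5p6 (R : realType) :
  exists Y : completeNormedModType R,
    [/\ infinite_dim Y, separable_space Y, separable_space (dual Y),
        (forall X : completeNormedModType R,
           infinite_dim X -> separable_space X -> reflexive_space X ->
           (exists N : X -> R, equivalent_norm N /\ aus N) ->
           iso_closed_subspace X Y)
      & exists E : nat -> completeNormedModType R,
          (forall n, [/\ infinite_dim (E n), separable_space (E n)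
                       & aus (fun x : E n => `|x|)]) /\
          is_l2_sum Y E].
Proof.
exists (gauge_banach (l2_gauge (fun n => @tree_gauge R n.+1))); split.
- exact: Y_infinite_dim.
- exact: Y_separable.
- exact: Y_dual_separable.
- move=> X _ sX rX [N [eN aN]].
  have [n [T [c [C [c0 TcC]]]]] := embeds_in_tree_space sX rX eN aN.
  pose S x := l2_inj (g := fun k => @tree_gauge R k.+1) (T x).
  have S_linear : linear S.
    by move=> a x y; rewrite /S [T _]linearP [l2_inj _]linearP.
  pose SL : {linear X -> gauge_banach (l2_gauge (fun n => @tree_gauge R n.+1))} :=
    HB.pack S (GRing.isLinear.Build R X _ *:%R S S_linear).
  have SB x : c * `|x| <= `|SL x| <= C * `|x|.
    by have -> : `|SL x| = `|T x| by exact: l2_norm_inj.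
  exists SL; split; first exact: closed_range c0 SB.
  by exists c, C.
- exists (fun n => gauge_banach (@tree_gauge R n.+1)); split.
    move=> n; split.
    + exact: tree_infinite_dim.
    + exact: tree_separable.
    + exact: tree_aus.
  exact: l2_is_l2_sum.
Qed.
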